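(* Let $B=(B^1,\dots,B^d)$ be a $d$-dimensional $G$-Brownian motion on the $G$-expectation space $(\Omega,L_{ip}(\Omega),\hat{\mathbb E})$, and let $T>0$, $n\ge1$. For each $\delta\ge0$ let $\xi^\delta\in L_G^1(\Omega_T;\mathbb R^n)$ and let $f^\delta,g^\delta_{ij}$ ($i,j=1,\dots,d$) be (random) $\mathbb R^n$-valued functions of $(t,y)\in[0,T]\times\mathbb R^n$ with $f^\delta(\cdot,y),g^\delta_{ij}(\cdot,y)\in M_G^1(0,T;\mathbb R^n)$ for every $y\in\mathbb R^n$. Assume that for all $\delta\ge0$, $t\in[0,T]$, $y,y_1,y_2\in\mathbb R^n$: (a) $|f^\delta(t,y)|+\sum_{i,j=1}^d|g^\delta_{ij}(t,y)|\le\beta(t)+C|y|$; (b) $|f^\delta(t,y_1)-f^\delta(t,y_2)|+\sum_{i,j=1}^d|g^\delta_{ij}(t,y_1)-g^\delta_{ij}(t,y_2)|\le\rho(|y_1-y_2|)$, where $C>0$, $\beta\in M_G^1([0,T];\mathbb R^+)$, and $\rho:(0,+\infty)\to(0,+\infty)$ is a continuous, increasing, concave function with $\rho(0+)=0$ (set $\rho(0):=0$) and $\int_0^1\frac1{\rho(r)}\,dr=+\infty$ (with $C,\beta,\rho$ independent of $\delta$). For each $\delta\ge0$ let $Y^\delta$ be the solution of $$Y^\delta_t=\hat{\mathbb E}\Big[\xi^\delta+\int_t^Tf^\delta(s,Y^\delta_s)\,ds+\sum_{i,j=1}^d\int_t^Tg^\delta_{ij}(s,Y^\delta_s)\,d\langle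 B^i,B^j\rangle_s\,\Big|\,\Omega_t\Big],\qquad t\in[0,T].$$ Assume further that, as $\delta\to0$, $\hat{\mathbb E}[|\xi^\delta-\xi^0|]\to0$ and, for all $t\in[0,T]$ and for each $\phi\in\{f,g_{ij}:i,j=1,\dots,d\}$, $$\int_t^T\hat{\mathbb E}\big[|\phi^\delta(s,Y^0_s)-\phi^0(s,Y^0_s)|\big]\,ds\to0.$$ Then, as $\delta\to0$, $$\forall\,t\in[0,T],\qquad\hat{\mathbb E}\big[|Y^\delta_t-Y^0_t|\big]\to0.$$
   Context: Sublinear expectations. A sublinear expectation $\mathbb E$ on a linear space $\mathcal H$ of real functions on a set $\Omega$ (with $\mathcal H$ containing constants and closed under $|\cdot|$ and under composition with functions in $C_{l,Lip}$) is a functional $\mathbb E:\mathcal H\to\mathbb R$ that is monotone, preserves constants, is subadditive and positively homogeneous. $C_{l,Lip}(\mathbb R^k)$ is the space of $\varphi$ with $|\varphi(x)-\varphi(y)|\le C(1+|x|^m+|y|^m)|x-y|$ for some $C>0$, $m\in\mathbb N$. Random vectors $X,Y$ are identically distributed, $X\stackrel d=Y$, if $\mathbb E_1[\varphi(X)]=\mathbb E_2[\varphi(Y)]$ for all $\varphi\in C_{l,Lip}$ (each under its own expectation); $Y$ is independent from $X$ if $\mathbb E[\varphi(X,Y)]=\mathbb E\big[\mathbb E[\varphi(x,Y)]_{x=X}\big]$ for all $\varphi\in C_{l,Lip}$. A random vector $\xi$ is $G$-normal if $a\xi+b\bar\xi\stackrel d=\sqrt{a^2+b^2}\,\xi$ for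 all $a,b\ge0$, where $\bar\xi\stackrel d=\xi$ is independent from $\xi$. $G$-Brownian motion. $\Omega=C_0^d(\mathbb R^+)$ is the space of continuous $\mathbb R^d$-valued paths starting at $0$, $B_t(\omega)=\omega_t$ the canonical process, $L_{ip}(\Omega_T)=\{\varphi(B_{t_1},\dots,B_{t_m}): m\ge1,\ t_i\in[0,T],\ \varphi\in C_{l,Lip}(\mathbb R^{d\times m})\}$, $L_{ip}(\Omega)=\bigcup_n L_{ip}(\Omega_n)$. Fix a $d$-dimensional $G$-normal $\xi$. The $G$-expectation $\hat{\mathbb E}$ on $L_{ip}(\Omega)$ is the sublinear expectation with $\hat{\mathbb E}[\varphi(B_{t_1}-B_{t_0},\dots,B_{t_m}-B_{t_{m-1}})]=\widetilde{\mathbb E}[\varphi(\sqrt{t_1-t_0}\,\xi_1,\dots,\sqrt{t_m-t_{m-1}}\,\xi_m)]$ for $0=t_0<\dots<t_m$, where $\xi_i\stackrel d=\xi$ and $\xi_{i+1}$ is independent from $(\xi_1,\dots,\xi_i)$. Under $\hat{\mathbb E}$, $B$ is called a $G$-Brownian motion. The conditional $G$-expectation is $\hat{\mathbb E}[\varphi(B_{t_1}-B_{t_0},\dots,B_{t_m}-B_{t_{m-1}})|\Omega_{t_j}]=\psi(B_{t_1}-B_{t_0},\dots,B_{t_j}-B_{t_{j-1}})$ with $\psi(x_1,\dots,x_j)=\widetilde{\mathbb E}[\varphi(x_1,\dots,x_j,\sqrt{t_{j+1}-t_j}\,\xi_{j+1},\dots,\sqrt{t_m-t_{m-1}}\,\xi_m)]$;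 it extends continuously to $L_G^1$ and is applied componentwise to $\mathbb R^n$-valued variables. Spaces and integrals. $L_G^p(\Omega_T)$, $p\ge1$, is the completion of $L_{ip}(\Omega_T)$ under $(\hat{\mathbb E}[|X|^p])^{1/p}$; $\hat{\mathbb E}$ extends continuously. $M_G^p(0,T;\mathbb R^n)$ is the completion of the simple processes $\eta_t=\sum_{k=0}^{N-1}\xi_k\mathbf 1_{[t_k,t_{k+1})}(t)$ ($0=t_0<\dots<t_N=T$, $\xi_k\in L_G^p(\Omega_{t_k})$, $\mathbb R^n$-valued) under $\big(\int_0^T\hat{\mathbb E}[|\eta_t|^p]dt\big)^{1/p}$. For simple processes, $\int_0^T\eta_s\,ds=\sum\xi_k(t_{k+1}-t_k)$ and $\int_0^T\eta_s\,d\langle B^i,B^j\rangle_s=\sum\xi_k(\langle B^i,B^j\rangle_{t_{k+1}}-\langle B^i,B^j\rangle_{t_k})$, extended by continuity to $M_G^1$. Here $\langle B^i,B^j\rangle_t$ is the limit of $\sum_k(B^i_{t_{k+1}}-B^i_{t_k})(B^j_{t_{k+1}}-B^j_{t_k})$ along partitions of $[0,t]$ with mesh tending to $0$. Convention. Solutions $Y^\delta$ are sought in $M_G^1(0,T;\mathbb R^n)$; the paper's standing fact is that under the stated assumptions the equation has a unique solution for every $\delta\ge0$. The value $Y^\delta_t$ for individual $t$ is the one given by the right-hand side of the equation. *)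

(* Defs.v *)
From HB Require Import structures.
From mathcomp Require Import all_boot all_order all_algebra.
From mathcomp Require Import all_classical all_reals all_analysis.
Set Implicit Arguments.
Unset Strict Implicit.
Unset Printing Implicit Defensive.
Import Order.TTheory GRing.Theory Num.Theory.
Import numFieldNormedType.Exports.
Local Open Scope classical_set_scope.
Local Open Scope ring_scope.

(* Euclidean (Frobenius) norm; the norm that the library puts on matrices is
   the sup norm. *)
Definition enorm (R : realType) (p q : nat) (A : 'M[R]_(p, q)) : R :=
  Num.sqrt (\sum_i \sum_j A i j ^+ 2).

(* C_{l,Lip}(R^{p x q}). *)
Definition ClLip (R : realType) (p q : nat) (phi : 'M[R]_(p, q) -> R) : Prop :=
  exists (C : R) (m : nat), 0 < C /\
    forall x y, `|phi x - phi y| <=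
      C * (1 + enorm x ^+ m + enorm y ^+ m) * enorm (x - y).

(** * Sublinear expectations *)

Record rv_space (R : realType) (U : Type) (H : set (U -> R)) : Prop := RvSpace {
  rv_lin : forall (a : R) X Y, H X -> H Y -> H (fun u => a * X u + Y u);
  rv_cst : forall c : R, H (fun=> c);
  rv_abs : forall X, H X -> H (fun u => `|X u|);
  rv_comp : forall (k : nat) (X : 'I_k -> U -> R) (phi : 'rV[R]_k -> R),
    (forall i, H (X i)) -> ClLip phi -> H (fun u => phi (\row_i X i u)) }.

Record sublinear_expectation (R : realType) (U : Type) (H : set (U -> R))
    (E : (U -> R) -> R) : Prop := SublinearExpectation {
  sub_mono : forall X Y, H X -> H Y -> (forall u, X u <= Y u) -> E X <= E Y;
  sub_cst : forall c : R, E (fun=> c) = c;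
  sub_add : forall X Y, H X -> H Y -> E (fun u => X u + Y u) <= E X + E Y;
  sub_homo : forall (a : R) X, 0 <= a -> H X -> E (fun u => a * X u) = a * E X }.

Record sublin_space (R : realType) := SublinSpace {
  carrier :> Type;
  rv : set (carrier -> R);
  expect : (carrier -> R) -> R;
  rvP : rv_space rv;
  expectP : sublinear_expectation rv expect }.

Section random_vectors.
Context {R : realType}.

(* Random vectors take values in matrices, so that a family of p vectors of R^d
   is a random p x d matrix. *)
Definition is_rvec (S : sublin_space R) p q (X : S -> 'M[R]_(p, q)) : Prop :=
  forall i j, rv (fun u => X u i j).

Definition eq_law (S1 S2 : sublin_space R) p q
    (X1 : S1 -> 'M[R]_(p, q)) (X2 : S2 -> 'M[R]_(p, q)) : Prop :=
  forall phi : 'M[R]_(p, q) -> R, ClLip phi ->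
    expect (phi \o X1) = expect (phi \o X2).

(* [indep X Y]: Y is independent from X (the relation is not symmetric). *)
Definition indep (S : sublin_space R) p1 p2 q
    (X : S -> 'M[R]_(p1, q)) (Y : S -> 'M[R]_(p2, q)) : Prop :=
  forall phi : 'M[R]_(p1 + p2, q) -> R, ClLip phi ->
    expect (fun u => phi (col_mx (X u) (Y u))) =
    expect (fun u => expect (fun v => phi (col_mx (X u) (Y v)))).

Definition is_Gnormal (S : sublin_space R) d (X : S -> 'rV[R]_d) : Prop :=
  is_rvec X /\
  exists X' : S -> 'rV[R]_d, [/\ is_rvec X', eq_law X' X, indep X X' &
    forall a b : R, 0 <= a -> 0 <= b ->
      eq_law (fun u => a *: X u + b *: X' u)
             (fun u => Num.sqrt (a ^+ 2 + b ^+ 2) *: X u)].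

End random_vectors.

(** * The canonical space and the G-expectation *)

(* C_0^d(R^+): a path is extended by 0 to negative times, so that each element
   of the space has exactly one representative. *)
Record path_space (R : realType) (d : nat) := Path {
  path_fun :> R -> 'rV[R]_d;
  path_cont : continuous path_fun;
  path_neg0 : forall t : R, t <= 0 -> path_fun t = 0 }.

(* t 0 = 0 < t 1 < ... < t m; the values t i for i > m are irrelevant. *)
Definition time_grid (R : realType) (m : nat) (t : nat -> R) : Prop :=
  t 0 = 0 /\ forall i, (i < m)%N -> t i < t i.+1.

Section canonical_space.
Context {R : realType} {d : nat}.
Local Notation Omega := (path_space R d).

(* L_ip(Omega_T). *)
Definition Lip_upto (T : R) : set (Omega -> R) :=
  [set X | exists (m : nat) (t : 'I_m -> R) (phi : 'M[R]_(m, d) -> R),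
    [/\ (0 < m)%N, forall i, 0 <= t i <= T, ClLip phi &
        X = fun w : Omega => phi (\matrix_(i < m) w (t i))]].

(* L_ip(Omega). *)
Definition Lip : set (Omega -> R) := \bigcup_n Lip_upto n%:R.

Definition increments (m : nat) (t : nat -> R) (w : Omega) : 'M[R]_(m, d) :=
  \matrix_(i < m) (w (t i.+1) - w (t i)).

End canonical_space.

(* xi i is the vector written xi_{i+1} in the usual 1-based numbering, and
   xi 0 is the given G-normal vector. *)
Record Gexpectation (R : realType) (d : nat) := GExpectation {
  Gbase : sublin_space R;
  xi : nat -> Gbase -> 'rV[R]_d;
  xi_normal : is_Gnormal (xi 0);
  xi_rvec : forall i, is_rvec (xi i);
  xi_law : forall i, eq_law (xi i) (xi 0);
  xi_indep : forall i,
    indep (fun u => \matrix_(k < i.+1) xi k u) (xi i.+1);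
  Ehat : (path_space R d -> R) -> R;
  EhatP : sublinear_expectation Lip Ehat;
  Ehat_fdd : forall (m : nat) (t : nat -> R) (phi : 'M[R]_(m, d) -> R),
    time_grid m t -> ClLip phi ->
    Ehat (fun w => phi (increments m t w)) =
    expect (fun u => phi (\matrix_(i < m) (Num.sqrt (t i.+1 - t i) *: xi i u))) }.

(** * The spaces L_G^1 *)

(* The completion of L_ip is presented by Cauchy sequences: a point of
   L_G^1(Omega; R^n) is a sequence X of random vectors with components in L_ip
   that satisfies [LG1 Lip X]. Two such sequences are the same point when they
   satisfy [LGeq]; Leibniz equality is never meaningful. Real random variables
   are the case n = 1. *)
Definition LGseq (R : realType) (d n : nat) := nat -> path_space R d -> 'rV[R]_n.

Section completion.
Context {R : realType} {d : nat} (G : Gexpectation R d).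
Local Notation Omega := (path_space R d).
Local Notation E := (Ehat G).

(* [LG1 (Lip_upto T)] is L_G^1(Omega_T; R^n), [LG1 Lip] is L_G^1(Omega; R^n). *)
Definition LG1 (H : set (Omega -> R)) n (X : LGseq R d n) : Prop :=
  (forall k j, H (fun w => X k w 0 j)) /\
  forall e : R, 0 < e ->
    \forall k & l \near \oo, E (fun w => enorm (X k w - X l w)) < e.

(* The continuous extension of E[|X|]. *)
Definition LGnorm n (X : LGseq R d n) : R :=
  lim ((fun k => E (fun w => enorm (X k w))) @ \oo).

Definition LGsub n (X Y : LGseq R d n) : LGseq R d n := fun k w => X k w - Y k w.

Definition LGdist n (X Y : LGseq R d n) : R := LGnorm (LGsub X Y).

Definition LGeq n (X Y : LGseq R d n) : Prop := LGdist X Y = 0.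

(* A random variable of L_ip as a point of the completion. *)
Definition LGcst n (X : Omega -> 'rV[R]_n) : LGseq R d n := fun=> X.

(* U <= V in L_G^1, that is (U - V)^+ = 0 in L_G^1, for the real random
   variables represented by the sequences U and V. *)
Definition LGle (U V : nat -> Omega -> R) : Prop :=
  (fun k => E (fun w => Num.max 0 (U k w - V k w))) @ \oo --> 0.

(* P = Q c in L_G^1, as the closure of the pointwise product on L_ip: along
   some sequences representing c and Q, the products converge to P in L_G^1.
   (Products of arbitrary representatives need not be Cauchy.) *)
Definition is_prod n (c : LGseq R d n) (Q : LGseq R d 1) (P : LGseq R d n) :=
  LG1 Lip P /\
  exists (c' : LGseq R d n) (Q' : LGseq R d 1),
    [/\ LG1 Lip c', LG1 Lip Q', LGeq c' c, LGeq Q' Q &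
        (fun k => E (fun w => enorm (Q' k w 0 0 *: c' k w - P k w))) @ \oo --> 0].

(** * Conditional G-expectation *)

Definition cexp_Lip (s : R) (X Z : Omega -> R) : Prop :=
  exists (m : nat) (t : nat -> R) (phi : 'M[R]_(m, d) -> R) (j : nat),
    [/\ time_grid m t, (j <= m)%N, t j = s & ClLip phi] /\
    X = (fun w => phi (increments m t w)) /\
    Z = (fun w => expect (fun u => phi (\matrix_(i < m)
          (if (i < j)%N then w (t i.+1) - w (t i)
           else Num.sqrt (t i.+1 - t i) *: @xi _ _ G i u)))).

(* Z = E[X | Omega_s] for X in L_G^1(Omega; R^n), componentwise. *)
Definition is_cexp n (s : R) (X Z : LGseq R d n) : Prop :=
  forall i : 'I_n, exists U V : nat -> Omega -> R,
    [/\ forall k, cexp_Lip s (U k) (V k),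
        (fun k => E (fun w => `|U k w - X k w 0 i|)) @ \oo --> 0 &
        (fun k => E (fun w => `|V k w - Z k w 0 i|)) @ \oo --> 0].

(** * Processes *)

(* Upper Lebesgue integral over D of a function h >= 0; it is the Lebesgue
   integral when h is Lebesgue measurable, even if h is not Borel (the
   measurable sets of [lebesgue_measure] are the Borel sets). *)
Definition upper_int (D : set R) (h : R -> R) : \bar R :=
  ereal_inf [set (\int[@lebesgue_measure R]_(s in D) (g s)%:E)%E |
    g in [set g : R -> R | measurable_fun D g /\
                           forall s, D s -> 0 <= g s /\ h s <= g s]].

Record simple_process n := SimpleProcess {
  sp_size : nat;
  sp_time : nat -> R;
  sp_coef : nat -> LGseq R d n }.

Definition is_simple n (T : R) (S : simple_process n) : Prop :=
  [/\ time_grid (sp_size S) (sp_time S), sp_time S (sp_size S) = T &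
      forall k, (k < sp_size S)%N -> LG1 (Lip_upto (sp_time S k)) (sp_coef S k)].

Definition sp_val n (S : simple_process n) (s : R) : LGseq R d n :=
  fun m w => \sum_(k < sp_size S)
    (if sp_time S k <= s < sp_time S k.+1 then sp_coef S k m w else 0).

Definition simple_cvg n (T : R) (S : nat -> simple_process n)
    (eta : R -> LGseq R d n) : Prop :=
  (forall m, is_simple T (S m)) /\
  (fun m => upper_int `[0, T] (fun s => LGdist (sp_val (S m) s) (eta s)))
    @ \oo --> 0%E.

(* eta in M_G^1(0,T; R^n). The completion of the simple processes is realized
   by the functions s |-> eta s with values in L_G^1 (modulo a.e. equality)
   that are limits of simple processes; such a limit has a version with eta s in
   L_G^1(Omega_s) for every s. *)
Definition MG1 n (T : R) (eta : R -> LGseq R d n) : Prop :=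
  (forall s, 0 <= s <= T -> LG1 (Lip_upto s) (eta s)) /\
  exists S : nat -> simple_process n, simple_cvg T S eta.

(** * Integrals over [t, T] *)

(* The integral of S 1_[t, T]. *)
Definition sp_int n (S : simple_process n) (t : R) : LGseq R d n :=
  fun m w => \sum_(k < sp_size S)
    (Num.max t (sp_time S k.+1) - Num.max t (sp_time S k)) *: sp_coef S k m w.

Definition is_int n (T : R) (eta : R -> LGseq R d n) (t : R) (I : LGseq R d n) :=
  LG1 (Lip_upto T) I /\
  exists S : nat -> simple_process n, simple_cvg T S eta /\
    (fun m => LGdist (sp_int (S m) t) I) @ \oo --> (0 : R).

(* Q is <B^i,B^j>_t. *)
Definition is_qv (i j : 'I_d) (t : R) (Q : LGseq R d 1) : Prop :=
  LG1 (Lip_upto t) Q /\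
  forall e : R, 0 < e -> exists2 h : R, 0 < h &
    forall (m : nat) (p : nat -> R), time_grid m p -> p m = t ->
      (forall k, (k < m)%N -> p k.+1 - p k < h) ->
      LGdist (LGcst (fun w : Omega => \row__ \sum_(k < m)
        ((w (p k.+1) 0 i - w (p k) 0 i) * (w (p k.+1) 0 j - w (p k) 0 j)))) Q
      < e.

(* Integral of a simple process against s |-> q s, where q is <B^i,B^j>. *)
Definition is_sp_int_qv n (q : R -> LGseq R d 1) (S : simple_process n) (t : R)
    (I : LGseq R d n) : Prop :=
  exists P : nat -> LGseq R d n,
    (forall k, (k < sp_size S)%N ->
      is_prod (sp_coef S k)
        (LGsub (q (Num.max t (sp_time S k.+1))) (q (Num.max t (sp_time S k))))
        (P k)) /\
    I = fun m w => \sum_(k < sp_size S) P k m w.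

Definition is_int_qv n (q : R -> LGseq R d 1) (T : R) (eta : R -> LGseq R d n)
    (t : R) (I : LGseq R d n) : Prop :=
  LG1 (Lip_upto T) I /\
  exists (S : nat -> simple_process n) (J : nat -> LGseq R d n),
    [/\ simple_cvg T S eta, forall m, is_sp_int_qv q (S m) t (J m) &
        (fun m => LGdist (J m) I) @ \oo --> (0 : R)].

(** * Substituting a random vector into a random function *)

(* Points of the grid (N+1)^{-1} Z^n in [-(N+1), N+1]^n. *)
Definition grid_pt n (N : nat) (a : {ffun 'I_n -> 'I_(2 * N.+1 ^ 2).+1}) :
    'rV[R]_n := \row_i ((a i)%:R / N.+1%:R - N.+1%:R).

(* Multilinear hat functions of mesh 1/(N+1): over the grid they form a
   Lipschitz partition of unity on the box. *)
Definition hat n (N : nat) (a y : 'rV[R]_n) : R :=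
  \prod_i Num.max 0 (1 - N.+1%:R * `|y 0 i - a 0 i|).

(* sum_a hat_a(Y) F(a): the piecewise multilinear interpolant of the random
   function F on the grid, evaluated at Y. *)
Definition interp n p (N : nat) (F : 'rV[R]_n -> LGseq R d p)
    (Y : LGseq R d n) : LGseq R d p :=
  fun k w => \sum_(a : {ffun 'I_n -> 'I_(2 * N.+1 ^ 2).+1})
    hat N (grid_pt a) (Y k w) *: F (grid_pt a) k w.

(* Z = F(Y). The points of L_G^1 are not functions on Omega, so for a random
   function y |-> F y in L_G^1 that is continuous in y, the random variable F(Y)
   is the limit of the interpolants of F on finer and finer grids. When F is
   given by functions w |-> F y w with a common modulus of continuity in y and
   Y is a function of w, this is w |-> F (Y w) w. *)
Definition is_eval n p (F : 'rV[R]_n -> LGseq R d p) (Y : LGseq R d n)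
    (Z : LGseq R d p) : Prop :=
  LG1 Lip Z /\ (fun N => LGdist (interp N F Y) Z) @ \oo --> (0 : R).

(* Z is the process s |-> f(s, Y_s) of M_G^1(0,T; R^n). *)
Definition is_subst n (T : R) (f : R -> 'rV[R]_n -> LGseq R d n)
    (Y Z : R -> LGseq R d n) : Prop :=
  MG1 T Z /\ forall s, 0 <= s <= T -> is_eval (f s) (Y s) (Z s).

(** * The equation *)

(* Y_t = E[zeta + int_t^T f(s, Y_s) ds
              + sum_{i,j} int_t^T g_ij(s, Y_s) d<B^i,B^j>_s | Omega_t]
   for every t in [0, T], where QV i j s is <B^i,B^j>_s. *)
Definition is_solution n (QV : 'I_d -> 'I_d -> R -> LGseq R d 1) (T : R)
    (zeta : LGseq R d n) (f : R -> 'rV[R]_n -> LGseq R d n)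
    (g : 'I_d -> 'I_d -> R -> 'rV[R]_n -> LGseq R d n)
    (Y : R -> LGseq R d n) : Prop :=
  MG1 T Y /\
  exists (F : R -> LGseq R d n) (K : 'I_d -> 'I_d -> R -> LGseq R d n),
    [/\ is_subst T f Y F, forall i j, is_subst T (g i j) Y (K i j) &
     forall t, 0 <= t <= T ->
       exists (I : LGseq R d n) (J : 'I_d -> 'I_d -> LGseq R d n),
         [/\ is_int T F t I, forall i j, is_int_qv (QV i j) T (K i j) t (J i j) &
          is_cexp t
            (fun k w => zeta k w + I k w + \sum_i \sum_j J i j k w) (Y t)]].

(* For every t in [0, T], the integral over [t, T] of
   E[|phi^delta(s, Y_s) - phi^0(s, Y_s)|] tends to 0 as delta -> 0+. *)
Definition coef_cvg n (T : R) (phi : R -> R -> 'rV[R]_n -> LGseq R d n)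
    (Y : R -> LGseq R d n) : Prop :=
  exists Phi : R -> R -> LGseq R d n,
    (forall delta, 0 <= delta -> is_subst T (phi delta) Y (Phi delta)) /\
    forall t, 0 <= t <= T ->
      upper_int `[t, T] (fun s => LGdist (Phi delta s) (Phi 0 s))
        @[delta --> 0^'+] --> 0%E.

End completion.

(* Main.v *)
(* Write u(t) = E|Y^delta_t - Y^0_t|. The conditional expectation is a contraction
   of L_G^1, E|int eta ds| <= int E|eta_s| ds, and
   E|int eta d<B^i,B^j>| <= a_ij int E|eta_s| ds with a_ij = E|xi^i xi^j|, because
   eta_s is independent of the increment of <B^i,B^j> after s. Splitting
   phi^delta(s, Y^delta) - phi^0(s, Y^0) at phi^delta(s, Y^0) and using the modulus
   rho (concavity gives rho(x) <= rho(x0) (1 + x / x0), hence E rho(X) <= 2 rho(x0)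
   when E X <= x0) yields u(t) <= eps_delta + K int_t^T rho(u(s)) ds with
   eps_delta -> 0, where the integral is an upper integral. Osgood's lemma then
   forces u -> 0.

   A functional in L_ip is handled through its dependence on finitely many path
   values, and E[X | Omega_s] becomes w |-> E[X(w up to s, then a new path)].
   This makes the conditional expectation independent of the representation of X,
   and the tower property reduces to the independence of one new increment. *)
Require Import Defs.
From HB Require Import structures.
From mathcomp Require Import all_boot all_order all_algebra.
From mathcomp Require Import all_classical all_reals all_analysis.
From mathcomp Require Import measurable_realfun.
From mathcomp Require Import ring lra.
Set Implicit Arguments.
Unset Strict Implicit.
Unset Printing Implicit Defensive.
Import Order.TTheory GRing.Theory Num.Theory.
Import numFieldNormedType.Exports.
Local Open Scope classical_set_scope.
Local Open Scope ring_scope.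

(** * Euclidean norm *)

Section euclidean_norm.
Context {R : realType}.
Implicit Types p q : nat.

(** Three obstacles shape the argument. Points of L_G^1 are Cauchy sequences and E is only
    sublinear, so an estimate is usually proved between elements of L_ip for each index k and then
    passed to the limsup in k ([ule]). Products need not stay in L_G^1; where one occurs, a uniform
    integrability bound |X_k| <= b + r_k with E[r_k] small ([LG1_ui]) controls the error. Finally,
    no measurability of s |-> E|eta_s| is at hand. An integral bound therefore means the existence
    of a measurable majorant ([dominated]), and Osgood's lemma is applied not to u but to e + eps /
    2 + c V, where V t is the infimum of the bounds available on [t, T]: this function is monotone
    and satisfies Osgood's increment inequality. The threshold eps depends only on rho, the
    constants and eta, so it is fixed before delta. The constant K contains the factor n, because
    conditioning is componentwise, and a factor 2 for each coefficient, from the affine majorant of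
    rho. *)

Lemma enorm_ge0 p q (A : 'M[R]_(p, q)) : 0 <= enorm A.
Proof. exact: sqrtr_ge0. Qed.

Lemma sumsq_ge0 p q (A : 'M[R]_(p, q)) : 0 <= \sum_i \sum_j A i j ^+ 2.
Proof. by apply: sumr_ge0 => i _; apply: sumr_ge0 => j _; exact: sqr_ge0. Qed.

Lemma enorm_sq p q (A : 'M[R]_(p, q)) :
  enorm A ^+ 2 = \sum_i \sum_j A i j ^+ 2.
Proof. by rewrite sqr_sqrtr ?sumsq_ge0. Qed.

Lemma enorm0 p q : enorm (0 : 'M[R]_(p, q)) = 0.
Proof.
by rewrite /enorm big1 ?sqrtr0// => i _; rewrite big1// => j _; rewrite mxE expr0n.
Qed.

Lemma enormZ p q (a : R) (A : 'M[R]_(p, q)) : enorm (a *: A) = `|a| * enorm A.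
Proof.
rewrite /enorm -sqrtr_sqr -sqrtrM ?sqr_ge0//; congr Num.sqrt.
rewrite mulr_sumr; apply: eq_bigr => i _; rewrite mulr_sumr.
by apply: eq_bigr => j _; rewrite mxE exprMn.
Qed.

Lemma enormN p q (A : 'M[R]_(p, q)) : enorm (- A) = enorm A.
Proof. by rewrite -scaleN1r enormZ normrN1 mul1r. Qed.

Lemma enorm_distC p q (A B : 'M[R]_(p, q)) : enorm (A - B) = enorm (B - A).
Proof. by rewrite -opprB enormN. Qed.

Lemma enorm_add p q (A B : 'M[R]_(p, q)) : enorm (A + B) <= enorm A + enorm B.
Proof.
have ge0 := @enorm_ge0 p q.
rewrite -(@ler_pXn2r _ 2)// ?nnegrE ?addr_ge0// sqrrD !enorm_sq.
pose s := \sum_i \sum_j A i j * B i j.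
have -> : \sum_i \sum_j (A + B) i j ^+ 2 =
    \sum_i \sum_j A i j ^+ 2 + s *+ 2 + \sum_i \sum_j B i j ^+ 2.
  rewrite /s -sumrMnl -!big_split/=; apply: eq_bigr => i _.
  rewrite -sumrMnl -!big_split/=; apply: eq_bigr => j _.
  by rewrite mxE sqrrD.
rewrite lerD2r lerD2l lerMn2r/=.
(* Cauchy-Schwarz, from the nonnegative square |b A - a B|^2 *)
set a := enorm A; set b := enorm B.
have h : s * (2 * a * b) <= (a * b) * (2 * a * b).
  have : 0 <= \sum_i \sum_j (b * A i j - a * B i j) ^+ 2.
    by apply: sumr_ge0 => i _; apply: sumr_ge0 => j _; exact: sqr_ge0.
  have -> : \sum_i \sum_j (b * A i j - a * B i j) ^+ 2 =
      b ^+ 2 * a ^+ 2 - s * (2 * a * b) + a ^+ 2 * b ^+ 2.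
    rewrite [a ^+ 2 in X in X - _]enorm_sq [b ^+ 2 in X in _ + X]enorm_sq.
    move: a b => a b; rewrite /s !mulr_sumr mulr_suml -sumrN -!big_split/=.
    apply: eq_bigr => i _; rewrite !mulr_sumr mulr_suml -sumrN -!big_split/=.
    by apply: eq_bigr => j _; ring.
  by move=> hs; nra.
have [ab|] := ltP 0 (a * b); first by rewrite ler_pM2r// in h; nra.
(* [h] says nothing when a b = 0; then one of the matrices is zero and so is s. *)
move=> ab0; have {ab0}: a * b = 0.
  by apply/eqP; rewrite eq_le ab0 mulr_ge0//; exact: enorm_ge0.
move=> /eqP; have zero (M : 'M[R]_(p, q)) : enorm M = 0 -> forall i j, M i j = 0.
  move=> /(congr1 (fun x => x ^+ 2)); rewrite enorm_sq expr0n/= => /eqP.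
  rewrite psumr_eq0; last by move=> i _; apply: sumr_ge0 => j _; exact: sqr_ge0.
  move=> /allP hM i j; have := hM i (mem_index_enum _).
  rewrite implyTb psumr_eq0 => [/allP/(_ j (mem_index_enum _))|k _];
    last exact: sqr_ge0.
  by rewrite implyTb sqrf_eq0 => /eqP.
rewrite mulf_eq0 => /orP[|] /eqP z.
- rewrite z mul0r /s big1// => i _; rewrite big1// => j _.
  by rewrite (zero A)// mul0r.
- rewrite z mulr0 /s big1// => i _; rewrite big1// => j _.
  by rewrite (zero B)// mulr0.
Qed.

Lemma enorm_triangle p q (B A C : 'M[R]_(p, q)) :
  enorm (A - C) <= enorm (A - B) + enorm (B - C).
Proof. by rewrite -[A - C](subrKA B) enorm_add. Qed.

Lemma enorm_sub p q (A B : 'M[R]_(p, q)) : enorm (A - B) <= enorm A + enorm B.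
Proof. by rewrite -(enormN B) enorm_add. Qed.

Lemma enorm_dist p q (A B : 'M[R]_(p, q)) :
  `|enorm A - enorm B| <= enorm (A - B).
Proof.
rewrite ler_norml; apply/andP; split.
- have := enorm_add (B - A) A; rewrite subrK enorm_distC; lra.
- have := enorm_add (A - B) B; rewrite subrK; lra.
Qed.

Lemma enorm_sum p q (I : Type) (r : seq I) (P : pred I) (F : I -> 'M[R]_(p, q)) :
  enorm (\sum_(i <- r | P i) F i) <= \sum_(i <- r | P i) enorm (F i).
Proof.
elim/big_rec2 : _ => [|i x A _ h]; first by rewrite enorm0.
by apply: (le_trans (enorm_add _ _)); rewrite lerD2l.
Qed.

Lemma enorm_coord p q (A : 'M[R]_(p, q)) i j : `|A i j| <= enorm A.
Proof.
rewrite -sqrtr_sqr; apply: ler_wsqrtr.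
rewrite (bigD1 i)//= (bigD1 j)//= -addrA lerDl addr_ge0//.
  by apply: sumr_ge0 => k _; exact: sqr_ge0.
by apply: sumr_ge0 => k _; apply: sumr_ge0 => l _; exact: sqr_ge0.
Qed.

Lemma enorm_le_sum p q (A : 'M[R]_(p, q)) :
  enorm A <= \sum_i \sum_j `|A i j|.
Proof.
have h0 i : 0 <= \sum_(j < q) `|A i j| by apply: sumr_ge0.
rewrite {1}[A]matrix_sum_delta; apply: (le_trans (enorm_sum _ _ _)).
apply: ler_sum => i _; apply: (le_trans (enorm_sum _ _ _)).
apply: ler_sum => j _; rewrite enormZ ler_piMr//.
rewrite /enorm (bigD1 i)//= (bigD1 j)//= mxE !eqxx expr1n big1 ?addr0 => [|k /negbTE kj].
  rewrite big1 ?addr0 ?sqrtr1// => k /negbTE ki.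
  by rewrite big1// => l _; rewrite mxE ki expr0n.
by rewrite mxE kj andbF expr0n.
Qed.

Lemma enorm_row p q (A : 'M[R]_(p, q)) i : enorm (row i A) <= enorm A.
Proof.
apply: ler_wsqrtr; rewrite big_ord1 (bigD1 i)//= -[leLHS]addr0 lerD//.
  by apply: ler_sum => j _; rewrite mxE.
by apply: sumr_ge0 => k _; apply: sumr_ge0 => l _; exact: sqr_ge0.
Qed.

Lemma enorm_rows p q (A : 'M[R]_(p, q)) :
  enorm A <= q%:R * \sum_i enorm (row i A).
Proof.
apply: (le_trans (enorm_le_sum _)); rewrite mulr_sumr; apply: ler_sum => i _.
rewrite -[q in q%:R]card_ord mulr_natl -sumr_const; apply: ler_sum => j _.
by apply: le_trans (enorm_coord (row i A) 0 j); rewrite mxE.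
Qed.

End euclidean_norm.

(** * Functionals of finitely many path values *)

Section growth.
Context {R : realType}.

(** The sum is at most 3 u with u the largest of the three, and u ^+ m is one of the terms on the
    right. *)
Lemma expr_sum3_le (m : nat) (x y z : R) : 0 <= x -> 0 <= y -> 0 <= z ->
  (x + y + z) ^+ m <= 3 ^+ m * (x ^+ m + y ^+ m + z ^+ m).
Proof.
move=> x0 y0 z0.
have [xm ym zm] : [/\ 0 <= x ^+ m, 0 <= y ^+ m & 0 <= z ^+ m].
  by split; exact: exprn_ge0.
have key u : 0 <= u -> x <= u -> y <= u -> z <= u ->
    u ^+ m <= x ^+ m + y ^+ m + z ^+ m ->
    (x + y + z) ^+ m <= 3 ^+ m * (x ^+ m + y ^+ m + z ^+ m).
  move=> u0 xu yu zu hu; apply: (@le_trans _ _ ((3 * u) ^+ m)).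
    by apply: lerXn2r; rewrite ?nnegrE ?mulr_ge0// ?addr_ge0//; lra.
  by rewrite exprMn ler_pM2l// exprn_gt0.
have [xy|/ltW yx] := leP x y; have [yz|/ltW zy] := leP y z.
- by apply: (key z) => //; lra.
- by apply: (key y) => //; lra.
- have [xz|/ltW zx] := leP x z; [apply: (key z)|apply: (key x)] => //; lra.
- by apply: (key x) => //; lra.
Qed.

Lemma le_expr_sum3 (m : nat) (a b : R) : 0 <= a -> 0 <= b ->
  1 + a ^+ m + b ^+ m <= 3 * (1 + a + b) ^+ m.
Proof.
move=> a0 b0.
have h u : 0 <= u -> u <= 1 + a + b -> u ^+ m <= (1 + a + b) ^+ m.
  by move=> u0 hu; apply: lerXn2r => //; rewrite nnegrE; lra.
have := h 1 ler01; have := h a a0; have := h b b0; rewrite expr1n; lra.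
Qed.

(** The weights (1 + |x| + |y|)^m and 1 + |x|^m + |y|^m agree up to constants. The first is the
    convenient one: it is stable under affine substitutions and multiplicative in m. *)
Lemma ClLip_power p q (phi : 'M[R]_(p, q) -> R) (C c : R) (m : nat) :
  0 <= C -> 0 <= c ->
  (forall x y, `|phi x - phi y| <=
     C * (1 + c * enorm x + c * enorm y) ^+ m * enorm (x - y)) ->
  ClLip phi.
Proof.
move=> C0 c0 h; exists ((C + 1) * 3 ^+ m * (1 + c ^+ m)), m; split.
  have c1 := exprn_ge0 m c0; rewrite mulr_gt0//; last lra.
  by rewrite mulr_gt0 ?exprn_gt0//; lra.
move=> x y; apply: (le_trans (h x y)).
rewrite ler_wpM2r ?enorm_ge0//.
have cx : 0 <= c * enorm x by rewrite mulr_ge0 ?enorm_ge0.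
have cy : 0 <= c * enorm y by rewrite mulr_ge0 ?enorm_ge0.
rewrite -!mulrA; apply: ler_pM; [by []|by apply: exprn_ge0; lra|lra|].
apply: (le_trans (expr_sum3_le _ ler01 cx cy)).
rewrite ler_wpM2l ?exprn_ge0// expr1n !exprMn.
have := exprn_ge0 m c0; have := exprn_ge0 m (enorm_ge0 x).
have := exprn_ge0 m (enorm_ge0 y).
set s := enorm y ^+ m; set r := enorm x ^+ m; set e := c ^+ m => s0 r0 e0; nra.
Qed.

Lemma ClLip_le_power p q (phi : 'M[R]_(p, q) -> R) : ClLip phi ->
  exists C m, 0 <= C /\ forall x y, `|phi x - phi y| <=
     C * (1 + enorm x + enorm y) ^+ m * enorm (x - y).
Proof.
case=> C [m [C0 h]]; exists (C * 3), m; split; first by rewrite mulr_ge0// ltW.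
move=> x y; apply: (le_trans (h x y)); rewrite ler_wpM2r ?enorm_ge0//.
by rewrite -mulrA ler_pM2l// le_expr_sum3 ?enorm_ge0.
Qed.

End growth.

Section tame.
Context {R : realType} {d : nat}.
Local Notation Omega := (path_space R d).
Implicit Types (L : seq R) (w : Omega) (X Y : Omega -> R).

Definition pnorm L w : R := \sum_(t <- L) enorm (w t).
Definition pdist L w w' : R := \sum_(t <- L) enorm (w t - w' t).

(* The intrinsic form of membership in L_ip, without reference to a function
   on a space of matrices. *)
Definition tame L X := exists (C : R) (m : nat), 0 <= C /\
  forall w w', `|X w - X w'| <=
    C * (1 + pnorm L w + pnorm L w') ^+ m * pdist L w w'.

Lemma pnorm_ge0 L w : 0 <= pnorm L w.
Proof. by apply: sumr_ge0 => i _; exact: enorm_ge0. Qed.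

Lemma pdist_ge0 L w w' : 0 <= pdist L w w'.
Proof. by apply: sumr_ge0 => i _; exact: enorm_ge0. Qed.

Lemma pdist_pnorm L w w' : pdist L w w' <= pnorm L w + pnorm L w'.
Proof.
by rewrite /pdist /pnorm -big_split/=; apply: ler_sum => i _; exact: enorm_sub.
Qed.

Definition zero_path : Omega.
Proof.
apply: (@Path R d (fun=> 0)) => // t; exact: cvg_cst.
Defined.

Lemma path_ext w w' : (forall t, w t = w' t) -> w = w'.
Proof.
case: w w' => f1 c1 n1 [f2 c2 n2] /= /funext h; subst f2.
by congr Path; exact: Prop_irrelevance.
Qed.

Lemma tame_eq L X w w' : tame L X -> (forall t, t \in L -> w t = w' t) ->
  X w = X w'.
Proof.
case=> C [m [C0 h]] hw; apply/eqP; rewrite -subr_eq0 -normr_le0.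
apply: (le_trans (h w w')).
rewrite [pdist _ _ _]big_seq big1 ?mulr0// => t tL.
by rewrite hw// subrr enorm0.
Qed.

Lemma tame_catl L L' X : tame L X -> tame (L ++ L') X.
Proof.
case=> C [m [C0 h]]; exists C, m; split=> // w w'; apply: (le_trans (h w w')).
have hN v : pnorm L v <= pnorm (L ++ L') v.
  by rewrite /pnorm big_cat/= lerDl; exact: pnorm_ge0.
have hD : pdist L w w' <= pdist (L ++ L') w w'.
  by rewrite /pdist big_cat/= lerDl; exact: pdist_ge0.
have := pnorm_ge0 L w; have := pnorm_ge0 L w'.
have := hN w; have := hN w' => h1 h2 h3 h4.
rewrite ler_pM ?pdist_ge0// ?mulr_ge0 ?exprn_ge0//; try lra.
by rewrite ler_wpM2l//; apply: lerXn2r; rewrite ?nnegrE; lra.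
Qed.

Lemma tame_perm L L' X : perm_eq L L' -> tame L X -> tame L' X.
Proof.
move=> LL' [C [m [C0 h]]]; exists C, m; split=> // w w'.
by rewrite /pnorm /pdist -!(perm_big _ LL')/=; exact: h.
Qed.

Lemma tame_catr L L' X : tame L X -> tame (L' ++ L) X.
Proof.
by move=> h; apply: (tame_perm (permEl (perm_catC L L'))); exact: tame_catl.
Qed.

(** Comparison with the zero path, where [pnorm] vanishes; the factor [pdist] raises the exponent by
    one. *)
Lemma tame_bound L X : tame L X ->
  exists C m, 0 <= C /\ forall w, `|X w| <= C * (1 + pnorm L w) ^+ m.
Proof.
case=> C [m [C0 h]]; exists (C + `|X zero_path|), m.+1.
split=> [|w]; first by rewrite addr_ge0.
have N0 : pnorm L zero_path = 0 by rewrite /pnorm big1// => t _; exact: enorm0.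
have := h w zero_path; have := pdist_pnorm L w zero_path; rewrite N0 !addr0.
set D := pdist _ _ _; set N := pnorm L w => DN hX.
have N1 : 1 <= 1 + N by have := pnorm_ge0 L w; rewrite -/N; lra.
have e1 : 1 <= (1 + N) ^+ m.+1 by exact: exprn_ege1.
rewrite -[X w](subrK (X zero_path)); apply: (le_trans (ler_normD _ _)).
rewrite mulrDl lerD//; last by rewrite ler_peMr.
apply: (le_trans hX); rewrite exprSr mulrA ler_wpM2l ?mulr_ge0 ?exprn_ge0//; lra.
Qed.

(** The common source of closure under sums, opposites, absolute values and maxima: only the
    increments of the new functional have to be compared. *)
Lemma tame_dom2 L X Y (h : Omega -> R) : tame L X -> tame L Y ->
  (forall w w', `|h w - h w'| <= `|X w - X w'| + `|Y w - Y w'|) -> tame L h.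
Proof.
move=> [C [m [C0 hX]]] [C' [m' [C'0 hY]]] H; exists (C + C'), (m + m')%N.
split=> [|w w']; first exact: addr_ge0.
apply: (le_trans (H w w')); apply: (le_trans (lerD (hX w w') (hY w w'))).
have N1 : 1 <= 1 + pnorm L w + pnorm L w'.
  by have := pnorm_ge0 L w; have := pnorm_ge0 L w'; lra.
have D0 := pdist_ge0 L w w'; rewrite -mulrDl ler_wpM2r// mulrDl lerD//.
- by rewrite ler_wpM2l// ler_weXn2l// leq_addr.
- by rewrite ler_wpM2l// ler_weXn2l// leq_addl.
Qed.

(** Polynomial growth of the local Lipschitz constant, as opposed to a global one, is what admits
    products. Second moments and products with hat functions rest on this. *)
Lemma tame_mul L X Y : tame L X -> tame L Y -> tame L (fun w => X w * Y w).
Proof.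
move=> tX tY; have [A [a [A0 bX]]] := tame_bound tX.
have [B [b [B0 bY]]] := tame_bound tY.
case: tX tY => C [m [C0 hX]] [C' [m' [C'0 hY]]].
exists (C * B + A * C'), ((m + b) + (a + m'))%N.
split=> [|w w']; first by rewrite addr_ge0 ?mulr_ge0.
have -> : X w * Y w - X w' * Y w' = (X w - X w') * Y w + X w' * (Y w - Y w').
  by ring.
apply: (le_trans (ler_normD _ _)); rewrite !normrM.
have Nw := pnorm_ge0 L w; have Nw' := pnorm_ge0 L w'.
set N := 1 + pnorm L w + pnorm L w'; have N1 : 1 <= N by rewrite /N; lra.
have D0 := pdist_ge0 L w w'.
have hY' : `|Y w| <= B * N ^+ b.
  apply: (le_trans (bY w)); rewrite ler_wpM2l//.
  by apply: lerXn2r; rewrite ?nnegrE /N; lra.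
have hX' : `|X w'| <= A * N ^+ a.
  apply: (le_trans (bX w')); rewrite ler_wpM2l//.
  by apply: lerXn2r; rewrite ?nnegrE /N; lra.
apply: (@le_trans _ _ ((C * B) * N ^+ (m + b) * pdist L w w' +
                       (A * C') * N ^+ (a + m') * pdist L w w')).
  rewrite lerD//.
    apply: (le_trans (ler_pM _ _ (hX w w') hY')) => //.
    by rewrite -/N exprD le_eqVlt; apply/orP; left; apply/eqP; ring.
  apply: (le_trans (ler_pM _ _ hX' (hY w w'))) => //.
  by rewrite -/N exprD le_eqVlt; apply/orP; left; apply/eqP; ring.
rewrite -mulrDl ler_wpM2r// [leRHS]mulrDl lerD// ler_wpM2l ?mulr_ge0//.
- by rewrite ler_weXn2l// leq_addr.
- by rewrite ler_weXn2l// leq_addl.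
Qed.

Lemma tame_cst L (c : R) : tame L (fun=> c).
Proof. by exists 0, 0%N; split=> // w w'; rewrite subrr normr0 !mul0r. Qed.

Lemma tame_coord t j : tame [:: t] (fun w => w t 0 j).
Proof.
exists 1, 0%N; split=> // w w'; rewrite expr0 !mul1r /pdist big_seq1.
by have := enorm_coord (w t - w' t) 0 j; rewrite !mxE.
Qed.

Lemma tame_matrix (m : nat) (t : 'I_m -> R) (phi : 'M[R]_(m, d) -> R) :
  ClLip phi -> tame (codom t) (fun w => phi (\matrix_(i < m) w (t i))).
Proof.
move=> /ClLip_le_power[C [k [C0 h]]]; pose c : R := d%:R.
have c0 : 0 <= c by exact: ler0n.
have hM (F : R -> 'rV[R]_d) :
    enorm (\matrix_(i < m) F (t i)) <= c * \sum_(s <- codom t) enorm (F s).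
  apply: (le_trans (enorm_rows _)); rewrite ler_wpM2l//.
  rewrite codomE big_map big_enum/=.
  by apply: ler_sum => i _; rewrite rowK.
exists (C * (1 + c) ^+ k * c), k; split=> [|w w'].
  by rewrite !mulr_ge0 ?exprn_ge0//; lra.
apply: (le_trans (h _ _)).
have hw := hM w; have hw' := hM w'; have hd := hM (fun s => w s - w' s).
rewrite -/(pnorm (codom t) w) in hw; rewrite -/(pnorm (codom t) w') in hw'.
rewrite -/(pdist (codom t) w w') in hd.
have -> : \matrix_(i < m) w (t i) - \matrix_(i < m) w' (t i) =
          \matrix_(i < m) (w (t i) - w' (t i)).
  by apply/matrixP => i j; rewrite !mxE.
set a := enorm (\matrix_i w (t i)) in hw *.
set b := enorm (\matrix_i w' (t i)) in hw' *.
have a0 : 0 <= a by exact: enorm_ge0.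
have b0 : 0 <= b by exact: enorm_ge0.
have N0 := pnorm_ge0 (codom t) w; have N0' := pnorm_ge0 (codom t) w'.
apply: (@le_trans _ _ (C * ((1 + c) * (1 + pnorm (codom t) w + pnorm (codom t) w')) ^+ k * (c * pdist (codom t) w w'))).
  rewrite ler_pM ?enorm_ge0// ?mulr_ge0 ?exprn_ge0//; first lra.
  rewrite ler_wpM2l//; apply: lerXn2r; rewrite ?nnegrE ?mulr_ge0//; try lra.
by rewrite exprMn le_eqVlt; apply/orP; left; apply/eqP; ring.
Qed.

End tame.

(** * Time grids *)

Section grids.
Context {R : realType}.
Implicit Types (L : seq R) (t : nat -> R).

(** Sorting [0 :: L] without duplicates: 0 is added because a [time_grid] starts there, and the
    absence of repetitions makes the order strict. *)
Lemma grid_of L : (forall x, x \in L -> 0 <= x) ->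
  exists m t, [/\ time_grid m t,
    forall x, x \in L -> exists2 i, (i <= m)%N & t i = x &
    forall i, (i <= m)%N -> t i \in 0 :: L].
Proof.
move=> L0; pose s := sort <=%R (undup (0 :: L)).
have sL x : (x \in s) = (x \in 0 :: L) by rewrite mem_sort mem_undup.
have s0 : (0 < size s)%N by case: (s) (sL 0) => //; rewrite mem_head.
have lt_s : sorted <%R s by rewrite sort_lt_sorted undup_uniq.
have idx x : x \in 0 :: L -> exists2 i, (i <= (size s).-1)%N & nth 0 s i = x.
  rewrite -sL => xs; exists (index x s); last exact: nth_index.
  by rewrite -ltnS prednK// index_mem.
exists (size s).-1, (nth 0 s); split; first split.
- have [i im hi] := idx 0 (mem_head _ _); apply/eqP; rewrite eq_le; apply/andP; split.
    rewrite -[leRHS]hi (le_sorted_leq_nth _ (sort_le_sorted _)) ?inE//.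
    by rewrite -(prednK s0) ltnS.
  have : nth 0 s 0 \in 0 :: L by rewrite -sL mem_nth.
  by rewrite inE => /orP[/eqP->|/L0].
- move=> i im; rewrite (lt_sorted_ltn_nth _ lt_s) ?inE//.
    by apply: (ltn_trans im); rewrite ltn_predL.
  by rewrite -ltn_predRL.
- by move=> x xL; apply: idx; rewrite inE xL orbT.
- by move=> i im; rewrite -sL mem_nth// -(prednK s0) ltnS.
Qed.

Section one_grid.
Variables (m : nat) (t : nat -> R).
Hypothesis tg : time_grid m t.

Lemma grid_lt i j : (i < j)%N -> (j <= m)%N -> t i < t j.
Proof.
case: tg => _ ht; elim: j => // j IH; rewrite ltnS leq_eqVlt => /orP[/eqP->|ij] jm.
  exact: ht.
by apply: (lt_trans (IH ij (ltnW jm))); exact: ht.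
Qed.

Lemma grid_le i j : (i <= j)%N -> (j <= m)%N -> t i <= t j.
Proof. by rewrite leq_eqVlt => /orP[/eqP->//|ij jm]; apply/ltW/grid_lt. Qed.

Lemma grid_ge0 i : (i <= m)%N -> 0 <= t i.
Proof. by case: tg => {1}<- _; exact: grid_le. Qed.

Lemma grid_leE i j : (i <= m)%N -> (j <= m)%N -> (t i <= t j) = (i <= j)%N.
Proof.
move=> im jm; have [ij|ji] := leqP i j; first exact: grid_le.
by apply/negbTE; rewrite -ltNge; exact: grid_lt.
Qed.

Lemma grid_ltE i j : (i <= m)%N -> (j <= m)%N -> (t i < t j) = (i < j)%N.
Proof. by move=> im jm; rewrite ltNge grid_leE// ltnNge. Qed.

Lemma grid_prefix k : (k <= m)%N -> time_grid k t.
Proof. by case: tg => t0 ht km; split=> // i ik; apply: ht; exact: leq_trans km. Qed.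

Lemma grid_gap : exists2 h, 0 < h & forall i, (i < m)%N -> h <= t i.+1 - t i.
Proof.
case: tg => _; elim: (m) => [_|k IH ht]; first by exists 1.
case: IH => [i ik|h h0 hh]; first by apply: ht; exact: ltnW.
exists (Num.min h (t k.+1 - t k)).
  by rewrite lt_min h0 subr_gt0 ht.
move=> i; rewrite ltnS leq_eqVlt ge_min => /orP[/eqP->|/hh ->//].
by rewrite lexx orbT.
Qed.

End one_grid.
End grids.

(** * Paths through prescribed values and concatenation of paths *)

Section paths.
Context {R : realType} {d : nat}.
Local Notation Omega := (path_space R d).

Lemma continuous_rV_sum (I : Type) (r : seq I) (F : I -> R -> 'rV[R]_d) :
  (forall i, continuous (F i)) -> continuous (fun x => \sum_(i <- r) F i x).
Proof.
move=> hF x; elim: r => [|i r IH].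
  under eq_fun do rewrite big_nil.
  exact: cvg_cst.
under eq_fun do rewrite big_cons.
by apply: cvgD => //; exact: hF.
Qed.

(* Hat functions centred at the grid points and narrower than the mesh turn
   prescribed values at the grid points into a path. *)
Lemma interp_path (m : nat) (t : nat -> R) : time_grid m t ->
  exists W : (nat -> 'rV[R]_d) -> Omega,
    forall A, A 0 = 0 -> forall i, (i <= m)%N -> W A (t i) = A i.
Proof.
move=> tg; have [h h0 hh] := grid_gap tg.
(* There is no hat at time 0: every hat has radius h, so it vanishes at the other grid points and at
   all times r <= 0, as a path must. *)
pose b (i : nat) (r : R) : R := Num.max 0 (1 - `|r - t i.+1| / h).
have far i r : h <= `|r - t i.+1| -> b i r = 0.
  move=> hr; apply/max_idPl; rewrite subr_le0 ler_pdivlMr// mul1r//.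
pose f (A : nat -> 'rV[R]_d) (r : R) := \sum_(i < m) b i r *: A i.+1.
have cf A : continuous (f A).
  apply: continuous_rV_sum => i x; apply: cvgZr_tmp.
  apply: (@continuous_max R R (fun=> 0) (fun r : R => 1 - `|r - t i.+1| / h)).
    exact: cvg_cst.
  apply: cvgB; first exact: cvg_cst.
  apply: cvgMr_tmp; apply: cvg_norm; apply: cvgB; [exact: cvg_id|exact: cvg_cst].
have f0 A r : r <= 0 -> f A r = 0.
  move=> r0; rewrite /f big1// => i _; rewrite far ?scale0r//.
  have := hh i (ltn_ord i); have := grid_ge0 tg (ltnW (ltn_ord i)).
  by move=> ? ?; rewrite ler0_norm; lra.
exists (fun A => Path (cf A) (f0 A)) => A A0 i im /=; rewrite /f.
case: i im => [_|i im].
  by rewrite A0; apply: (f0 A); case: tg => ->.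
rewrite (bigD1 (Ordinal im))//= {1}/b subrr normr0 mul0r subr0.
rewrite (max_idPr _) ?ler01// scale1r big1 ?addr0// => j ji.
rewrite far ?scale0r//.
have {}ji : (nat_of_ord j != i) by apply: contra_neq ji => ?; exact: val_inj.
have [lt|lt|eq] := ltngtP j i; last by rewrite eq eqxx in ji.
  have /= := hh i im; have := grid_le tg lt (ltnW im).
  by move=> ? ?; rewrite ger0_norm; lra.
have /= := hh j (ltn_ord j); have := grid_le tg lt (ltnW (ltn_ord j)).
by move=> ? ?; rewrite ler0_norm; lra.
Qed.

Lemma continuous_concat s (w w' : Omega) :
  continuous (fun r : R => w (Num.min r s) + (w' (Num.max r s) - w' s)).
Proof.
move=> r; have cmin : {for r, continuous (fun r : R => Num.min r s)}.
  by apply: (@continuous_min R R (fun x => x)); [exact: cvg_id|exact: cvg_cst].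
have cmax : {for r, continuous (fun r : R => Num.max r s)}.
  by apply: (@continuous_max R R (fun x => x)); [exact: cvg_id|exact: cvg_cst].
apply: cvgD.
  by apply: (@continuous_comp _ _ _ (fun r : R => Num.min r s) (path_fun w)) => //; exact: path_cont.
apply: cvgB; last exact: cvg_cst.
by apply: (@continuous_comp _ _ _ (fun r : R => Num.max r s) (path_fun w')) => //; exact: path_cont.
Qed.

Lemma concat_neg s (w w' : Omega) r : 0 <= s -> r <= 0 ->
  w (Num.min r s) + (w' (Num.max r s) - w' s) = 0.
Proof.
move=> s0 r0; have rs : r <= s by exact: le_trans r0 s0.
by rewrite (min_idPl rs) (max_idPr rs) subrr addr0 path_neg0.
Qed.

Lemma le_maxl0 (s : R) : 0 <= Num.max 0 s.
Proof. by rewrite le_max lexx. Qed.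

(* The path w up to time s, continued by the increments of w' after s; a
   negative s counts as 0. *)
Definition concat (s : R) (w w' : Omega) : Omega :=
  Path (@continuous_concat (Num.max 0 s) w w')
    (fun r => @concat_neg (Num.max 0 s) w w' r (le_maxl0 s)).

End paths.

(** * L_ip as the space of tame functionals *)

Section tame_Lip.
Context {R : realType} {d : nat}.
Local Notation Omega := (path_space R d).
Implicit Types (L : seq R) (w : Omega) (X Y : Omega -> R).

(** Each term of a sum over L is at most the whole sum over L', whence the factor [size L]. This
    also identifies negative times with time 0. *)
Lemma tame_transfer L L' X :
  (forall x, x \in L -> exists2 y, y \in L' & forall w : Omega, w x = w y) ->
  tame L X -> tame L' X.
Proof.
move=> LL' [C [m [C0 h]]]; pose c : R := (size L)%:R.
have c0 : 0 <= c by exact: ler0n.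
have hs (g : R -> R) : (forall x, 0 <= g x) ->
    (forall x y, (forall w : Omega, w x = w y) -> g x = g y) ->
    \sum_(x <- L) g x <= c * \sum_(x <- L') g x.
  move=> g0 gxy; rewrite /c mulr_natl.
  have : forall x, x \in L -> g x <= \sum_(x <- L') g x.
    move=> x /LL'[y yL' xy]; rewrite (gxy _ _ xy).
    by rewrite (perm_big _ (perm_to_rem yL'))/= big_cons lerDl sumr_ge0.
  elim: (L) => [|x r IH] hr; first by rewrite big_nil.
  rewrite big_cons mulrS lerD ?hr ?mem_head// IH// => y yr.
  by rewrite hr// inE yr orbT.
have hN w : pnorm L w <= c * pnorm L' w.
  by apply: hs => [x|x y ->//]; exact: enorm_ge0.
have hD w w' : pdist L w w' <= c * pdist L' w w'.
  by apply: hs => [x|x y xy]; [exact: enorm_ge0|rewrite !xy].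
exists (C * (1 + c) ^+ m * c), m; split=> [|w w'].
  by rewrite !mulr_ge0 ?exprn_ge0//; lra.
apply: (le_trans (h w w')).
have N0 := pnorm_ge0 L' w; have N0' := pnorm_ge0 L' w'.
have n0 := pnorm_ge0 L w; have n0' := pnorm_ge0 L w'.
have := hN w; have := hN w' => h1 h2.
apply: (@le_trans _ _ (C * ((1 + c) * (1 + pnorm L' w + pnorm L' w')) ^+ m *
   (c * pdist L' w w'))).
  rewrite ler_pM ?pdist_ge0// ?mulr_ge0 ?exprn_ge0//; first lra.
  by rewrite ler_wpM2l//; apply: lerXn2r; rewrite ?nnegrE; nra.
by rewrite exprMn le_eqVlt; apply/orP; left; apply/eqP; ring.
Qed.

Lemma path_max0 w x : w x = w (Num.max 0 x).
Proof. by have [x0|//] := leP x 0; rewrite !path_neg0. Qed.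

(** The extra times L' allow a conditioning time to be placed on the grid. *)
Lemma tame_grid L L' X : tame L X -> (forall x, x \in L' -> 0 <= x) ->
  exists m t, [/\ time_grid m t, tame (mkseq t m.+1) X &
    forall x, x \in L' -> exists2 i, (i <= m)%N & t i = x].
Proof.
move=> tX L'0.
have [|m [t [tg h1 h2]]] := @grid_of R (map (Num.max 0) L ++ L').
  by move=> x; rewrite mem_cat => /orP[/mapP[y _ ->]|/L'0//]; rewrite le_max lexx.
exists m, t; split=> //; last first.
  by move=> x xL'; apply: h1; rewrite mem_cat xL' orbT.
apply: tame_transfer tX => x xL; exists (Num.max 0 x); last by move=> w; exact: path_max0.
have [|i im <-] := h1 (Num.max 0 x); first by rewrite mem_cat map_f.
by apply: map_f; rewrite mem_iota.
Qed.

Definition rowat p (M : 'M[R]_(p, d)) (k : nat) : 'rV[R]_d :=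
  if insub k is Some i then row i M else 0.

Lemma rowat_ord p (M : 'M[R]_(p, d)) (i : 'I_p) : rowat M i = row i M.
Proof. by rewrite /rowat valK. Qed.

Lemma rowatB p (M N : 'M[R]_(p, d)) k : rowat (M - N) k = rowat M k - rowat N k.
Proof. by rewrite /rowat; case: insub => [i|]; rewrite ?subr0// linearB. Qed.

Lemma enorm_rowat p (M : 'M[R]_(p, d)) k : enorm (rowat M k) <= enorm M.
Proof.
rewrite /rowat; case: insub => [i|]; first exact: enorm_row.
by rewrite enorm0 enorm_ge0.
Qed.

Section on_a_grid.
Variables (m : nat) (t : nat -> R) (W : (nat -> 'rV[R]_d) -> Omega).
Hypothesis Wt : forall A, A 0 = 0 -> forall i, (i <= m)%N -> W A (t i) = A i.

Lemma tame_grid_ext X w w' : tame (mkseq t m.+1) X ->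
  (forall i, (i <= m)%N -> w (t i) = w' (t i)) -> X w = X w'.
Proof.
move=> tX h; apply: (tame_eq tX) => x /mapP[i]; rewrite mem_iota/= add0n ltnS.
by move=> im ->; exact: h.
Qed.

(** X reads the path [W (A M)] only at grid times, where it is additive in M with norm at most c.
    This turns a tame functional back into a function of a matrix. *)
Lemma ClLip_path p (c : R) (A : 'M[R]_(p, d) -> nat -> 'rV[R]_d) X :
  0 <= c -> (forall M, A M 0 = 0) ->
  (forall M N i, A (M - N) i = A M i - A N i) ->
  (forall M i, (i <= m)%N -> enorm (A M i) <= c * enorm M) ->
  tame (mkseq t m.+1) X -> ClLip (fun M => X (W (A M))).
Proof.
move=> c0 A0 AB Ac [C [k [C0 h]]]; pose l : R := m.+1%:R.
have l0 : 0 <= l by exact: ler0n.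
have hs (g : nat -> R) b : (forall i, (i <= m)%N -> g i <= b) ->
    \sum_(x <- iota 0 m.+1) g x <= l * b.
  move=> gb; rewrite -[iota 0 m.+1]/(index_iota 0 m.+1) big_mkord.
  rewrite /l mulr_natl -[X in _ *+ X]card_ord -sumr_const.
  by apply: ler_sum => i _; apply: gb; rewrite -ltnS.
have hN M : pnorm (mkseq t m.+1) (W (A M)) <= l * (c * enorm M).
  by rewrite /pnorm big_map; apply: hs => i im; rewrite Wt// Ac.
have hD M N : pdist (mkseq t m.+1) (W (A M)) (W (A N)) <= l * (c * enorm (M - N)).
  by rewrite /pdist big_map; apply: hs => i im; rewrite !Wt// -AB Ac.
apply: (@ClLip_power R p d _ (C * (l * c)) (l * c) k); rewrite ?mulr_ge0//.
move=> x y; apply: (le_trans (h _ _)).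
apply: (@le_trans _ _ (C * (1 + l * c * enorm x + l * c * enorm y) ^+ k *
   (l * (c * enorm (x - y))))).
  have h1 := pnorm_ge0 (mkseq t m.+1) (W (A x)).
  have h2 := pnorm_ge0 (mkseq t m.+1) (W (A y)).
  have h3 := hN x; have h4 := hN y; rewrite mulrA in h3; rewrite mulrA in h4.
  apply: ler_pM; [|exact: pdist_ge0| |exact: hD].
    by rewrite mulr_ge0// exprn_ge0//; lra.
  by apply: ler_wpM2l => //; apply: lerXn2r; rewrite ?nnegrE; lra.
by rewrite le_eqVlt; apply/orP; left; apply/eqP; ring.
Qed.

End on_a_grid.

(** The required function of the matrix of path values is X evaluated at the interpolating path,
    which X cannot distinguish from the original one. *)
Lemma tame_is_Lip L X : tame L X -> Lip X.
Proof.
move=> /tame_grid -/(_ [::])[//|m [t [tg tX _]]].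
have [W Wt] := @interp_path R d _ _ tg.
(* Row 0 is overwritten by 0 because paths start at 0. *)
pose A (M : 'M[R]_(m.+1, d)) i := if i == 0%N then 0 else rowat M i.
exists (Num.bound (t m)) => //; exists m.+1, (fun i : 'I_m.+1 => t i).
exists (fun M => X (W (A M))); split=> //.
- move=> i; have im : (i <= m)%N by rewrite -ltnS.
  rewrite (grid_ge0 tg)//=; apply: (le_trans (grid_le tg im (leqnn m))).
  by apply/ltW/archi_boundP; exact: (grid_ge0 tg).
- apply: (ClLip_path Wt (c := 1) (A := A)) => //.
  + by move=> M N i; rewrite /A; case: eqP; rewrite ?subr0// rowatB.
  + move=> M i im; rewrite mul1r /A; case: eqP; last by rewrite enorm_rowat.
    by rewrite enorm0 enorm_ge0.
- apply/funext => w; apply: (tame_grid_ext tX) => i im; rewrite Wt// /A.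
  case: eqP => [->|_]; first by case: tg => -> _; exact: path_neg0.
  have im' : (i < m.+1)%N by [].
  by rewrite -[i]/(nat_of_ord (Ordinal im')) rowat_ord rowK.
Qed.

Lemma Lip_tame X : Lip X -> exists L, tame L X.
Proof.
case=> n _ [m [t [phi [_ _ hphi ->]]]]; exists (codom t); exact: tame_matrix.
Qed.

Lemma Lip_dom2 X Y (h : Omega -> R) : Lip X -> Lip Y ->
  (forall w w', `|h w - h w'| <= `|X w - X w'| + `|Y w - Y w'|) -> Lip h.
Proof.
move=> /Lip_tame[L tX] /Lip_tame[L' tY] hh; apply: (@tame_is_Lip (L ++ L')).
by apply: tame_dom2 hh; [exact: tame_catl|exact: tame_catr].
Qed.

Lemma Lip_mul X Y : Lip X -> Lip Y -> Lip (fun w => X w * Y w).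
Proof.
move=> /Lip_tame[L tX] /Lip_tame[L' tY]; apply: (@tame_is_Lip (L ++ L')).
by apply: tame_mul; [exact: tame_catl|exact: tame_catr].
Qed.

Lemma Lip_cst (c : R) : Lip (fun _ : Omega => c).
Proof. by apply: (@tame_is_Lip [::]); exact: tame_cst. Qed.

Lemma Lip_coord t j : Lip (fun w : Omega => w t 0 j).
Proof. by apply: (@tame_is_Lip [:: t]); exact: tame_coord. Qed.

Lemma Lip_dom X (h : Omega -> R) : Lip X ->
  (forall w w', `|h w - h w'| <= `|X w - X w'|) -> Lip h.
Proof.
move=> hX hh; apply: (Lip_dom2 hX (Lip_cst 0)) => w w'.
by rewrite subrr normr0 addr0.
Qed.

Lemma Lip_add X Y : Lip X -> Lip Y -> Lip (fun w => X w + Y w).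
Proof.
move=> hX hY; apply: (Lip_dom2 hX hY) => w w'.
by rewrite opprD addrACA ler_normD.
Qed.

Lemma Lip_opp X : Lip X -> Lip (fun w => - X w).
Proof. by move=> hX; apply: (Lip_dom hX) => w w'; rewrite -opprD normrN. Qed.

Lemma Lip_sub X Y : Lip X -> Lip Y -> Lip (fun w => X w - Y w).
Proof. by move=> hX hY; apply: Lip_add => //; exact: Lip_opp. Qed.

Lemma Lip_abs X : Lip X -> Lip (fun w => `|X w|).
Proof. by move=> hX; apply: (Lip_dom hX) => w w'; exact: ler_dist_dist. Qed.

Lemma Lip_max X Y : Lip X -> Lip Y -> Lip (fun w => Num.max (X w) (Y w)).
Proof.
move=> hX hY; have h : Lip (fun w => 2^-1 * (X w + Y w + `|X w - Y w|)).
  apply: Lip_mul; first exact: Lip_cst.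
  by apply: Lip_add; [exact: Lip_add|apply: Lip_abs; exact: Lip_sub].
apply: (Lip_dom h) => w w'; rewrite le_eqVlt; apply/orP; left; apply/eqP.
by congr `|_ - _|; rewrite maxr_absE; field.
Qed.

Lemma Lip_exp X n : Lip X -> Lip (fun w => X w ^+ n).
Proof.
move=> hX; elim: n => [|n IH]; first exact: Lip_cst.
have -> : (fun w => X w ^+ n.+1) = (fun w => X w * X w ^+ n).
  by apply/funext => w; rewrite exprS.
exact: Lip_mul.
Qed.

Lemma Lip_sum (I : eqType) (r : seq I) (P : pred I) (F : I -> Omega -> R) :
  (forall i, i \in r -> P i -> Lip (F i)) -> Lip (fun w => \sum_(i <- r | P i) F i w).
Proof.
elim: r => [|i r IH] hF; first by (under eq_fun do rewrite big_nil); exact: Lip_cst.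
have hr : Lip (fun w => \sum_(j <- r | P j) F j w).
  by apply: IH => j jr; apply: hF; rewrite inE jr orbT.
under eq_fun do rewrite big_cons.
case Pi: (P i) => //.
by apply: Lip_add => //; apply: hF => //; exact: mem_head.
Qed.

Lemma Lip_prod (I : eqType) (r : seq I) (P : pred I) (F : I -> Omega -> R) :
  (forall i, i \in r -> P i -> Lip (F i)) -> Lip (fun w => \prod_(i <- r | P i) F i w).
Proof.
elim: r => [|i r IH] hF; first by (under eq_fun do rewrite big_nil); exact: Lip_cst.
have hr : Lip (fun w => \prod_(j <- r | P j) F j w).
  by apply: IH => j jr; apply: hF; rewrite inE jr orbT.
under eq_fun do rewrite big_cons.
case Pi: (P i) => //.
by apply: Lip_mul => //; apply: hF => //; exact: mem_head.
Qed.

Definition Lipv n (X : Omega -> 'rV[R]_n) := forall j, Lip (fun w => X w 0 j).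

(** The norm does not come from ring operations; its increment is bounded by the sum of the
    coordinate increments, once the observation times of all coordinates are merged into one
    list. *)
Lemma Lip_enorm n (X : Omega -> 'rV[R]_n) : Lipv X -> Lip (fun w => enorm (X w)).
Proof.
move=> hX.
have hs (r : seq 'I_n) : exists2 L, True & forall j, j \in r -> tame L (fun w => X w 0 j).
  elim: r => [|i r [L _ hL]]; first by exists [::].
  have [L' hL'] := Lip_tame (hX i); exists (L' ++ L) => // j.
  by rewrite inE => /orP[/eqP->|/hL]; [exact: tame_catl|exact: tame_catr].
have [L _ hL] := hs (index_enum 'I_n).
have : exists C m, 0 <= C /\ forall w w', \sum_j `|X w 0 j - X w' 0 j| <=
     C * (1 + pnorm L w + pnorm L w') ^+ m * pdist L w w'.
  elim: (index_enum 'I_n) hL => [_|i r IH hL].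
    by exists 0, 0%N; split=> // w w'; rewrite big_nil !mul0r.
  case: IH => [j jr|C [m [C0 h]]]; first by apply: hL; rewrite inE jr orbT.
  have [C' [m' [C'0 h']]] := hL i (mem_head _ _).
  exists (C' + C), (m' + m)%N; split=> [|w w']; first exact: addr_ge0.
  rewrite big_cons; apply: (le_trans (lerD (h' w w') (h w w'))).
  have N1 : 1 <= 1 + pnorm L w + pnorm L w'.
    by have := pnorm_ge0 L w; have := pnorm_ge0 L w'; lra.
  have D0 := pdist_ge0 L w w'; rewrite -mulrDl ler_wpM2r// mulrDl lerD//.
  - by rewrite ler_wpM2l// ler_weXn2l// leq_addr.
  - by rewrite ler_wpM2l// ler_weXn2l// leq_addl.
case=> C [m [C0 h]]; apply: (@tame_is_Lip L); exists C, m; split=> // w w'.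
apply: le_trans (h w w'); apply: (le_trans (enorm_dist _ _)).
apply: (le_trans (enorm_le_sum _)); rewrite big_ord1.
by apply: ler_sum => j _; rewrite !mxE.
Qed.

Lemma Lipv_add n (X Y : Omega -> 'rV[R]_n) : Lipv X -> Lipv Y -> Lipv (fun w => X w + Y w).
Proof. by move=> hX hY j; (under eq_fun do rewrite mxE); exact: Lip_add. Qed.

Lemma Lipv_opp n (X : Omega -> 'rV[R]_n) : Lipv X -> Lipv (fun w => - X w).
Proof. by move=> hX j; (under eq_fun do rewrite mxE); exact: Lip_opp. Qed.

Lemma Lipv_sub n (X Y : Omega -> 'rV[R]_n) : Lipv X -> Lipv Y -> Lipv (fun w => X w - Y w).
Proof. by move=> hX hY; apply: Lipv_add => //; exact: Lipv_opp. Qed.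

Lemma Lipv_scale n (a : Omega -> R) (X : Omega -> 'rV[R]_n) :
  Lip a -> Lipv X -> Lipv (fun w => a w *: X w).
Proof. by move=> ha hX j; (under eq_fun do rewrite mxE); exact: Lip_mul. Qed.

Lemma Lipv_cst n (c : 'rV[R]_n) : Lipv (fun=> c).
Proof. by move=> j; exact: Lip_cst. Qed.

Lemma Lipv_sum n (I : eqType) (r : seq I) (P : pred I) (F : I -> Omega -> 'rV[R]_n) :
  (forall i, i \in r -> P i -> Lipv (F i)) -> Lipv (fun w => \sum_(i <- r | P i) F i w).
Proof.
move=> hF j; under eq_fun do rewrite summxE.
by apply: Lip_sum => i ir Pi; exact: hF.
Qed.

Lemma Lipv_path t : Lipv (fun w : Omega => w t).
Proof. by move=> j; exact: Lip_coord. Qed.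

End tame_Lip.

(** * Conditional expectation by freezing the past *)

(** Membership in L_ip by recursion on the syntax of the functional. The leaves are closed by
    hypotheses, which is why proofs bring the membership of each component into the context
    beforehand. *)
Ltac lip := repeat first
  [ assumption
  | match goal with
    | |- Lip (fun _ => ?c) => exact: (@Lip_cst _ _ c)
    | |- Lip (fun w => @?X w + @?Y w) => apply: (@Lip_add _ _ X Y)
    | |- Lip (fun w => - @?X w) => apply: (@Lip_opp _ _ X)
    | |- Lip (fun w => @?X w * @?Y w) => apply: (@Lip_mul _ _ X Y)
    | |- Lip (fun w => `|@?X w|) => apply: (@Lip_abs _ _ X)
    | |- Lip (fun w => @?X w ^+ ?n) => apply: (@Lip_exp _ _ X n)
    | |- Lip (fun w => enorm (@?X w)) => apply: (@Lip_enorm _ _ _ X)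
    | |- Lip (fun w => Num.max (@?X w) (@?Y w)) => apply: (@Lip_max _ _ X Y)
    | |- Lip (fun w => \sum_(i <- _ | _) _) => apply: Lip_sum => ? _ _
    | |- Lip (fun w => \prod_(i <- _ | _) _) => apply: Lip_prod => ? _ _
    | |- Lipv (fun _ => ?c) => exact: (@Lipv_cst _ _ _ c)
    | |- Lipv (fun w => @?X w + @?Y w) => apply: (@Lipv_add _ _ _ X Y)
    | |- Lipv (fun w => - @?X w) => apply: (@Lipv_opp _ _ _ X)
    | |- Lipv (fun w => @?a w *: @?X w) => apply: (@Lipv_scale _ _ _ a X)
    | |- Lipv (fun w => \sum_(i <- _ | _) _) => apply: Lipv_sum => ? _ _
    | |- Lipv (fun w => path_fun w ?t) => exact: Lipv_path
    | |- Lip (fun w => fun_of_matrix (path_fun w _) _ _) => exact: Lip_coord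
    | H : _ |- _ => exact: H
    end ].

Section Gexp.
Context {R : realType} {d : nat} (G : Gexpectation R d).
Local Notation Omega := (path_space R d).
Local Notation E := (Ehat G).
Implicit Types (L : seq R) (w : Omega) (X Y : Omega -> R).

Lemma E_le X Y : Lip X -> Lip Y -> (forall w, X w <= Y w) -> E X <= E Y.
Proof. exact: (sub_mono (EhatP G)). Qed.

Lemma E_cst (c : R) : E (fun=> c) = c.
Proof. exact: (sub_cst (EhatP G)). Qed.

Lemma E_add X Y : Lip X -> Lip Y -> E (fun w => X w + Y w) <= E X + E Y.
Proof. exact: (sub_add (EhatP G)). Qed.

Lemma E_scale (a : R) X : 0 <= a -> Lip X -> E (fun w => a * X w) = a * E X.
Proof. exact: (sub_homo (EhatP G)). Qed.

Lemma E_ge0 X : Lip X -> (forall w, 0 <= X w) -> 0 <= E X.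
Proof. by move=> hX X0; rewrite -(E_cst 0); apply: E_le => //; exact: Lip_cst. Qed.

(** Subadditivity applied to U = (U - V) + V, for both orders of the two variables. *)
Lemma E_dist X Y : Lip X -> Lip Y -> `|E X - E Y| <= E (fun w => `|X w - Y w|).
Proof.
have half U V : Lip U -> Lip V -> E U - E V <= E (fun w => `|U w - V w|).
  move=> hU hV; rewrite lerBlDr; apply: (@le_trans _ _ (E (fun w => `|U w - V w| + V w))).
    by apply: E_le; [lip|lip|move=> w; have := ler_norm (U w - V w); lra].
  by apply: E_add; lip.
move=> hX hY; rewrite ler_norml; have := half _ _ hX hY; have := half _ _ hY hX.
have -> : (fun w => `|Y w - X w|) = (fun w => `|X w - Y w|).
  by apply/funext => w; exact: distrC.
by move=> h1 h2; lra.
Qed.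

Lemma E_sum (I : eqType) (r : seq I) (P : pred I) (F : I -> Omega -> R) :
  (forall i, i \in r -> P i -> Lip (F i)) ->
  E (fun w => \sum_(i <- r | P i) F i w) <= \sum_(i <- r | P i) E (F i).
Proof.
elim: r => [|i r IH] hF.
  by rewrite big_nil; under eq_fun do rewrite big_nil; rewrite E_cst.
have hr : forall j, j \in r -> P j -> Lip (F j).
  by move=> j jr; apply: hF; rewrite inE jr orbT.
have -> : (fun w => \sum_(j <- i :: r | P j) F j w) =
  (fun w => (if P i then F i w else 0) + \sum_(j <- r | P j) F j w).
  by apply/funext => w; rewrite big_cons; case: (P i); rewrite ?add0r.
rewrite big_cons; case Pi : (P i); last first.
  by under eq_fun do rewrite add0r; exact: IH.
apply: (le_trans (E_add _ _)); [exact: hF (mem_head _ _) Pi|exact: Lip_sum|].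
by rewrite lerD2l; exact: IH.
Qed.

Definition cums (x : nat -> 'rV[R]_d) (i : nat) : 'rV[R]_d := \sum_(k < i) x k.

Lemma enorm_matrix_rows p (F : 'I_p -> 'rV[R]_d) (c : R) :
  (forall i, enorm (F i) <= c) ->
  enorm (\matrix_(i < p) F i) <= (d * p)%:R * c.
Proof.
move=> hF; apply: (le_trans (enorm_rows _)); rewrite natrM -mulrA ler_wpM2l//.
rewrite mulr_natl -[X in _ *+ X]card_ord -sumr_const; apply: ler_sum => i _.
by rewrite rowK.
Qed.

Lemma ClLip_comp p q p' q' (A : 'M[R]_(p', q') -> 'M[R]_(p, q)) (c : R)
    (phi : 'M[R]_(p, q) -> R) : 0 <= c ->
  (forall x y, enorm (A x - A y) <= c * enorm (x - y)) ->
  ClLip phi -> ClLip (fun x => phi (A x)).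
Proof.
move=> c0 hA /ClLip_le_power[C [m [C0 h]]]; pose b := enorm (A 0).
have b0 : 0 <= b by exact: enorm_ge0.
have hb x : enorm (A x) <= b + c * enorm x.
  have := enorm_add (A x - A 0) (A 0); rewrite subrK.
  by have := hA x 0; rewrite subr0 /b; lra.
apply: (@ClLip_power R _ _ _ (C * (1 + 2 * b) ^+ m * c) c m) => //.
  by rewrite !mulr_ge0 ?exprn_ge0//; lra.
move=> x y; apply: (le_trans (h _ _)).
have hx := hb x; have hy := hb y; have x0 := enorm_ge0 x; have y0 := enorm_ge0 y.
have ax0 := enorm_ge0 (A x); have ay0 := enorm_ge0 (A y).
apply: (@le_trans _ _ (C * ((1 + 2 * b) * (1 + c * enorm x + c * enorm y)) ^+ m *
   (c * enorm (x - y)))).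
  apply: ler_pM => //; [|exact: enorm_ge0|].
    by rewrite mulr_ge0// exprn_ge0//; lra.
  have u0 : 0 <= c * enorm x by rewrite mulr_ge0.
  have v0 : 0 <= c * enorm y by rewrite mulr_ge0.
  apply: ler_wpM2l => //; move: (c * enorm x) (c * enorm y) hx hy u0 v0 => u v hx hy u0 v0.
  by apply: lerXn2r; rewrite ?nnegrE; [lra|rewrite mulr_ge0//; lra|nra].
by rewrite exprMn le_eqVlt; apply/orP; left; apply/eqP; ring.
Qed.

Lemma tame_increments m t (phi : 'M[R]_(m, d) -> R) : ClLip phi ->
  tame (mkseq t m.+1) (fun w => phi (increments m t w)).
Proof.
move=> hphi.
pose A (M : 'M[R]_(m.+1, d)) := \matrix_(i < m) (rowat M i.+1 - rowat M i).
have hA : ClLip (fun M => phi (A M)).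
  apply: (@ClLip_comp _ _ _ _ A ((d * m)%:R * 2)) => // x y.
  have -> : A x - A y = \matrix_(i < m) (rowat (x - y) i.+1 - rowat (x - y) i).
    by apply/row_matrixP => i; rewrite linearB/= !rowK !rowatB !opprD !opprK addrACA.
  rewrite -mulrA; apply: enorm_matrix_rows => i; apply: (le_trans (enorm_sub _ _)).
  by have := enorm_rowat (x - y) i.+1; have := enorm_rowat (x - y) i; lra.
have := @tame_matrix R d m.+1 (fun i : 'I_m.+1 => t i) _ hA.
have -> : codom (fun i : 'I_m.+1 => t i) = mkseq t m.+1.
  by rewrite codomE /mkseq -val_enum_ord -map_comp.
congr tame; apply/funext => w; congr phi; apply/row_matrixP => i; rewrite !rowK.
have im1 : (i.+1 < m.+1)%N by rewrite ltnS.
have im : (i < m.+1)%N by rewrite ltnS ltnW.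
rewrite -[X in rowat _ X - _]/(nat_of_ord (Ordinal im1)).
by rewrite -[X in _ - rowat _ X]/(nat_of_ord (Ordinal im)) !rowat_ord !rowK.
Qed.

Section on_a_grid.
Variables (m : nat) (t : nat -> R) (W : (nat -> 'rV[R]_d) -> Omega).
Hypothesis tg : time_grid m t.
Hypothesis Wt : forall A, A 0 = 0 -> forall i, (i <= m)%N -> W A (t i) = A i.

(** A sample path of G-Brownian motion as far as the grid can see: its increments are the copies of
    the G-normal vector scaled by the roots of the time steps. *)
Definition Wxi (u : Gbase G) : Omega :=
  W (cums (fun k => Num.sqrt (t k.+1 - t k) *: xi (g := G) k u)).

Lemma cums0 x : cums x 0 = 0.
Proof. by rewrite /cums big_ord0. Qed.

Lemma ClLip_cums p (b : nat -> R) X : tame (mkseq t m.+1) X ->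
  ClLip (fun M : 'M[R]_(p, d) => X (W (cums (fun k => b k *: rowat M k)))).
Proof.
apply: (ClLip_path Wt (c := \sum_(k < m) `|b k|)
  (A := fun M : 'M[R]_(p, d) => cums (fun k => b k *: rowat M k))).
- exact: sumr_ge0.
- by move=> M; exact: cums0.
- move=> M N i; rewrite /cums -sumrB; apply: eq_bigr => k _.
  by rewrite rowatB scalerBr.
- move=> M i im; apply: (le_trans (enorm_sum _ _ _)); rewrite mulr_suml.
  apply: (@le_trans _ _ (\sum_(k < i) `|b k| * enorm M)).
    by apply: ler_sum => k _; rewrite enormZ ler_wpM2l// enorm_rowat.
  rewrite -!(big_mkord xpredT (fun k => `|b k| * enorm M)).
  rewrite [leRHS](big_cat_nat (leq0n i) im)/= lerDl.
  by apply: sumr_ge0 => k _; rewrite mulr_ge0// enorm_ge0.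
Qed.

Lemma cums_increments w i : (i <= m)%N ->
  cums (fun k => rowat (increments m t w) k) i = w (t i).
Proof.
move=> im; have -> : cums (rowat (increments m t w)) i =
    \sum_(k < i) (w (t k.+1) - w (t k)).
  apply: eq_bigr => k _; have km := leq_trans (ltn_ord k) im.
  by rewrite -[nat_of_ord k]/(nat_of_ord (Ordinal km)) rowat_ord rowK.
rewrite -(big_mkord xpredT (fun k => w (t k.+1) - w (t k))).
rewrite (telescope_sumr (fun k => w (t k)))//.
by case: tg => -> _; rewrite [w 0]path_neg0// subr0.
Qed.

(** The defining formula [Ehat_fdd] speaks of functions of increments; interpolation through the
    partial sums of the increments writes X as such a function. *)
Lemma E_grid X : tame (mkseq t m.+1) X -> E X = expect (fun u => X (Wxi u)).
Proof.
move=> tX; pose phi (M : 'M[R]_(m, d)) := X (W (cums (fun k => 1 *: rowat M k))).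
have hphi : ClLip phi by exact: ClLip_cums.
have e : X = (fun w => phi (increments m t w)).
  apply/funext => w; apply: (tame_grid_ext tX) => i im; rewrite Wt ?cums0//.
  have -> : (fun k => 1 *: rowat (increments m t w) k) = rowat (increments m t w).
    by apply/funext => k; rewrite scale1r.
  by rewrite cums_increments.
rewrite {1}e Ehat_fdd//; congr expect; apply/funext => u.
rewrite /phi; apply: (tame_grid_ext tX) => i im.
rewrite !Wt ?cums0//; apply: eq_bigr => k _.
have km := leq_trans (ltn_ord k) im; rewrite scale1r.
by rewrite -[X in rowat _ X]/(nat_of_ord (Ordinal km)) rowat_ord rowK.
Qed.

End on_a_grid.

Lemma concatE s w w' r : 0 <= s ->
  concat s w w' r = if r <= s then w r else w s + (w' r - w' s).
Proof.
move=> s0; rewrite /= (max_idPr s0); case: leP => rs.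
  by rewrite subrr addr0.
by [].
Qed.

Lemma concat_le s w w' r : 0 <= s -> r <= s -> concat s w w' r = w r.
Proof. by move=> s0 rs; rewrite concatE// rs. Qed.

Lemma concat_ge s w w' r : 0 <= s -> s <= r ->
  concat s w w' r = w s + (w' r - w' s).
Proof.
move=> s0; rewrite le_eqVlt => /orP[/eqP<-|sr].
  by rewrite concat_le// subrr addr0.
by rewrite concatE// leNgt sr.
Qed.

Lemma concatA s s' w w' w'' : 0 <= s -> s <= s' ->
  concat s' (concat s w w') w'' = concat s w (concat s' w' w'').
Proof.
move=> s0 ss'; have s'0 := le_trans s0 ss'; apply: path_ext => r.
have [rs|/ltW sr] := leP r s.
  by rewrite concat_le ?(le_trans rs ss')// !concat_le.
rewrite [RHS]concat_ge// [concat s' w' w'' s]concat_le//.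
have [rs'|/ltW sr'] := leP r s'.
  by rewrite !(concat_le _ _ s'0 rs') concat_ge.
by rewrite !(concat_ge _ _ s'0 sr') concat_ge// -addrA; congr (_ + _); rewrite addrAC.
Qed.

Lemma concat0 w w' : concat 0 w w' = w'.
Proof.
apply: path_ext => r; have [r0|/ltW r0] := leP r 0.
  by rewrite concat_le// !path_neg0.
by rewrite concat_ge// (path_neg0 w (lexx 0)) (path_neg0 w' (lexx 0)) add0r subr0.
Qed.

Lemma pnorm_cat L L' w : pnorm (L ++ L') w = pnorm L w + pnorm L' w.
Proof. by rewrite /pnorm big_cat. Qed.

Section concat_bounds.
Variables (s : R) (L : seq R).
Hypothesis s0 : 0 <= s.
(** The times at which a functional of [concat s w w'] reads w and w' respectively. The copies of s,
    one per element of L, account for the subtracted value [w' s]. *)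
Let Lmin := map (Num.min^~ s) L.
Let Lmax := map (Num.max^~ s) L ++ map (fun=> s) L.

Lemma pnorm_concat w w' : pnorm L (concat s w w') <= pnorm Lmin w + pnorm Lmax w'.
Proof.
rewrite pnorm_cat /pnorm !big_map -!big_split/=; apply: ler_sum => x _ /=.
rewrite (max_idPr s0); apply: (le_trans (enorm_add _ _)).
by rewrite lerD2l enorm_sub.
Qed.

Lemma pdist_concatl w1 w2 w' :
  pdist L (concat s w1 w') (concat s w2 w') = pdist Lmin w1 w2.
Proof.
rewrite /pdist big_map; apply: eq_bigr => x _ /=.
by rewrite (max_idPr s0) opprD addrACA subrr addr0.
Qed.

Lemma pdist_concatr w w1 w2 :
  pdist L (concat s w w1) (concat s w w2) <= pdist Lmax w1 w2.
Proof.
rewrite /pdist big_cat/= !big_map -!big_split/=; apply: ler_sum => x _ /=.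
rewrite (max_idPr s0) opprD addrACA subrr add0r.
rewrite [X in enorm X](_ : _ = w1 (Num.max x s) - w2 (Num.max x s) -
  (w1 s - w2 s)); last by rewrite !opprD !opprK addrACA.
exact: enorm_sub.
Qed.

Lemma tame_concat X w : tame L X -> tame Lmax (fun w' => X (concat s w w')).
Proof.
case=> C [m [C0 h]]; pose a := pnorm Lmin w.
have a0 : 0 <= a by exact: pnorm_ge0.
exists (C * (1 + 2 * a) ^+ m), m; split=> [|w1 w2].
  by rewrite !mulr_ge0 ?exprn_ge0//; lra.
apply: (le_trans (h _ _)).
have h1 := pnorm_concat w w1; have h2 := pnorm_concat w w2.
have p1 := pnorm_ge0 Lmax w1; have p2 := pnorm_ge0 Lmax w2.
have q1 := pnorm_ge0 L (concat s w w1); have q2 := pnorm_ge0 L (concat s w w2).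
rewrite -/a in h1; rewrite -/a in h2.
rewrite -[X in X * pdist Lmax _ _]mulrA -exprMn.
apply: ler_pM; [|exact: pdist_ge0| |exact: pdist_concatr].
  by rewrite mulr_ge0// exprn_ge0//; lra.
by apply: ler_wpM2l => //; apply: lerXn2r; rewrite ?nnegrE; nra.
Qed.

(* The conditional expectation at time s, represented by freezing the path up
   to time s. *)
Definition cond X w : R := E (fun w' => X (concat s w w')).

Lemma Lip_concat X w : tame L X -> Lip (fun w' => X (concat s w w')).
Proof. by move=> tX; apply: tame_is_Lip (tame_concat w tX). Qed.

Lemma tame_cond X : tame L X -> tame Lmin (cond X).
Proof.
move=> tX; case: (tX) => C [m [C0 h]].
pose b := E (fun w => (1 + 2 * pnorm Lmax w) ^+ m).
have Lb : Lip (fun w => (1 + 2 * pnorm Lmax w) ^+ m) by rewrite /pnorm; lip.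
exists (C * b), m; split=> [|w1 w2].
  rewrite mulr_ge0//; apply: E_ge0 => // w; rewrite exprn_ge0//.
  by have := pnorm_ge0 Lmax w; lra.
have hw w := Lip_concat w tX.
apply: (le_trans (E_dist (hw w1) (hw w2))).
pose a := C * (1 + pnorm Lmin w1 + pnorm Lmin w2) ^+ m * pdist Lmin w1 w2.
have n1 := pnorm_ge0 Lmin w1; have n2 := pnorm_ge0 Lmin w2.
have a0 : 0 <= a by rewrite !mulr_ge0 ?pdist_ge0// exprn_ge0//; lra.
have -> : C * b * (1 + pnorm Lmin w1 + pnorm Lmin w2) ^+ m * pdist Lmin w1 w2 =
          a * b by rewrite /a; ring.
rewrite -E_scale//; apply: E_le => [||w]; [|by lip|].
  by apply: Lip_abs; apply: Lip_sub; exact: hw.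
apply: (le_trans (h _ _)); rewrite pdist_concatl /a.
rewrite [leRHS]mulrAC -[X in _ <= X * _]mulrA -exprMn.
apply: ler_wpM2r; first exact: pdist_ge0.
have h1 := pnorm_concat w1 w; have h2 := pnorm_concat w2 w.
have q1 := pnorm_ge0 L (concat s w1 w); have q2 := pnorm_ge0 L (concat s w2 w).
have p := pnorm_ge0 Lmax w.
by apply: ler_wpM2l => //; apply: lerXn2r; rewrite ?nnegrE; nra.
Qed.

End concat_bounds.
End Gexp.

(** * The tower property and the contraction of conditioning *)

Section tower.
Context {R : realType} {d : nat} (G : Gexpectation R d).
Local Notation Omega := (path_space R d).
Local Notation E := (Ehat G).
Implicit Types (L : seq R) (w : Omega) (X Y : Omega -> R).

Lemma cumsS (x : nat -> 'rV[R]_d) i : cums x i.+1 = cums x i + x i.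
Proof. by rewrite /cums big_ord_recr. Qed.

Lemma tame_mkseqS m t X : tame (mkseq t m) X -> tame (mkseq t m.+1) X.
Proof. by move=> tX; rewrite mkseqS -cats1; exact: tame_catl. Qed.

Lemma tame_cond_grid m t j X : time_grid m t -> (j <= m)%N ->
  tame (mkseq t m.+1) X -> tame (mkseq t j.+1) (cond G (t j) X).
Proof.
move=> tg jm tX; apply: tame_transfer (tame_cond G (grid_ge0 tg jm) tX).
move=> _ /mapP[_ /mapP[i im ->] ->]; exists (Num.min (t i) (t j)) => //.
rewrite mem_iota/= add0n ltnS in im; apply/mapP.
have [ij|ji] := leqP i j.
  exists i; first by rewrite mem_iota.
  by apply/min_idPl; exact: (grid_le tg ij jm).
exists j; first by rewrite mem_iota/= add0n ltnS.
by apply/min_idPr; exact: (grid_le tg (ltnW ji) im).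
Qed.

Lemma tame_concat_grid m t j X w : time_grid m t -> (j <= m)%N ->
  tame (mkseq t m.+1) X -> tame (mkseq t m.+1) (fun w' => X (concat (t j) w w')).
Proof.
move=> tg jm tX; apply: tame_transfer (tame_concat (grid_ge0 tg jm) w tX).
have jin : t j \in mkseq t m.+1 by apply: map_f; rewrite mem_iota.
move=> x; rewrite mem_cat => /orP[|/mapP[_ _ ->]]; last by exists (t j).
move=> /mapP[y ym ->]; exists (Num.max y (t j)) => //.
by case: leP.
Qed.

(* Conditioning at the last grid time but one integrates a single increment out,
   which is one use of independence. *)
Lemma tower_last m t X : time_grid m.+1 t -> tame (mkseq t m.+2) X ->
  E (cond G (t m) X) = E X.
Proof.
move=> tg tX; have tm0 : 0 <= t m by exact: (grid_ge0 tg).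
case: m tg tX tm0 => [|i] tg tX tm0.
  (* With a single increment, conditioning is at time 0 and returns the constant E X; independence
     is available from the second increment on. *)
  case: (tg) => t0 _; rewrite [in LHS]t0.
  have -> : cond G 0 X = fun=> E X.
    apply/funext => w; rewrite /cond; congr (Ehat G _).
    by apply/funext => w'; rewrite concat0.
  exact: E_cst.
have [W Wt] := @interp_path R d _ _ tg.
have tY := tame_mkseqS (tame_cond_grid tg (leqnSn _) tX).
rewrite (E_grid G tg Wt tY) (E_grid G tg Wt tX).
pose phi (M : 'M[R]_(i.+1 + 1, d)) :=
  X (W (cums (fun k => Num.sqrt (t k.+1 - t k) *: rowat M k))).
have hphi : ClLip phi by exact: (ClLip_cums Wt).
pose past u := \matrix_(k < i.+1) xi (g := G) k u.
(* The sample u drives the path up to [t i.+1], the sample v only its last increment. *)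
have key u v : phi (col_mx (past u) (xi (g := G) i.+1 v)) =
    X (concat (t i.+1) (Wxi t W u) (Wxi t W v)).
  have past_row k : (k < i.+1)%N ->
      rowat (col_mx (past u) (xi (g := G) i.+1 v)) k = xi (g := G) k u.
    move=> ki; rewrite -[X in rowat _ X]/(nat_of_ord (lshift 1 (Ordinal ki))).
    by rewrite rowat_ord rowKu rowK.
  have next_row : rowat (col_mx (past u) (xi (g := G) i.+1 v)) i.+1 =
      xi (g := G) i.+1 v.
    rewrite [X in rowat _ X](_ : _ = nat_of_ord (rshift i.+1 (0 : 'I_1))); last first.
      by rewrite /= addn0.
    by rewrite rowat_ord rowKd; apply/rowP => j; rewrite mxE.
  have pastE l : (l <= i.+1)%N -> cums (fun k => Num.sqrt (t k.+1 - t k) *: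
        rowat (col_mx (past u) (xi (g := G) i.+1 v)) k) l =
      cums (fun k => Num.sqrt (t k.+1 - t k) *: xi (g := G) k u) l.
    move=> li; apply: eq_bigr => k _; rewrite past_row//.
    exact: (leq_trans _ li).
  apply: (tame_grid_ext tX) => l li; rewrite Wt ?cums0//.
  move: li; rewrite leq_eqVlt => /orP[/eqP->|]; last first.
    rewrite ltnS => li; rewrite concat_le//; last exact: (grid_le tg li (leqnSn _)).
    by rewrite pastE// /Wxi Wt ?cums0// leqW.
  rewrite concat_ge//; last exact: (grid_le tg (leqnSn _) (leqnn _)).
  rewrite /Wxi !Wt ?cums0// cumsS next_row pastE//; congr (_ + _).
  by rewrite cumsS addrAC subrr add0r.
transitivity (expect (fun u => expect (fun v =>
    phi (col_mx (past u) (xi (g := G) i.+1 v))))).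
  congr expect; apply/funext => u; rewrite /cond.
  rewrite (E_grid G tg Wt (tame_concat_grid (Wxi t W u) tg (leqnSn _) tX)).
  by congr expect; apply/funext => v; rewrite key.
(* Independence puts both samples at u, and a path concatenated with itself is that path. *)
rewrite -(xi_indep G hphi); congr expect; apply/funext => u; rewrite key.
congr X.
by apply: path_ext => r /=; rewrite (max_idPr tm0) /=; case: leP => _; rewrite ?subrr ?addr0// addrC subrK.
Qed.

(** Induction on the last grid time: the last increment is integrated out both in X and in the
    functional frozen at [t j], and [concatA] identifies the two nested freezings. *)
Lemma tower_grid m t j X : time_grid m t -> (j <= m)%N ->
  tame (mkseq t m.+1) X -> E (cond G (t j) X) = E X.
Proof.
elim: m X => [|m IH] X tg.
  rewrite leqn0 => /eqP-> tX; case: (tg) => -> _.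
  have -> : cond G 0 X = fun=> E X; last exact: E_cst.
  apply/funext => w; rewrite /cond; congr (Ehat G _).
  by apply/funext => w'; rewrite concat0.
rewrite leq_eqVlt => /orP[/eqP-> tX|jm tX].
  have tm0 := grid_ge0 tg (leqnn m.+1).
  congr (Ehat G _); apply/funext => w; rewrite /cond -[RHS](E_cst G).
  congr (Ehat G _); apply/funext => w'; apply: (tame_grid_ext tX) => i im.
  by rewrite concat_le//; exact: (grid_le tg im (leqnn _)).
rewrite ltnS in jm.
have tj0 : 0 <= t j by exact: (grid_ge0 tg (leqW jm)).
have tY := tame_cond_grid tg (leqnSn m) tX.
rewrite -(tower_last tg tX) -(IH _ (grid_prefix tg (leqnSn m)) jm tY).
congr (Ehat G _); apply/funext => w; rewrite /cond.
rewrite -(tower_last tg (tame_concat_grid w tg (leqW jm) tX)).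
congr (Ehat G _); apply/funext => w'; rewrite /cond.
congr (Ehat G _); apply/funext => w''.
by rewrite concatA//; exact: (grid_le tg jm (leqnSn _)).
Qed.

Lemma tower s X : 0 <= s -> Lip X -> E (cond G s X) = E X.
Proof.
move=> s0 /Lip_tame[L tX].
have [|m [t [tg tX' hs]]] := @tame_grid _ _ L [:: s] X tX.
  by move=> x; rewrite inE => /eqP->.
have [j jm <-] := hs s (mem_head _ _); exact: (tower_grid tg jm tX').
Qed.

Lemma Lip_cond s X : 0 <= s -> Lip X -> Lip (cond G s X).
Proof. by move=> s0 /Lip_tame[L tX]; apply: tame_is_Lip (tame_cond G s0 tX). Qed.

Lemma Lip_concat_rv s X w : 0 <= s -> Lip X -> Lip (fun w' => X (concat s w w')).
Proof. by move=> s0 /Lip_tame[L tX]; exact: (Lip_concat s0 w tX). Qed.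

(** For each frozen past this is [E_dist]; the tower property then removes the conditioning on the
    right. *)
Lemma cond_dist s X Y : 0 <= s -> Lip X -> Lip Y ->
  E (fun w => `|cond G s X w - cond G s Y w|) <= E (fun w => `|X w - Y w|).
Proof.
move=> s0 hX hY; have hXY : Lip (fun w => `|X w - Y w|) by lip.
rewrite -[leRHS](tower s0 hXY); apply: E_le.
- by apply: Lip_abs; apply: Lip_sub; exact: Lip_cond.
- exact: Lip_cond.
- by move=> w; apply: (@E_dist _ _ G (fun w' => X (concat s w w'))
      (fun w' => Y (concat s w w'))); exact: Lip_concat_rv.
Qed.

Lemma cexp_Lip_cond s X Z : cexp_Lip G s X Z -> [/\ 0 <= s, Lip X & Z = cond G s X].
Proof.
case=> m [t [phi [j [[tg jm <- hphi] [-> ->]]]]].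
have tj0 : 0 <= t j by exact: (grid_ge0 tg jm).
split=> //; first by exact: (tame_is_Lip (tame_increments t hphi)).
apply/funext => w.
pose A (M : 'M[R]_(m, d)) := \matrix_(i < m)
  (if (i < j)%N then w (t i.+1) - w (t i) else row i M).
have hA : ClLip (fun M => phi (A M)).
  apply: (@ClLip_comp _ _ _ _ _ A (d * m)%:R) => // x y.
  have -> : A x - A y = \matrix_(i < m) (if (i < j)%N then 0 else row i (x - y)).
    apply/row_matrixP => i; rewrite linearB/= !rowK; case: ifP; rewrite ?subrr// linearB//.
  apply: enorm_matrix_rows => i; case: ifP => _; last exact: enorm_row.
  by rewrite enorm0 enorm_ge0.
transitivity (expect (fun u => phi (A (\matrix_(i < m)
    (Num.sqrt (t i.+1 - t i) *: xi (g := G) i u))))).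
  congr expect; apply/funext => u; congr phi; apply/row_matrixP => i.
  by rewrite !rowK; case: ifP.
rewrite -(Ehat_fdd G tg hA); congr (Ehat G _); apply/funext => w'.
congr phi; apply/row_matrixP => i; rewrite !rowK.
have im := ltn_ord i; case: ifP => [ij|/negbT]; last rewrite -leqNgt => ij.
  have h1 := grid_le tg ij jm; have h2 := grid_le tg (ltnW ij) jm.
  by rewrite !concat_le.
have h1 := grid_le tg ij (ltnW im); have h2 := grid_le tg (leqW ij) im.
rewrite !concat_ge//.
by rewrite opprD addrACA subrr add0r opprB addrA subrK.
Qed.

End tower.

(** * Mixed second moments of the increments *)

Section quadratic_moment.
Context {R : realType} {d : nat} (G : Gexpectation R d).
Local Notation E := (Ehat G).

Definition qmom (i j : 'I_d) : R :=
  expect (fun u => `|xi (g := G) 0 u 0 i * xi (g := G) 0 u 0 j|).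

Lemma ClLip_coord_mul (a : R) (i j : 'I_d) : 0 <= a ->
  ClLip (fun x : 'rV[R]_d => a * `|x 0 i * x 0 j|).
Proof.
move=> a0; apply: (@ClLip_power R _ _ _ a 1 1) => // x y.
rewrite -mulrBr normrM (ger0_norm a0) -mulrA ler_wpM2l//.
apply: (le_trans (ler_dist_dist _ _)); rewrite !mul1r expr1.
have -> : x 0 i * x 0 j - y 0 i * y 0 j =
    x 0 i * (x - y) 0 j + (x - y) 0 i * y 0 j by rewrite !mxE; ring.
apply: (le_trans (ler_normD _ _)); rewrite !normrM.
have := enorm_coord x 0 i; have := enorm_coord y 0 j.
have := enorm_coord (x - y) 0 i; have := enorm_coord (x - y) 0 j.
have := normr_ge0 (x 0 i); have := normr_ge0 (y 0 j).
have := normr_ge0 ((x - y) 0 i); have := normr_ge0 ((x - y) 0 j); nra.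
Qed.

Lemma rv_coord_mul i j : rv (fun u => `|xi (g := G) 0 u 0 i * xi (g := G) 0 u 0 j|).
Proof.
have := @rv_comp _ _ _ (rvP (Gbase G)) d (fun l u => xi (g := G) 0 u 0 l)
  (fun x => 1 * `|x 0 i * x 0 j|) (fun l => xi_rvec G 0 0 l) (ClLip_coord_mul i j ler01).
by congr rv; apply/funext => u; rewrite !mxE mul1r.
Qed.

Lemma qmom_ge0 i j : 0 <= qmom i j.
Proof.
rewrite -(sub_cst (expectP (Gbase G)) 0); apply: (sub_mono (expectP (Gbase G))) => //.
- exact: (rv_cst (rvP (Gbase G))).
- exact: rv_coord_mul.
Qed.

Lemma E_increment_grid m t k i j : time_grid m t -> (k < m)%N ->
  E (fun w => `|(w (t k.+1) 0 i - w (t k) 0 i) * (w (t k.+1) 0 j - w (t k) 0 j)|) =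
  (t k.+1 - t k) * qmom i j.
Proof.
move=> tg km; set X := (X in E X = _).
have D0 : 0 <= t k.+1 - t k by rewrite subr_ge0 (grid_le tg).
have tX : tame (mkseq t m.+1) X.
  have inc (l : 'I_d) : tame (mkseq t m.+1) (fun w => w (t k.+1) 0 l - w (t k) 0 l).
    have hc k' : (k' <= m)%N -> tame (mkseq t m.+1) (fun w => w (t k') 0 l).
      move=> k'm; apply: tame_transfer (tame_coord (t k') l) => x.
      rewrite inE => /eqP->; exists (t k') => //.
      by apply: map_f; rewrite mem_iota.
    apply: (tame_dom2 (hc k.+1 km) (hc k (ltnW km))) => w w'.
    by rewrite opprD addrACA -opprD; exact: ler_normB.
  apply: (tame_dom2 (h := X) (tame_mul (inc i) (inc j)) (tame_cst _ 0)) => w w'.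
  by rewrite subrr normr0 addr0; exact: ler_dist_dist.
have [W Wt] := @interp_path R d _ _ tg.
rewrite (E_grid G tg Wt tX).
transitivity (expect (fun u =>
    (fun x => (t k.+1 - t k) * `|x 0 i * x 0 j|) (xi (g := G) k u))).
  congr expect; apply/funext => u; rewrite /X /Wxi !Wt ?cums0// 1?ltnW//.
  rewrite cumsS !mxE; set c := cums _ _; set s := Num.sqrt _.
  rewrite -[t k.+1 - t k](sqr_sqrtr D0) -/s -[s ^+ 2]ger0_norm ?sqr_ge0// -normrM.
  by congr `|_|; ring.
rewrite (xi_law G k (ClLip_coord_mul i j D0)).
by rewrite /comp (sub_homo (expectP (Gbase G)))//; exact: rv_coord_mul.
Qed.

End quadratic_moment.

(** * The completion L_G^1 *)

Section eventual_bounds.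
Context {R : realType}.
Implicit Types (u v : nat -> R) (x y : R).

(* limsup u <= x *)
Definition ule u x := forall e, 0 < e -> exists N, forall k, (N <= k)%N -> u k <= x + e.

Lemma ule_le u v x : ule v x -> (forall k, u k <= v k) -> ule u x.
Proof.
move=> hv uv e /hv[N hN]; exists N => k /hN; exact: le_trans.
Qed.

Lemma ule_mono u x y : x <= y -> ule u x -> ule u y.
Proof.
by move=> xy hu e /hu[N hN]; exists N => k /hN; move/le_trans; apply; rewrite lerD2r.
Qed.

Lemma ule_add u v x y : ule u x -> ule v y -> ule (fun k => u k + v k) (x + y).
Proof.
move=> hu hv e e0; have e2 : 0 < e / 2 by rewrite divr_gt0.
have [N hN] := hu _ e2; have [M hM] := hv _ e2; exists (maxn N M) => k.
by rewrite geq_max => /andP[/hN h1 /hM h2]; lra.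
Qed.

Lemma ule_scale u c x : 0 <= c -> ule u x -> ule (fun k => c * u k) (c * x).
Proof.
move=> c0 hu e e0; have c1 : 0 < c + 1 by lra.
have [N hN] := hu (e / (c + 1)) (divr_gt0 e0 c1); exists N => k /hN h.
apply: (le_trans (ler_wpM2l c0 h)); rewrite mulrDr lerD2l mulrCA ler_piMr ?ltW//.
by rewrite ltr_pdivrMr// mul1r; lra.
Qed.

Lemma ule_sum (I : Type) (r : seq I) (P : pred I) (u : I -> nat -> R) (x : I -> R) :
  (forall i, P i -> ule (u i) (x i)) ->
  ule (fun k => \sum_(i <- r | P i) u i k) (\sum_(i <- r | P i) x i).
Proof.
move=> hu; elim: r => [|i r IH].
  by move=> e e0; exists 0%N => k _; rewrite !big_nil add0r ltW.
rewrite big_cons; under eq_fun do rewrite big_cons.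
by case Pi : (P i) => //; apply: ule_add => //; exact: hu.
Qed.

Lemma ule_cst c : ule (fun=> c) c.
Proof. by move=> e e0; exists 0%N => k _; rewrite lerDl ltW. Qed.

Lemma ule_cvg0 u : u @ \oo --> (0 : R) -> ule u 0.
Proof.
move=> /cvgrPdist_lt h e /h[N _ hN]; exists N => k /hN /=.
by rewrite sub0r normrN add0r => /ltW; exact: le_trans (ler_norm _).
Qed.

Lemma cvg0_ule u : (forall k, 0 <= u k) -> ule u 0 -> u @ \oo --> (0 : R).
Proof.
move=> u0 hu; apply/cvgrPdist_le => e /hu[N hN]; exists N => // k /hN.
by rewrite add0r sub0r normrN ger0_norm.
Qed.

Lemma ule_cst_le c x : ule (fun=> c) x -> c <= x.
Proof. by move=> h; apply/ler_addgt0Pr => e /h[N /(_ N (leqnn _))]. Qed.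

End eventual_bounds.

(** * Norm, distance and uniform integrability in L_G^1 *)

Section LG1_theory.
Context {R : realType} {d : nat} (G : Gexpectation R d).
Local Notation Omega := (path_space R d).
Local Notation E := (Ehat G).

Lemma E_leD (A B C : Omega -> R) : Lip A -> Lip B -> Lip C ->
  (forall w, A w <= B w + C w) -> E A <= E B + E C.
Proof.
move=> hA hB hC h; apply: le_trans (E_add G hB hC); apply: E_le => //.
exact: Lip_add.
Qed.

Lemma E_leD3 (A B C D : Omega -> R) : Lip A -> Lip B -> Lip C -> Lip D ->
  (forall w, A w <= B w + C w + D w) -> E A <= E B + E C + E D.
Proof.
move=> hA hB hC hD h; have hBC := Lip_add hB hC.
by apply: (le_trans (E_leD hA hBC hD h)); rewrite lerD2r; exact: E_add.
Qed.

Lemma LG1P n (X : LGseq R d n) : LG1 G Lip X <-> (forall k, Lipv (X k)) /\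
  forall e, 0 < e -> exists N, forall k l, (N <= k)%N -> (N <= l)%N ->
    E (fun w => enorm (X k w - X l w)) <= e.
Proof.
split=> [[h1 h2]|[h1 h2]]; split=> // e e0.
  have [[P Q] /= [[N1 _ hN1] [N2 _ hN2]] h] := h2 e e0.
  exists (maxn N1 N2) => k l; rewrite !geq_max => /andP[kN1 _] /andP[_ lN2].
  by apply: ltW; apply: (h (k, l)); split; [exact: hN1|exact: hN2].
have e2 : 0 < e / 2 by rewrite divr_gt0.
have [N hN] := h2 _ e2.
exists ([set k | (N <= k)%N], [set k | (N <= k)%N]).
  by split; exists N.
by move=> [k l] [/= kN lN]; apply: (le_lt_trans (hN k l kN lN)); lra.
Qed.

Lemma LG1_Lipv n (X : LGseq R d n) k : LG1 G Lip X -> Lipv (X k).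
Proof. by case/LG1P. Qed.

Lemma Lip_upto_Lip s (X : Omega -> R) : Lip_upto s X -> Lip X.
Proof.
case=> m [t [phi [_ _ hphi ->]]].
by apply: (@tame_is_Lip _ _ (codom t)); exact: tame_matrix.
Qed.

Lemma LG1_upto s n (X : LGseq R d n) : LG1 G (Lip_upto s) X -> LG1 G Lip X.
Proof. by case=> h1 h2; split=> // k j; exact: Lip_upto_Lip (h1 k j). Qed.

Lemma Lip_upto_concat s (X : Omega -> R) w w' : 0 <= s -> Lip_upto s X ->
  X (concat s w w') = X w.
Proof.
move=> s0 [m [t [phi [_ ht _ ->]]]]; congr phi; apply/row_matrixP => i.
by rewrite !rowK concat_le//; have /andP[] := ht i.
Qed.

Lemma Lip_upto_mono s s' (X : Omega -> R) : s <= s' -> Lip_upto s X -> Lip_upto s' X.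
Proof.
move=> ss' [m [t [phi [m0 ht hphi ->]]]]; exists m, t, phi; split=> // i.
by have /andP[-> ts] := ht i; exact: le_trans ss'.
Qed.

(** [LGnorm] is defined by [lim], which carries information only for a convergent sequence; here the
    reverse triangle inequality makes the sequence of norms Cauchy. *)
Lemma LGnorm_is_cvg n (X : LGseq R d n) : LG1 G Lip X ->
  (fun k => E (fun w => enorm (X k w))) @ \oo --> LGnorm G X.
Proof.
move=> /LG1P[hX cX]; apply/cauchy_cvgP/cauchy_exP => e e0.
have e2 : 0 < e / 2 by rewrite divr_gt0.
have [N hN] := cX _ e2; exists (E (fun w => enorm (X N w))).
exists N => // k /= Nk; rewrite /ball/=.
apply: le_lt_trans (_ : _ <= e / 2) _; last lra.
apply: le_trans (hN N k (leqnn _) Nk).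
have hk := hX k; have h := hX N; apply: (le_trans (E_dist G _ _)); [lip|lip|].
by apply: E_le; [lip|lip|move=> w; exact: enorm_dist].
Qed.

Lemma ule_LGnorm n (X : LGseq R d n) : LG1 G Lip X ->
  ule (fun k => E (fun w => enorm (X k w))) (LGnorm G X).
Proof.
move=> /LGnorm_is_cvg/cvgrPdist_lt h e /h[N _ hN]; exists N => k /hN /=.
by rewrite ltr_norml; lra.
Qed.

Lemma LGnorm_ule n (X : LGseq R d n) x : LG1 G Lip X ->
  ule (fun k => E (fun w => enorm (X k w))) x -> LGnorm G X <= x.
Proof.
move=> /LGnorm_is_cvg/cvgrPdist_lt h hx; apply/ler_addgt0Pr => e e0.
have e2 : 0 < e / 2 by rewrite divr_gt0.
have [N _ hN] := h _ e2; have [M hM] := hx _ e2.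
have := hN (maxn N M) (leq_maxl _ _); have := hM _ (leq_maxr N M).
by rewrite ltr_norml; lra.
Qed.

Lemma LG1_0 n : LG1 G Lip (fun _ _ => 0 : 'rV[R]_n).
Proof.
apply/LG1P; split=> [k|e e0]; first by lip.
exists 0%N => k l _ _; apply: le_trans (ltW e0); rewrite -(E_cst G 0).
by apply: E_le; [lip|lip|move=> w; rewrite subrr enorm0].
Qed.

Lemma LG1_add n (X Y : LGseq R d n) : LG1 G Lip X -> LG1 G Lip Y ->
  LG1 G Lip (fun k w => X k w + Y k w).
Proof.
move=> /LG1P[hX cX] /LG1P[hY cY]; apply/LG1P; split=> [k|e e0]; first by lip.
have e2 : 0 < e / 2 by rewrite divr_gt0.
have [N hN] := cX _ e2; have [M hM] := cY _ e2; exists (maxn N M) => k l.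
rewrite !geq_max => /andP[kN kM] /andP[lN lM].
rewrite (splitr e); apply: (@le_trans _ _ (_ + _)); last exact: lerD (hN k l kN lN) (hM k l kM lM).
apply: E_leD; [lip..|move=> w].
by rewrite opprD addrACA enorm_add.
Qed.

Lemma LG1_scale n (a : R) (X : LGseq R d n) : LG1 G Lip X ->
  LG1 G Lip (fun k w => a *: X k w).
Proof.
move=> /LG1P[hX cX]; apply/LG1P; split=> [k|e e0]; first by lip.
have a1 : 0 < `|a| + 1 by have := normr_ge0 a; lra.
have [N hN] := cX _ (divr_gt0 e0 a1); exists N => k l kN lN.
have -> : (fun w => enorm (a *: X k w - a *: X l w)) =
    (fun w => `|a| * enorm (X k w - X l w)).
  by apply/funext => w; rewrite -scalerBr enormZ.
rewrite E_scale//; last by lip.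
apply: (le_trans (ler_wpM2l (normr_ge0 a) (hN k l kN lN))).
by rewrite mulrCA ler_piMr ?ltW// ltr_pdivrMr// mul1r; lra.
Qed.

Lemma LG1_sub n (X Y : LGseq R d n) : LG1 G Lip X -> LG1 G Lip Y ->
  LG1 G Lip (LGsub X Y).
Proof.
move=> hX hY; have := LG1_add hX (LG1_scale (-1) hY).
by congr LG1; apply/funext => k; apply/funext => w; rewrite scaleN1r.
Qed.

Lemma LG1_sum n (I : eqType) (r : seq I) (P : pred I) (X : I -> LGseq R d n) :
  (forall i, i \in r -> P i -> LG1 G Lip (X i)) ->
  LG1 G Lip (fun k w => \sum_(i <- r | P i) X i k w).
Proof.
elim: r => [|i r IH] hX.
  have := LG1_0 n; congr LG1; apply/funext => k; apply/funext => w.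
  by rewrite big_nil.
have hr : LG1 G Lip (fun k w => \sum_(j <- r | P j) X j k w).
  by apply: IH => j jr; apply: hX; rewrite inE jr orbT.
case Pi : (P i); last first.
  by move: hr; congr LG1; apply/funext => k; apply/funext => w; rewrite big_cons Pi.
have := LG1_add (hX i (mem_head _ _) Pi) hr.
by congr LG1; apply/funext => k; apply/funext => w; rewrite big_cons Pi.
Qed.

Lemma LG1_cst n (X : Omega -> 'rV[R]_n) : Lipv X -> LG1 G Lip (LGcst X).
Proof.
move=> hX; apply/LG1P; split=> [//|e e0]; exists 0%N => k l _ _.
apply: le_trans (ltW e0); rewrite -(E_cst G 0).
by apply: E_le; [by rewrite /LGcst; lip|lip|move=> w; rewrite subrr enorm0].
Qed.

Lemma LGnorm_ge0 n (X : LGseq R d n) : LG1 G Lip X -> 0 <= LGnorm G X.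
Proof.
move=> hX; apply: ule_cst_le; apply: (ule_le (ule_LGnorm hX)) => k.
have := LG1_Lipv k hX => hk; apply: E_ge0; first by lip.
by move=> w; exact: enorm_ge0.
Qed.

Lemma LGnorm_le_add n p q (X : LGseq R d n) (Y : LGseq R d p) (Z : LGseq R d q) :
  LG1 G Lip X -> LG1 G Lip Y -> LG1 G Lip Z ->
  (forall k w, enorm (X k w) <= enorm (Y k w) + enorm (Z k w)) ->
  LGnorm G X <= LGnorm G Y + LGnorm G Z.
Proof.
move=> hX hY hZ h; apply: LGnorm_ule => //.
apply: (ule_le (ule_add (ule_LGnorm hY) (ule_LGnorm hZ))) => k.
have := LG1_Lipv k hX; have := LG1_Lipv k hY; have := LG1_Lipv k hZ => ? ? ?.
by apply: E_leD; [lip..|move=> w; exact: h].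
Qed.

Lemma LGdist_triangle n (Y X Z : LGseq R d n) :
  LG1 G Lip X -> LG1 G Lip Y -> LG1 G Lip Z ->
  LGdist G X Z <= LGdist G X Y + LGdist G Y Z.
Proof.
move=> hX hY hZ; apply: LGnorm_le_add; try exact: LG1_sub.
by move=> k w; exact: enorm_triangle.
Qed.

Lemma LGdistC n (X Y : LGseq R d n) : LGdist G X Y = LGdist G Y X.
Proof.
rewrite /LGdist /LGnorm /LGsub.
suff -> : (fun k => E (fun w => enorm (X k w - Y k w))) =
  (fun k => E (fun w => enorm (Y k w - X k w))) by [].
by apply/funext => k; congr (Ehat G _); apply/funext => w; exact: enorm_distC.
Qed.

Lemma LGdist_ge0 n (X Y : LGseq R d n) : LG1 G Lip X -> LG1 G Lip Y ->
  0 <= LGdist G X Y.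
Proof. by move=> hX hY; apply: LGnorm_ge0; exact: LG1_sub. Qed.

Lemma ule_LGdist n (X Y : LGseq R d n) : LG1 G Lip X -> LG1 G Lip Y ->
  ule (fun k => E (fun w => enorm (X k w - Y k w))) (LGdist G X Y).
Proof. by move=> hX hY; apply: ule_LGnorm; exact: LG1_sub. Qed.

Lemma LGdist_ule n (X Y : LGseq R d n) x : LG1 G Lip X -> LG1 G Lip Y ->
  ule (fun k => E (fun w => enorm (X k w - Y k w))) x -> LGdist G X Y <= x.
Proof. by move=> hX hY; apply: LGnorm_ule; exact: LG1_sub. Qed.

Lemma LGnorm_dist n (X Y : LGseq R d n) : LG1 G Lip X -> LG1 G Lip Y ->
  LGnorm G X <= LGnorm G Y + LGdist G X Y.
Proof.
move=> hX hY; apply: LGnorm_le_add => //; first exact: LG1_sub.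
by move=> k w; have := enorm_add (Y k w) (X k w - Y k w); rewrite addrC subrK.
Qed.

(* Uniform integrability: X_k is close to a fixed X_N, and X_N has a second
   moment because L_ip is closed under products. *)
Lemma LG1_ui n (X : LGseq R d n) e : LG1 G Lip X -> 0 < e ->
  exists (b : R) (r : nat -> Omega -> R), [/\ 0 < b, forall k, Lip (r k),
    forall k w, 0 <= r k w, ule (fun k => E (r k)) e &
    forall k w, enorm (X k w) <= b + r k w].
Proof.
move=> /LG1P[hX cX] e0; have e2 : 0 < e / 2 by rewrite divr_gt0.
have [N hN] := cX _ e2; have hXN := hX N.
pose q := E (fun w => enorm (X N w) ^+ 2).
have q0 : 0 <= q by apply: E_ge0; [lip|move=> w; exact: sqr_ge0].
(* By x <= b + x^2 / b, the part of |X_N| above b costs q / b in expectation, and this b gives q / b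
   <= e / 2. The summand 1 keeps b positive when q = 0. *)
pose b := 2 * q / e + 1; have b0 : 0 < b.
  have : 0 <= 2 * q / e by apply: divr_ge0; [lra|exact: ltW].
  by rewrite /b; lra.
exists b, (fun k w => enorm (X k w - X N w) + b^-1 * enorm (X N w) ^+ 2).
split=> //.
- by move=> k; have hk := hX k; lip.
- by move=> k w; rewrite addr_ge0 ?enorm_ge0// mulr_ge0 ?sqr_ge0// invr_ge0 ltW.
- move=> e' e'0; exists N => k Nk; have hk := hX k.
  apply: (le_trans (E_add G _ _)); [lip|lip|]; rewrite E_scale ?invr_ge0 ?ltW//; last by lip.
  have := hN k N Nk (leqnn _); rewrite -/q.
  suff : b^-1 * q <= e / 2 by lra.
  rewrite ler_pdivrMl// /b; have -> : (2 * q / e + 1) * (e / 2) = q + e / 2.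
    by have e_neq0 := lt0r_neq0 e0; field.
  lra.
- move=> k w; have := enorm_add (X k w - X N w) (X N w); rewrite subrK.
  suff : enorm (X N w) <= b + b^-1 * enorm (X N w) ^+ 2 by lra.
  have x0 := enorm_ge0 (X N w); move: (enorm _) x0 => x x0.
  have [xb|bx] := leP x b; first by rewrite ler_wpDr// mulr_ge0 ?sqr_ge0// invr_ge0 ltW.
  suff : x <= b^-1 * x ^+ 2 by lra.
  rewrite ler_pdivlMl//; nra.
Qed.

(** Each component is a contraction through its own approximating sequences; summing the components
    to recover the Euclidean norm costs the factor n. *)
Lemma cexp_dist n s (X X' Z Z' : LGseq R d n) :
  LG1 G Lip X -> LG1 G Lip X' -> LG1 G Lip Z -> LG1 G Lip Z' ->
  is_cexp G s X Z -> is_cexp G s X' Z' ->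
  LGdist G Z Z' <= n%:R * LGdist G X X'.
Proof.
move=> hX hX' hZ hZ' cZ cZ'; apply: LGdist_ule => //.
have hi (i : 'I_n) : ule (fun k => E (fun w => `|Z k w 0 i - Z' k w 0 i|)) (LGdist G X X').
  have [U [V [hUV UX VZ]]] := cZ i; have [U' [V' [hUV' UX' VZ']]] := cZ' i.
  have := ule_add (ule_add (ule_add (ule_cvg0 UX) (ule_cvg0 VZ))
    (ule_add (ule_cvg0 UX') (ule_cvg0 VZ'))) (ule_LGdist hX hX').
  rewrite !add0r => h; apply: (ule_le h) => k.
  have [s0 hU eV] := cexp_Lip_cond (hUV k).
  have [_ hU' eV'] := cexp_Lip_cond (hUV' k).
  have hV : Lip (V k) by rewrite eV; exact: Lip_cond.
  have hV' : Lip (V' k) by rewrite eV'; exact: Lip_cond.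
  have lX := LG1_Lipv k hX; have lX' := LG1_Lipv k hX'.
  have lZ := LG1_Lipv k hZ; have lZ' := LG1_Lipv k hZ'.
  have lXi := lX i; have lXi' := lX' i; have lZi := lZ i; have lZi' := lZ' i.
  have h1 : E (fun w => `|Z k w 0 i - Z' k w 0 i|) <=
      E (fun w => `|V k w - Z k w 0 i|) + E (fun w => `|V' k w - Z' k w 0 i|) +
      E (fun w => `|V k w - V' k w|).
    apply: E_leD3; [lip..|move=> w].
    have := ler_distD (V k w) (Z k w 0 i) (Z' k w 0 i).
    have := ler_distD (V' k w) (V k w) (Z' k w 0 i).
    by rewrite (distrC (Z k w 0 i) (V k w)); lra.
  have h2 : E (fun w => `|V k w - V' k w|) <= E (fun w => `|U k w - U' k w|).
    by rewrite eV eV'; exact: cond_dist.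
  have h3 : E (fun w => `|U k w - U' k w|) <=
      E (fun w => `|U k w - X k w 0 i|) + E (fun w => `|U' k w - X' k w 0 i|) +
      E (fun w => enorm (X k w - X' k w)).
    apply: E_leD3; [lip..|move=> w].
    have := ler_distD (X k w 0 i) (U k w) (U' k w).
    have := ler_distD (X' k w 0 i) (X k w 0 i) (U' k w).
    have := enorm_coord (X k w - X' k w) 0 i.
    by rewrite (distrC (X' k w 0 i)) !mxE; lra.
  lra.
have := @ule_sum _ _ (index_enum 'I_n) xpredT _ _ (fun i _ => hi i).
rewrite sumr_const card_ord; rewrite [X in ule _ X -> _](esym (mulr_natl _ _)) => h; apply: (ule_le h) => k.
have lZ := LG1_Lipv k hZ; have lZ' := LG1_Lipv k hZ'.
apply: (@le_trans _ _ (E (fun w => \sum_(i < n) `|Z k w 0 i - Z' k w 0 i|))).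
  apply: E_le; [lip|by apply: Lip_sum => i _ _; have ? := lZ i; have ? := lZ' i; lip|move=> w].
  apply: (le_trans (enorm_le_sum _)); rewrite big_ord1; apply: ler_sum => i _.
  by rewrite !mxE.
by apply: E_sum => i _ _; have ? := lZ i; have ? := lZ' i; lip.
Qed.

End LG1_theory.

(** * Upper integrals *)

Section dominated.
Context {R : realType} (T : R).
Implicit Types (h : R -> R) (x y : R).
Local Notation mu := (@lebesgue_measure R).

(* The upper integral of h over [0, T] is at most y (up to attainment). *)
Definition dominated h y := exists g : R -> R,
  [/\ measurable_fun `[0, T] g, forall s, 0 <= s <= T -> 0 <= g s /\ h s <= g s &
      (\int[mu]_(s in `[0%R, T]) (g s)%:E <= y%:E)%E].

Lemma dominated_upper_int h y : (upper_int `[0%R, T] h < y%:E)%E -> dominated h y.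
Proof.
move=> /ereal_inf_lt[_ [g [mg hg] <-] /ltW gy]; by exists g.
Qed.

Lemma dominated_le h h' y y' : (forall s, 0 <= s <= T -> h s <= h' s) -> y' <= y ->
  dominated h' y' -> dominated h y.
Proof.
move=> hh yy [g [mg hg gy]]; exists g; split=> //.
  by move=> s sT; have [g0 gh] := hg s sT; split=> //; exact: le_trans (hh s sT) gh.
by apply: (le_trans gy); rewrite lee_fin.
Qed.

Lemma dominated_ge0 h y : dominated h y -> 0 <= y.
Proof.
case=> g [mg hg gy]; rewrite -lee_fin; apply: le_trans gy.
by apply: integral_ge0 => s /=; rewrite in_itv/= => sT; rewrite lee_fin; have [] := hg s sT.
Qed.

Lemma dominated_add h h' y y' : dominated h y -> dominated h' y' ->
  dominated (fun s => h s + h' s) (y + y').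
Proof.
move=> [g [mg hg gy]] [g' [mg' hg' gy']]; exists (fun s => g s + g' s); split.
- exact: measurable_funD.
- move=> s sT; have [? ?] := hg s sT; have [? ?] := hg' s sT.
  by split; [exact: addr_ge0|exact: lerD].
- under eq_integral do rewrite EFinD.
  rewrite ge0_integralD//=; first by rewrite EFinD leeD.
  + by move=> s; rewrite /= in_itv/= => sT; rewrite lee_fin; have [] := hg s sT.
  + exact/measurable_EFinP.
  + by move=> s; rewrite /= in_itv/= => sT; rewrite lee_fin; have [] := hg' s sT.
  + exact/measurable_EFinP.
Qed.

Lemma dominated_sum (I : Type) (r : seq I) (P : pred I) (h : I -> R -> R) (y : I -> R) :
  (forall i, P i -> dominated (h i) (y i)) ->
  dominated (fun s => \sum_(i <- r | P i) h i s) (\sum_(i <- r | P i) y i).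
Proof.
move=> hd; elim: r => [|i r IH].
  exists (fun=> 0); split.
  - exact: measurable_cst.
  - by move=> s _; rewrite big_nil.
  - by rewrite big_nil integral0.
rewrite big_cons; under eq_fun do rewrite big_cons.
by case Pi : (P i) => //; apply: dominated_add => //; exact: hd.
Qed.

(** The interval may reach beyond [0, T]. Being half-open, it has to in order to cover T itself,
    which explains the bound [r * T + r] for a constant below. *)
Lemma dominated_step a b r : 0 <= r -> a <= b ->
  dominated (fun s => if a <= s < b then r else 0) (r * (b - a)).
Proof.
move=> r0 ab; pose P : set R := [set` `[a, b[].
have mP : measurable P by exact: measurable_itv.
exists ((fun=> r) \_ P); split.
- by apply/measurable_restrict => //; exact: measurable_cst.
- by move=> s _; rewrite patchE /P mem_setE in_itv/=; case: ifP.
- have -> : (fun s => (((fun=> r) \_ P) s)%:E) = (EFin \o (fun=> r)) \_ P.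
    by apply/funext => s; rewrite /= !patchE; case: ifP.
  rewrite -integral_mkcondr.
  apply: (@le_trans _ _ (\int[mu]_(s in P) (cst r%:E s))%E).
    apply: ge0_subset_integral.
    - by apply: measurableI.
    - exact: mP.
    - exact: measurable_cst.
    - by move=> ? _; rewrite lee_fin.
    - exact: subIsetr.
  rewrite integral_cst//= /P lebesgue_measure_itv/= lte_fin.
  case: ltP => [_|ba]; first by rewrite -EFinB -EFinM.
  by rewrite mule0 lee_fin mulr_ge0// subr_ge0.
Qed.

Lemma dominated_cst r : 0 <= r -> 0 <= T -> dominated (fun=> r) (r * T + r).
Proof.
move=> r0 T0; have := dominated_step r0 (_ : 0 <= T + 1) => /(_ _)/=.
rewrite subr0 mulrDr mulr1 => h; apply: (dominated_le _ (lexx _) (h _)); last lra.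
by move=> s /andP[-> sT]; rewrite (le_lt_trans sT)//; lra.
Qed.

(** A majorant g of a step function is at least its value on each cell, so its integral over the
    disjoint cells dominates the Riemann sum. This converts an upper integral into a finite sum, to
    which E can be applied. *)
Lemma dominated_grid m t h y : time_grid m t -> t m <= T ->
  (forall i s, (i < m)%N -> t i <= s < t i.+1 -> h s = h (t i)) ->
  (forall i, (i < m)%N -> 0 <= h (t i)) -> dominated h y ->
  \sum_(i < m) (t i.+1 - t i) * h (t i) <= y.
Proof.
move=> tg tT hs h0 [g [mg hg gy]].
have t0 : t 0 = 0 by case: tg.
have sub k : (k <= m)%N -> [set` `[0, t k[] `<=` [set` `[0%R, T]].
  move=> km s /=; rewrite !in_itv/= => /andP[-> /ltW sk]/=.
  by rewrite (le_trans sk)// (le_trans (grid_le tg km (leqnn _))).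
have mgE A : measurable A -> A `<=` [set` `[0%R, T]] -> measurable_fun A (EFin \o g).
  by move=> mA AT; apply: (measurable_funS _ AT) => //; exact/measurable_EFinP.
have g0 A s : A `<=` [set` `[0%R, T]] -> A s -> (0 <= (EFin \o g) s)%E.
  by move=> AT /AT /=; rewrite in_itv/= => /hg[] ? _; rewrite lee_fin.
have key k : (k <= m)%N -> ((\sum_(i < k) (t i.+1 - t i) * h (t i))%:E <=
    \int[mu]_(s in `[0%R, t k[) (EFin \o g) s)%E.
  elim: k => [|k IH] km.
    rewrite big_ord0; apply: integral_ge0 => s sA; apply: (g0 [set` `[0, t 0%N[]) => //.
    exact: sub.
  have tk := grid_lt tg (ltnSn k) km; have tk0 := grid_ge0 tg (ltnW km).
  have eU : [set` `[0, t k.+1[] = [set` `[0, t k[] `|` [set` `[t k, t k.+1[].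
    apply/seteqP; split=> s /=; rewrite !in_itv/=.
      by move=> /andP[-> ->]; rewrite andbT; case: (ltP s (t k)) => _; [left|right].
    by case=> /andP[h1 h2]; apply/andP; split=> //; [exact: lt_trans tk|exact: le_trans h1].
  have := sub _ km; rewrite eU => subU.
  have subr : [set` `[t k, t k.+1[] `<=` [set` `[0%R, T]].
    by move=> s hs'; apply: subU; right.
  rewrite ge0_integral_setU//=; first last.
  - apply/disj_setPS => s [] /=; rewrite !in_itv/= => /andP[_ h1] /andP[h2 _].
    by move: (lt_le_trans h1 h2); rewrite ltxx.
  - by move=> s sA; exact: (g0 _ s subU sA).
  - by apply: mgE => //; exact: measurableU.
  rewrite big_ord_recr/= EFinD; apply: leeD; first exact: (IH (ltnW km)).
  apply: (@le_trans _ _ (\int[mu]_(s in `[t k, t k.+1[) (cst (h (t k))%:E s))%E).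
    rewrite integral_cst//= lebesgue_measure_itv/= lte_fin tk -EFinB -EFinM lee_fin.
    by rewrite mulrC.
  apply: ge0_le_integral => //=.
  - by move=> s _; rewrite lee_fin h0.
  - exact: mgE.
  - move=> s hs'; rewrite lee_fin; have := subr _ hs'; rewrite /= in_itv/= => /hg[_].
    by rewrite (hs k)//; move: hs'; rewrite /= in_itv.
rewrite -lee_fin; apply: le_trans gy; apply: (le_trans (key m (leqnn m))).
apply: ge0_subset_integral => //; [by apply: mgE|by move=> s; apply: g0|exact: (sub _ (leqnn m))].
Qed.

End dominated.

(** * Integrals of simple processes *)

(** All multiples of a = h / 2 are added up to one beyond the sum of L, which bounds every element
    of L. If a cell had length at least h, the first multiple of a after its left end would be a
    grid point inside it. *)
Lemma fine_grid (R : realType) (L : seq R) (h : R) : 0 < h ->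
  (forall x, x \in L -> 0 <= x) -> exists m t, [/\ time_grid m t,
    forall x, x \in L -> exists2 i, (i <= m)%N & t i = x &
    forall k, (k < m)%N -> t k.+1 - t k < h].
Proof.
move=> h0 L0; pose a := h / 2; have a0 : 0 < a by rewrite divr_gt0.
pose N := Num.bound ((\sum_(x <- L) x) / a).
have sL x : x \in L -> x <= N%:R * a.
  move=> xL; apply: (@le_trans _ _ (\sum_(x <- L) x)).
    rewrite (perm_big _ (perm_to_rem xL))/= big_cons lerDl big_seq.
    by apply: sumr_ge0 => y /mem_rem/L0.
  rewrite -ler_pdivrMr//; apply: ltW; apply: archi_boundP.
  by apply: divr_ge0; [rewrite big_seq; apply: sumr_ge0 => y /L0|exact: ltW].
pose M : seq R := [seq k%:R * a | k <- iota 0 N.+1].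
have [|m [t [tg h1 h2]]] := @grid_of R (L ++ M).
  move=> x; rewrite mem_cat => /orP[/L0//|/mapP[k _ ->]].
  by rewrite mulr_ge0// ltW.
exists m, t; split=> //; first by move=> x xL; apply: h1; rewrite mem_cat xL.
move=> k km; rewrite ltNge; apply/negP => gap.
have tk0 := grid_ge0 tg (ltnW km); pose q := (Num.truncn (t k / a)).+1.
have tka : 0 <= t k / a by rewrite divr_ge0// ltW.
have /andP[q1 q2] := truncn_itv tka.
have k1 : t k < q%:R * a by rewrite -ltr_pdivrMr.
have k2 : q%:R * a < t k.+1.
  have : q%:R * a <= t k + a.
    by rewrite /q -natr1 mulrDl mul1r lerD2r -ler_pdivlMr.
  have := gap; have : h = a + a by rewrite -mulrDr /a; field.
  lra.
have kN : t k.+1 <= N%:R * a.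
  have := h2 k.+1 km; rewrite inE mem_cat => /or3P[/eqP->|/sL//|/mapP[j]].
    by rewrite mulr_ge0// ltW.
  by rewrite mem_iota/= add0n ltnS => jN ->; rewrite ler_pM2r// ler_nat.
have qN : (q <= N)%N.
  by rewrite -(ler_nat R) -(ler_pM2r a0); apply: ltW; exact: lt_le_trans kN.
have [|i im ti] := h1 (q%:R * a).
  by rewrite mem_cat; apply/orP; right; apply: (map_f (fun k : nat => k%:R * a)); rewrite mem_iota/= add0n ltnS.
have ki : (k < i)%N by rewrite -(grid_ltE tg (ltnW km) im) ti.
have ik : (i < k.+1)%N by rewrite -(grid_ltE tg im km) ti.
by have := leq_trans ki ik; rewrite ltnn.
Qed.

(** * Finite families of steps and their time integrals *)

Section families.
Context {R : realType} {d : nat} (G : Gexpectation R d).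
Local Notation Omega := (path_space R d).
Local Notation E := (Ehat G).
Variables (T : R) (n : nat) (I : finType).
Variables (al be : I -> R) (c : I -> LGseq R d n).

(** Steps [c i] on [al i, be i) that may overlap. The difference of two simple processes over
    unrelated grids, restricted to [t, T], is such a family without passing to a common
    refinement. *)
Definition fam_val (s : R) : LGseq R d n :=
  fun k w => \sum_i (if al i <= s < be i then c i k w else 0).

Hypothesis al0 : forall i, 0 <= al i.
Hypothesis albe : forall i, al i <= be i.
Hypothesis beT : forall i, be i <= T.
Hypothesis cL : forall i, LG1 G (Lip_upto (al i)) (c i).
Hypothesis T0 : 0 <= T.

Let be0 i : 0 <= be i.
Proof. exact: le_trans (albe i). Qed.

Let cLip i : LG1 G Lip (c i).
Proof. exact: LG1_upto (cL i). Qed.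

Lemma LG1_fam_val s : LG1 G Lip (fam_val s).
Proof.
apply: LG1_sum => i _ _; case: (al i <= s < be i); [exact: cLip|exact: LG1_0].
Qed.

Lemma fam_val_concat s k w w' : 0 <= s ->
  fam_val s k (concat s w w') = fam_val s k w.
Proof.
move=> s0; apply: eq_bigr => i _; case: ifP => // /andP[als _].
apply/rowP => j; have [h _] := cL i.
exact: (Lip_upto_concat w w' s0 (Lip_upto_mono als (h k j))).
Qed.

Section on_a_grid.
Variables (m : nat) (t : nat -> R).
Hypothesis tg : time_grid m t.
Hypothesis tal : forall i, exists2 x, (x <= m)%N & t x = al i.
Hypothesis tbe : forall i, exists2 x, (x <= m)%N & t x = be i.
Hypothesis tT : t m = T.

Lemma fam_val_step i s : (i < m)%N -> t i <= s < t i.+1 ->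
  fam_val s = fam_val (t i).
Proof.
move=> im /andP[h1 h2]; apply/funext => k; apply/funext => w.
apply: eq_bigr => l _; have [x xm ex] := tal l; have [y ym ey] := tbe l.
suff -> : (al l <= s < be l) = (al l <= t i < be l) by [].
rewrite -ex -ey; congr andb.
- rewrite (grid_leE tg xm (ltnW im)); apply/idP/idP => [xs|xi].
    by have := le_lt_trans xs h2; rewrite (grid_ltE tg xm im) ltnS.
  exact: le_trans (grid_le tg xi (ltnW im)) h1.
- rewrite (grid_ltE tg (ltnW im) ym); apply/idP/idP => [sy|iy].
    by have := le_lt_trans h1 sy; rewrite (grid_ltE tg (ltnW im) ym).
  exact: lt_le_trans h2 (grid_le tg iy ym).
Qed.

Lemma fam_dominated y : dominated T (fun s => LGnorm G (fam_val s)) y ->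
  \sum_(i < m) (t i.+1 - t i) * LGnorm G (fam_val (t i)) <= y.
Proof.
move=> hd; apply: (dominated_grid tg (h := fun s => LGnorm G (fam_val s))) hd.
- by rewrite tT.
- by move=> i s im hs; rewrite (fam_val_step im hs).
- by move=> i _; apply: LGnorm_ge0; exact: LG1_fam_val.
Qed.

Lemma fam_telescope (f : nat -> R) i x y : (x <= m)%N -> t x = al i -> (y <= m)%N -> t y = be i ->
  \sum_(z < m) (if al i <= t z < be i then f z.+1 - f z else 0) = f y - f x.
Proof.
move=> xm ex ym ey; have xy : (x <= y)%N by rewrite -(grid_leE tg)// ex ey.
rewrite -(telescope_sumr f xy) -(big_mkord xpredT (fun z =>
  if al i <= t z < be i then f z.+1 - f z else 0)).
rewrite (big_cat_nat (leq0n x) xm)/= (big_cat_nat xy ym)/=.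
rewrite big_nat big1 ?add0r; last first.
  move=> z /= zx; have zm := leq_trans zx xm.
  by rewrite -ex (grid_leE tg xm (ltnW zm)) leqNgt zx.
rewrite [X in _ + X]big_nat [X in _ + X]big1 ?addr0; last first.
  move=> z /andP[yz zm]; rewrite -ey (grid_ltE tg (ltnW zm) ym).
  by rewrite [(z < y)%N]ltnNge yz andbF.
rewrite big_nat [RHS]big_nat; apply: eq_bigr => z /andP[xz zy].
have zm := leq_trans zy ym.
by rewrite -ex -ey (grid_leE tg xm (ltnW zm)) (grid_ltE tg (ltnW zm) ym) xz zy.
Qed.

(** Each increment [F i] telescopes over the cells inside [al i, be i); exchanging the sums
    collects, on each cell, the value of the process there. It serves with f the time and with f a
    discrete covariation. *)
Lemma fam_regroup (f : nat -> R) (F : I -> R) k w :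
  (forall i x y, (x <= m)%N -> t x = al i -> (y <= m)%N -> t y = be i -> F i = f y - f x) ->
  \sum_i F i *: c i k w = \sum_(z < m) (f z.+1 - f z) *: fam_val (t z) k w.
Proof.
move=> hF; transitivity (\sum_i \sum_(z < m)
    (f z.+1 - f z) *: (if al i <= t z < be i then c i k w else 0)).
  apply: eq_bigr => i _; have [x xm ex] := tal i; have [y ym ey] := tbe i.
  rewrite (hF i x y)// -(fam_telescope f xm ex ym ey) scaler_suml.
  by apply: eq_bigr => z _; case: ifP; rewrite ?scale0r ?scaler0.
by rewrite exchange_big/=; apply: eq_bigr => z _; rewrite scaler_sumr.
Qed.

End on_a_grid.

Lemma LGnorm_int_dt y : dominated T (fun s => LGnorm G (fam_val s)) y ->
  LGnorm G (fun k w => \sum_i (be i - al i) *: c i k w) <= y.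
Proof.
move=> hd.
pose L := T :: ([seq al i | i : I] ++ [seq be i | i : I]).
have [|m [t [tg h1 h2]]] := @grid_of R L.
  by move=> x; rewrite inE mem_cat => /or3P[/eqP->//|/mapP[i _ ->]|/mapP[i _ ->]].
have tal i : exists2 x, (x <= m)%N & t x = al i.
  by apply: h1; rewrite inE mem_cat; apply/or3P; constructor 2; apply: map_f; rewrite mem_enum.
have tbe i : exists2 x, (x <= m)%N & t x = be i.
  by apply: h1; rewrite inE mem_cat; apply/or3P; constructor 3; apply: map_f; rewrite mem_enum.
have tT : t m = T.
  apply/eqP; rewrite eq_le; apply/andP; split.
    have := h2 m (leqnn m); rewrite !inE mem_cat => /or4P[/eqP->|/eqP->|/mapP[i _ ->]|/mapP[i _ ->]] //.
    exact: le_trans (beT i).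
  by have [i im <-] := h1 T (mem_head _ _); exact: (grid_le tg im).
apply: le_trans (fam_dominated tg tal tbe tT hd).
apply: LGnorm_ule; first by apply: LG1_sum => i _ _; exact: LG1_scale.
have hu (i : 'I_m) : ule (fun k => (t i.+1 - t i) * E (fun w => enorm (fam_val (t i) k w)))
    ((t i.+1 - t i) * LGnorm G (fam_val (t i))).
  apply: ule_scale; last by apply: ule_LGnorm; exact: LG1_fam_val.
  by rewrite subr_ge0 (grid_le tg).
have := @ule_sum _ _ (index_enum 'I_m) xpredT _ _ (fun i _ => hu i).
move=> h; apply: (ule_le h) => k.
have lc i := LG1_Lipv k (cLip i); have lv s := LG1_Lipv k (LG1_fam_val s).
apply: (@le_trans _ _ (E (fun w => \sum_(i < m) (t i.+1 - t i) * enorm (fam_val (t i) k w)))).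
  apply: E_le; [lip|lip|move=> w].
  rewrite (fam_regroup tg tal tbe (f := t)); last by move=> i x y' _ <- _ <-.
  apply: (le_trans (enorm_sum _ _ _)); apply: ler_sum => i _.
  by rewrite enormZ ger0_norm// subr_ge0 (grid_le tg).
apply: (le_trans (E_sum _ _)); first by move=> i _ _; lip.
by apply: ler_sum => i _; rewrite E_scale//; [rewrite subr_ge0 (grid_le tg)|lip].
Qed.

End families.

(** * Finite families integrated against the mutual variation *)

Section stochastic_families.
Context {R : realType} {d : nat} (G : Gexpectation R d).
Local Notation Omega := (path_space R d).
Local Notation E := (Ehat G).
Variables (a b : 'I_d) (q : R -> LGseq R d 1).
Hypothesis qP : forall s, 0 <= s -> is_qv G a b s (q s).

Definition dqv (t : nat -> R) (k : nat) (w : Omega) : R :=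
  (w (t k.+1) 0 a - w (t k) 0 a) * (w (t k.+1) 0 b - w (t k) 0 b).

Lemma Lip_dqv t k : Lip (dqv t k).
Proof. by rewrite /dqv; lip. Qed.

Lemma LG1_q s : 0 <= s -> LG1 G Lip (q s).
Proof. by case/qP => /LG1_upto. Qed.

(** Once conditioned at [t k], X is a nonnegative constant and positive homogeneity takes it out of
    the sublinear E. *)
Lemma E_dqv_mul m t k (X : Omega -> R) : time_grid m t -> (k < m)%N ->
  Lip X -> (forall w, 0 <= X w) -> (forall w w', X (concat (t k) w w') = X w) ->
  E (fun w => `|dqv t k w| * X w) = (t k.+1 - t k) * qmom G a b * E X.
Proof.
move=> tg km hX X0 cX; have tk0 := grid_ge0 tg (ltnW km).
have hd := Lip_dqv t k; have tk := grid_le tg (leqnSn k) km.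
rewrite -(tower G tk0 (X := fun w => `|dqv t k w| * X w)); last by lip.
rewrite -(E_increment_grid G a b tg km) -[E (fun w => `|(_ : R)|)]/(E (fun w => `|dqv t k w|)).
rewrite -E_scale//; last by apply: E_ge0; [lip|].
congr (Ehat G _); apply/funext => w; rewrite /cond.
rewrite [RHS]mulrC -E_scale//; last by lip.
congr (Ehat G _); apply/funext => w'; rewrite cX mulrC; congr (_ * `|_|).
rewrite /dqv [concat _ _ _ (t k)]concat_le// !concat_ge// !mxE.
by congr (_ * _); ring.
Qed.

Lemma qv_mesh (e : R) (L : seq R) : 0 < e -> (forall s, s \in L -> 0 <= s) ->
  exists2 h, 0 < h & forall s, s \in L -> forall m (p : nat -> R), time_grid m p -> p m = s ->
    (forall k, (k < m)%N -> p k.+1 - p k < h) ->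
    LGdist G (LGcst (fun w : Omega => \row__ \sum_(k < m) dqv p k w)) (q s) < e.
Proof.
move=> e0; elim: L => [|s L IH] L0; first by exists 1.
case: IH => [x xL|h h0 hh]; first by apply: L0; rewrite inE xL orbT.
have [_ /(_ e e0)[h' h'0 hh']] := qP (L0 s (mem_head _ _)).
exists (Num.min h h'); first by rewrite lt_min h0.
move=> x; rewrite inE => /orP[/eqP->|xL] m p tg pm mesh.
  by apply: hh' => // k /mesh; rewrite lt_min => /andP[].
by apply: (hh x xL) => // k /mesh; rewrite lt_min => /andP[].
Qed.

Variables (T : R) (n : nat) (I : finType).
Variables (al be : I -> R) (c P : I -> LGseq R d n).
Hypothesis al0 : forall i, 0 <= al i.
Hypothesis albe : forall i, al i <= be i.
Hypothesis beT : forall i, be i <= T.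
Hypothesis cL : forall i, LG1 G (Lip_upto (al i)) (c i).
Hypothesis T0 : 0 <= T.
Hypothesis cP : forall i, is_prod G (c i) (LGsub (q (be i)) (q (al i))) (P i).

Let be0 i : 0 <= be i.
Proof. exact: le_trans (albe i). Qed.

Let cLip i : LG1 G Lip (c i).
Proof. exact: LG1_upto (cL i). Qed.

Let PLip i : LG1 G Lip (P i).
Proof. by case: (cP i). Qed.

Let Q i := LGsub (q (be i)) (q (al i)).

Let QLip i : LG1 G Lip (Q i).
Proof. by apply: LG1_sub; apply: LG1_q. Qed.

(* On a fine grid the increments of <B^a,B^b> are replaced by discrete
   covariations, which are independent of the adapted coefficients. *)
Lemma qv_discretization e : 0 < e -> exists m t (Qh : I -> Omega -> 'rV[R]_1), [/\
  time_grid m t, t m = T,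
  (forall i, exists2 x, (x <= m)%N & t x = al i) /\
  (forall i, exists2 x, (x <= m)%N & t x = be i),
  forall i, Lipv (Qh i) /\ LGdist G (Q i) (LGcst (Qh i)) <= e &
  forall k w, \sum_i Qh i w 0 0 *: c i k w =
    \sum_(z < m) dqv t z w *: fam_val al be c (t z) k w].
Proof.
move=> e0; have e2 : 0 < e / 2 by rewrite divr_gt0.
pose L := T :: ([seq al i | i : I] ++ [seq be i | i : I]).
have L0 x : x \in L -> 0 <= x.
  by rewrite inE mem_cat => /or3P[/eqP->//|/mapP[i _ ->]|/mapP[i _ ->]].
have alL i : al i \in L.
  by rewrite inE mem_cat; apply/or3P; constructor 2; apply: map_f; rewrite mem_enum.
have beL i : be i \in L.
  by rewrite inE mem_cat; apply/or3P; constructor 3; apply: map_f; rewrite mem_enum.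
have [h h0 hh] := qv_mesh e2 L0.
have [m0 [t [tg0 h1 mesh0]]] := fine_grid h0 L0.
have [m mm0 tT] := h1 T (mem_head _ _).
(* The fine grid may run past T, so it is cut at the index of T. *)
have tg := grid_prefix tg0 mm0.
have mesh k : (k < m)%N -> t k.+1 - t k < h by move=> km; apply: mesh0; exact: leq_trans mm0.
have LT x : x \in L -> x <= T.
  by rewrite inE mem_cat => /or3P[/eqP->//|/mapP[i _ ->]|/mapP[i _ ->]]; [exact: le_trans (beT i)|].
have h2 x : x \in L -> exists2 i, (i <= m)%N & t i = x.
  move=> xL; have [i im0 ti] := h1 x xL; exists i => //.
  by rewrite -(grid_leE tg0 im0 mm0) ti tT LT.
pose S k (w : Omega) := \sum_(z < k) dqv t z w.
have hS k : Lip (S k) by rewrite /S; apply: Lip_sum => z _ _; exact: Lip_dqv.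
have [fx hfx] : {fx : I -> nat & forall i, (fx i <= m)%N /\ t (fx i) = al i}.
  by apply: (@choice _ _ (fun i x => (x <= m)%N /\ t x = al i)) => i; have [x xm ex] := h2 _ (alL i); exists x.
have [fy hfy] : {fy : I -> nat & forall i, (fy i <= m)%N /\ t (fy i) = be i}.
  by apply: (@choice _ _ (fun i x => (x <= m)%N /\ t x = be i)) => i; have [x xm ex] := h2 _ (beL i); exists x.
have hdist s k : s \in L -> (k <= m)%N -> t k = s ->
    LGdist G (LGcst (fun w => \row__ S k w)) (q s) < e / 2.
  move=> sL km tk; apply: (hh s sL) => //; first exact: (grid_prefix tg km).
  by move=> z zk; apply: mesh; exact: leq_trans km.
have hrow (X : Omega -> R) : Lip X -> Lipv (fun w => \row_(j < 1) X w).
  by move=> hX j; under eq_fun do rewrite mxE.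
exists m, t, (fun i w => \row__ (S (fy i) w - S (fx i) w)); split=> //.
- by split=> i; apply: h2.
- move=> i; have hl : Lipv (fun w => \row_(j < 1) (S (fy i) w - S (fx i) w)).
    by apply: hrow; apply: Lip_sub.
  split=> //; have [xm ex] := hfx i; have [ym ey] := hfy i.
  have qb := LG1_q (be0 i); have qa := LG1_q (al0 i).
  have hSb := LG1_cst G (hrow _ (hS (fy i))); have hSa := LG1_cst G (hrow _ (hS (fx i))).
  rewrite LGdistC; apply: (@le_trans _ _ (LGdist G (LGcst (fun w => \row__ S (fy i) w)) (q (be i)) +
     LGdist G (LGcst (fun w => \row__ S (fx i) w)) (q (al i)))).
    apply: LGnorm_le_add; try exact: LG1_sub.
      by apply: LG1_sub => //; exact: LG1_cst.
    move=> k w; apply: le_trans (enorm_sub _ _); rewrite le_eqVlt; apply/orP; left.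
    by apply/eqP; congr enorm; apply/rowP => j; rewrite !mxE; ring.
  by rewrite (splitr e); apply: lerD; apply: ltW; apply: hdist.
- move=> k w; have tal i : exists2 x, (x <= m)%N & t x = al i by exact: h2.
  have tbe i : exists2 x, (x <= m)%N & t x = be i by exact: h2.
  rewrite (fam_regroup c albe tg tal tbe (f := fun z => S z w)).
    by apply: eq_bigr => z _; congr (_ *: _); rewrite /S big_ord_recr/= addrAC subrr add0r.
  move=> i x y xm ex ym ey; rewrite mxE.
  have [xm' ex'] := hfx i; have [ym' ey'] := hfy i.
  have inj z z' : (z <= m)%N -> (z' <= m)%N -> t z = t z' -> z = z'.
    move=> zm zm' tzz; apply/eqP.
    by rewrite eqn_leq -(grid_leE tg zm zm') -(grid_leE tg zm' zm) tzz lexx.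
  by rewrite (inj (fx i) x)// ?ex'// (inj (fy i) y)// ey'.
Qed.

(* The product of a coefficient with an increment of <B^a,B^b> is only given as
   the limit of products of some representatives, so the error made by passing
   to the representatives used here is a product R e with E[R] bounded and E[e]
   small. Uniform integrability of the limit makes such an error harmless. *)
Lemma LGnorm_int_qv y :
  dominated T (fun s => LGnorm G (fam_val al be c s)) y ->
  LGnorm G (fun k w => \sum_i P i k w) <= qmom G a b * y.
Proof.
move=> hd; pose D : LGseq R d n := fun k w => \sum_i P i k w.
have hD : LG1 G Lip D by apply: LG1_sum.
have [cQ hcQ] := @choice _ _ (fun i (cQ : LGseq R d n * LGseq R d 1) =>
  [/\ LG1 G Lip cQ.1, LG1 G Lip cQ.2, LGeq G cQ.1 (c i), LGeq G cQ.2 (Q i) &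
      (fun k => E (fun w => enorm (cQ.2 k w 0 0 *: cQ.1 k w - P i k w)))
        @ \oo --> 0])
  (fun i => let: conj _ (ex_intro c' (ex_intro Q' h)) := cP i in ex_intro _ (c', Q') h).
pose c' i := (cQ i).1; pose Q' i := (cQ i).2.
have hc' i : LG1 G Lip (c' i) by case: (hcQ i).
have hQ' i : LG1 G Lip (Q' i) by case: (hcQ i).
have vfam := LG1_fam_val be cL.
suff main eta : 0 < eta -> LGnorm G D <= qmom G a b * y + eta * 4.
  apply/ler_addgt0Pr => eta eta0; have := main (eta / 4) (divr_gt0 eta0 _).
  by rewrite mulfVK; [apply|].
move=> eta0.
have [bd [r [bd0 rL r0 rE hr]]] := LG1_ui hD eta0.
pose BR := \sum_i (LGnorm G (Q' i) + LGnorm G (c i)).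
have BR0 : 0 <= BR by apply: sumr_ge0 => i _; apply: addr_ge0; exact: LGnorm_ge0.
(* Threshold for the factor R of the error R e. Where R <= M the error is at most M e; where R > M
   the bound bd + r of |D| is used instead, with bd <= (bd / M) R. As BR bounds E[R] in the limit,
   the latter costs at most eta. *)
pose M := bd * BR / eta + 1.
have M0 : 0 < M.
  have : 0 <= bd * BR / eta by rewrite divr_ge0 ?mulr_ge0// ltW.
  by rewrite /M; lra.
have M1 : bd / M * BR <= eta.
  rewrite mulrAC ler_pdivrMr// /M.
  have -> : eta * (bd * BR / eta + 1) = bd * BR + eta.
    by have eta_neq0 := lt0r_neq0 eta0; field.
  lra.
(* N exceeds the number of terms, so that |I| errors of size e, multiplied by M, stay below M N e =
   eta. *)
pose N : R := #|I|%:R + 1.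
have N0 : 0 < N by rewrite /N; have := ler0n R #|I|; lra.
pose e := eta / (M * N).
have e0 : 0 < e by rewrite divr_gt0// mulr_gt0.
have [m [t [Qh [tg tT [tal tbe] hQh regroup]]]] := qv_discretization e0.
have QhL i : Lipv (Qh i) by case: (hQh i).
pose A k w := enorm (\sum_i Qh i w 0 0 *: c i k w).
pose Z k w := \sum_i enorm (Q' i k w 0 0 *: c' i k w - P i k w).
pose Rr k w := \sum_i (enorm (Q' i k w) + enorm (c i k w)).
pose er k w := \sum_i (enorm (c' i k w - c i k w) + enorm (Q' i k w - Qh i w)).
have lc k i := LG1_Lipv k (cLip i); have lc' k i := LG1_Lipv k (hc' i).
have lQ' k i := LG1_Lipv k (hQ' i); have lP k i := LG1_Lipv k (PLip i).
have lD k := LG1_Lipv k hD.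
have lQ00 k i : Lip (fun w => Q' i k w 0 0) by exact: lQ'.
have lQh00 i : Lip (fun w => Qh i w 0 0) by exact: QhL.
have ldqv z := Lip_dqv t z.
have lv k s := LG1_Lipv k (vfam s).
have lA k : Lip (A k) by rewrite /A; lip.
have lZ k : Lip (Z k) by rewrite /Z; lip.
have lR k : Lip (Rr k) by rewrite /Rr; lip.
have ler k : Lip (er k) by rewrite /er; lip.
have R0 k w : 0 <= Rr k w.
  by apply: sumr_ge0 => i _; apply: addr_ge0; exact: enorm_ge0.
have er0 k w : 0 <= er k w.
  by apply: sumr_ge0 => i _; apply: addr_ge0; exact: enorm_ge0.
have Z0 k w : 0 <= Z k w by apply: sumr_ge0 => i _; exact: enorm_ge0.
have A0 k w : 0 <= A k w by exact: enorm_ge0.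
(* D is split into the discretized integral (A), the gap between P and the products of its
   representatives (Z), and the change of both factors of these products (bounded by R e). *)
have bound k w : enorm (D k w) <= A k w + Z k w + Rr k w * er k w.
  have -> : D k w = \sum_i Qh i w 0 0 *: c i k w -
      \sum_i (Q' i k w 0 0 *: c' i k w - P i k w) +
      \sum_i (Q' i k w 0 0 *: c' i k w - Qh i w 0 0 *: c i k w).
    by rewrite !sumrB opprB [X in X + _]addrC addrACA subrK subrr addr0.
  apply: (le_trans (enorm_add _ _)); apply: lerD.
    apply: (le_trans (enorm_sub _ _)); rewrite lerD2l; exact: enorm_sum.
  apply: (le_trans (enorm_sum _ _ _)).
  rewrite /er mulr_sumr; apply: ler_sum => i _.
  have -> : Q' i k w 0 0 *: c' i k w - Qh i w 0 0 *: c i k w =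
      Q' i k w 0 0 *: (c' i k w - c i k w) + (Q' i k w - Qh i w) 0 0 *: c i k w.
    by rewrite !mxE scalerBr scalerBl addrA subrK.
  apply: (le_trans (enorm_add _ _)); rewrite !enormZ.
  have h1 := enorm_coord (Q' i k w) 0 0; have h2 := enorm_coord (Q' i k w - Qh i w) 0 0.
  have Ri : enorm (Q' i k w) + enorm (c i k w) <= Rr k w.
    rewrite /Rr (bigD1 i)//= lerDl; apply: sumr_ge0 => j _.
    by apply: addr_ge0; exact: enorm_ge0.
  have g1 := enorm_ge0 (c' i k w - c i k w); have g2 := enorm_ge0 (Q' i k w - Qh i w).
  have g3 := enorm_ge0 (Q' i k w); have g4 := enorm_ge0 (c i k w).
  rewrite mulrDr; apply: lerD.
    by apply: ler_wpM2r => //; lra.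
  rewrite mulrC; apply: ler_pM => //; lra.
have EA : ule (fun k => E (A k)) (qmom G a b * y).
  apply: (ule_mono (ler_wpM2l (qmom_ge0 G a b) (fam_dominated cL tg tal tbe tT hd))).
  rewrite mulr_sumr.
  have hu (z : 'I_m) : ule (fun k => qmom G a b * ((t z.+1 - t z) * E (fun w => enorm (fam_val al be c (t z) k w))))
      (qmom G a b * ((t z.+1 - t z) * LGnorm G (fam_val al be c (t z)))).
    apply: ule_scale; first exact: qmom_ge0.
    by apply: ule_scale; [rewrite subr_ge0 (grid_le tg)|exact: ule_LGnorm].
  apply: (ule_le (@ule_sum _ _ (index_enum 'I_m) xpredT _ _ (fun i _ => hu i))) => k.
  apply: (@le_trans _ _ (E (fun w => \sum_(z < m) `|dqv t z w| * enorm (fam_val al be c (t z) k w)))).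
    apply: E_le => //; first by lip.
    move=> w; rewrite /A regroup; apply: (le_trans (enorm_sum _ _ _)).
    by apply: ler_sum => z _; rewrite enormZ.
  apply: (le_trans (E_sum _ _)); first by move=> z _ _; lip.
  apply: ler_sum => z _; rewrite (E_dqv_mul tg)//; first 1 last.
  - by lip.
  - by move=> w; exact: enorm_ge0.
  - by move=> w w'; rewrite (fam_val_concat be cL)//; exact: (grid_ge0 tg (ltnW (ltn_ord z))).
  by rewrite le_eqVlt; apply/orP; left; apply/eqP; ring.
have EZ : ule (fun k => E (Z k)) 0.
  have hz i : ule (fun k => E (fun w => enorm (Q' i k w 0 0 *: c' i k w - P i k w))) 0.
    by apply: ule_cvg0; case: (hcQ i).
  have := @ule_sum _ _ (index_enum I) xpredT _ _ (fun i _ => hz i); rewrite big1// => h.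
  by apply: (ule_le h) => k; apply: E_sum => i _ _; lip.
have ER : ule (fun k => E (Rr k)) BR.
  have hz i : ule (fun k => E (fun w => enorm (Q' i k w)) + E (fun w => enorm (c i k w)))
    (LGnorm G (Q' i) + LGnorm G (c i)) by apply: ule_add; exact: ule_LGnorm.
  apply: (ule_le (@ule_sum _ _ (index_enum I) xpredT _ _ (fun i _ => hz i))) => k.
  apply: (le_trans (E_sum _ _)); first by move=> i _ _; lip.
  by apply: ler_sum => i _; apply: E_add; lip.
have Eer : ule (fun k => E (er k)) (N * e).
  have hz i : ule (fun k => E (fun w => enorm (c' i k w - c i k w)) +
      E (fun w => enorm (Q' i k w - Qh i w))) e.
    have [_ _ ec eQ _] := hcQ i; have [_ dQ] := hQh i.
    have hQhi := LG1_cst G (QhL i).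
    rewrite -[e]add0r -{1}ec; apply: ule_add; first exact: ule_LGdist.
    apply: ule_mono (ule_LGdist (hQ' i) hQhi).
    apply: (le_trans (LGdist_triangle (hQ' i) (QLip i) hQhi)).
    by rewrite (_ : LGdist _ _ _ = 0) ?add0r.
  have := @ule_sum _ _ (index_enum I) xpredT _ _ (fun i _ => hz i).
  rewrite sumr_const => h; apply: (ule_mono (x := e *+ #|I|)).
    by rewrite /N mulrDl mul1r mulr_natl lerDl ltW.
  apply: (ule_le h) => k; apply: (le_trans (E_sum _ _)); first by move=> i _ _; lip.
  by apply: ler_sum => i _; apply: E_add; lip.
apply: LGnorm_ule => //.
have bM0 : 0 <= bd / M by rewrite divr_ge0// ltW.
have := ule_add (ule_add (ule_add EA EZ) rE)
  (ule_add (ule_scale (ltW M0) Eer) (ule_scale bM0 ER)).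
have -> : M * (N * e) = eta.
  by rewrite /e; field; rewrite !lt0r_neq0.
move=> h; have h' := ule_mono (_ : _ <= qmom G a b * y + eta * 4) h.
apply: (ule_le (h' _)); first by lra.
move=> k; have lAk := lA k; have lZk := lZ k; have lrk := rL k.
have lek := ler k; have lRk := lR k.
rewrite -(E_scale G (ltW M0) lek) -(E_scale G bM0 lRk).
apply: (@le_trans _ _ (E (fun w => (A k w + Z k w + r k w) + (M * er k w + bd / M * Rr k w)))).
  apply: E_le; [lip|lip|move=> w].
  have := bound k w; have := hr k w; have := R0 k w; have := er0 k w; have := r0 k w.
  have := A0 k w; have := Z0 k w.
  move: (enorm _) (A k w) (Z k w) (Rr k w) (er k w) (r k w) => D' A' Z' R' e' r' ? ? ? he hR ? ?.
  have [RM|MR] := leP R' M.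
    have := ler_wpM2r he RM; have : 0 <= bd / M * R' by rewrite mulr_ge0.
    lra.
  have : bd <= bd / M * R' by rewrite mulrAC ler_pdivlMr// ler_pM2l// ltW.
  have : 0 <= M * e' by rewrite mulr_ge0// ltW.
  lra.
apply: (le_trans (E_add G _ _)); [lip|lip|apply: lerD].
  by apply: (le_trans (E_add G _ _)); [lip|lip|rewrite lerD2r; apply: E_add; lip].
by apply: E_add; lip.
Qed.

End stochastic_families.

Lemma cvge0_lt (R : realType) (U : Type) (F : set_system U) (u : U -> \bar R) (e : R) :
  Filter F -> u @ F --> 0%E -> 0 < e -> F [set x | (u x < e%:E)%E].
Proof. by move=> FF h e0; apply: (h [set x | (x < e%:E)%E]); apply: open_ereal_lt'; rewrite lte_fin. Qed.

(** * From simple processes to processes in M_G^1 *)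

Section simple_integrals.
Context {R : realType} {d : nat} (G : Gexpectation R d).
Local Notation Omega := (path_space R d).
Local Notation E := (Ehat G).
Variables (T : R) (n : nat).
Hypothesis T0 : 0 <= T.

Lemma LG1_upto_mono s s' (X : LGseq R d n) : s <= s' ->
  LG1 G (Lip_upto s) X -> LG1 G (Lip_upto s') X.
Proof. by move=> ss' [h1 h2]; split=> // k j; exact: Lip_upto_mono (h1 k j). Qed.

Lemma LGnorm_opp (X : LGseq R d n) : LGnorm G (fun k w => - X k w) = LGnorm G X.
Proof.
rewrite /LGnorm; suff -> : (fun k => E (fun w => enorm (- X k w))) =
  (fun k => E (fun w => enorm (X k w))) by [].
by apply/funext => k; congr (Ehat G _); apply/funext => w; rewrite enormN.
Qed.

Lemma LG1_opp s (X : LGseq R d n) : LG1 G (Lip_upto s) X ->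
  LG1 G (Lip_upto s) (fun k w => - X k w).
Proof.
move=> [h1 h2]; split=> [k j|e e0].
  have [m [t [phi [m0 ht hphi eX]]]] := h1 k j; exists m, t, (fun M => - phi M); split=> //.
    have [C [l [C0 hC]]] := hphi; exists C, l; split=> // x y.
    by rewrite -opprD normrN.
  by apply/funext => w; rewrite mxE; have /(congr1 (fun f => - f w)) := eX.
have := h2 e e0; apply: filterS => -[k l] /=.
suff -> : (fun w => enorm (- X k w - - X l w)) = (fun w => enorm (X k w - X l w)) by [].
by apply/funext => w; rewrite -opprD enormN.
Qed.

Lemma is_prod_opp (c : LGseq R d n) Q P : is_prod G c Q P ->
  is_prod G (fun k w => - c k w) Q (fun k w => - P k w).
Proof.
have opp (X : LGseq R d n) : LG1 G Lip X -> LG1 G Lip (fun k w => - X k w).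
  by move=> /(LG1_scale (-1)); congr LG1; apply/funext => k; apply/funext => w; rewrite scaleN1r.
move=> [hP [c' [Q' [hc' hQ' ec eQ h]]]]; split; first exact: opp.
exists (fun k w => - c' k w), Q'; split=> //; first exact: opp.
  rewrite /LGeq; transitivity (LGdist G c' c); last exact: ec.
  rewrite /LGdist -LGnorm_opp; congr LGnorm.
  by apply/funext => k; apply/funext => w; rewrite /LGsub !opprD !opprK.
move: h; suff -> : (fun k => E (fun w => enorm (Q' k w 0 0 *: c' k w - P k w))) =
  (fun k => E (fun w => enorm (Q' k w 0 0 *: - c' k w - - P k w))) by [].
apply/funext => k; congr (Ehat G _); apply/funext => w.
by rewrite scalerN -opprD enormN.
Qed.

Section two_simple_processes.
Variables (S S0 : @simple_process R d n) (t : R).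
Hypothesis hS : is_simple G T S.
Hypothesis hS0 : is_simple G T S0.
Hypothesis t0 : 0 <= t.
Hypothesis tT : t <= T.

(** The difference of the two processes as one family over a disjoint union, with negated
    coefficients for the second; the maxima with t restrict it to [t, T]. *)
Let I : finType := ('I_(sp_size S) + 'I_(sp_size S0))%type.
Let time (i : I) (k : nat) : R :=
  match i with inl j => sp_time S (k + j)%N | inr j => sp_time S0 (k + j)%N end.
Let al i := Num.max t (time i 0).
Let be i := Num.max t (time i 1).
Let c (i : I) : LGseq R d n :=
  match i with inl j => sp_coef S j | inr j => fun k w => - sp_coef S0 j k w end.

Let time_le i : time i 0 <= time i 1 <= T.
Proof.
case: i => j; rewrite /time ?add0n ?add1n.
- by case: hS => tg <- _; rewrite !(grid_le tg)// ltnW.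
- by case: hS0 => tg <- _; rewrite !(grid_le tg)// ltnW.
Qed.

Let al0 i : 0 <= al i.
Proof. by rewrite le_max t0. Qed.

Let albe i : al i <= be i.
Proof. by have /andP[h _] := time_le i; rewrite ge_max !le_max lexx h orbT. Qed.

Let beT i : be i <= T.
Proof. by have /andP[_ h] := time_le i; rewrite ge_max tT. Qed.

Let cL i : LG1 G (Lip_upto (al i)) (c i).
Proof.
apply: (@LG1_upto_mono (time i 0)); first by rewrite le_max lexx orbT.
case: i => j; rewrite /time add0n /c.
- by case: hS => _ _; apply.
- by apply: LG1_opp; case: hS0 => _ _; apply.
Qed.

Lemma LG1_sp_val (U : @simple_process R d n) s : is_simple G T U -> LG1 G Lip (sp_val U s).
Proof.
move=> [_ _ hU]; apply: LG1_sum => k _ _.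
case: (sp_time U k <= s < sp_time U k.+1); last exact: LG1_0.
exact: LG1_upto (hU k (ltn_ord k)).
Qed.

Lemma LG1_sp_int (U : @simple_process R d n) : is_simple G T U -> LG1 G Lip (sp_int U t).
Proof.
move=> [_ _ hU]; apply: LG1_sum => k _ _; apply: LG1_scale.
exact: LG1_upto (hU k (ltn_ord k)).
Qed.

Let valE s : fam_val al be c s =
  if t <= s then LGsub (sp_val S s) (sp_val S0 s) else (fun _ _ => 0).
Proof.
have hi (x y : R) : (Num.max t x <= s < Num.max t y) = (t <= s) && (x <= s < y).
  by rewrite ge_max lt_max; case: (leP t s).
apply/funext => k; apply/funext => w; rewrite /fam_val big_sumType/=.
rewrite /al /be; under eq_bigr do rewrite hi.
under [X in _ + X]eq_bigr do rewrite hi.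
case: (leP t s) => /= ts; last by rewrite !big1// addr0.
rewrite /LGsub /sp_val -sumrN; congr (_ + _); apply: eq_bigr => j _.
by case: ifP; rewrite ?oppr0.
Qed.

Let dominated_val y :
  dominated T (fun s => if t <= s then LGdist G (sp_val S s) (sp_val S0 s) else 0) y ->
  dominated T (fun s => LGnorm G (fam_val al be c s)) y.
Proof.
apply: dominated_le => // s _; rewrite valE; case: ifP => _ //.
apply: LGnorm_ule; first exact: LG1_0.
apply: (ule_le (ule_cst 0)) => k; rewrite -[leRHS](E_cst G).
by apply: E_le; [lip|lip|move=> w; rewrite enorm0].
Qed.

Lemma simple_int_dist y :
  dominated T (fun s => if t <= s then LGdist G (sp_val S s) (sp_val S0 s) else 0) y ->
  LGdist G (sp_int S t) (sp_int S0 t) <= y.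
Proof.
move=> /dominated_val/(LGnorm_int_dt al0 albe beT cL T0).
rewrite /LGdist; suff -> : LGsub (sp_int S t) (sp_int S0 t) =
  (fun k w => \sum_i (be i - al i) *: c i k w) by [].
apply/funext => k; apply/funext => w.
rewrite big_sumType/= /LGsub /sp_int -sumrN; congr (_ + _); apply: eq_bigr => j _.
by rewrite scalerN.
Qed.

Lemma simple_int_qv_dist a b (q : R -> LGseq R d 1) (J J0 : LGseq R d n) y :
  (forall s, 0 <= s -> is_qv G a b s (q s)) ->
  is_sp_int_qv G q S t J -> is_sp_int_qv G q S0 t J0 ->
  dominated T (fun s => if t <= s then LGdist G (sp_val S s) (sp_val S0 s) else 0) y ->
  LGdist G J J0 <= qmom G a b * y.
Proof.
move=> qP [P [hP ->]] [P0 [hP0 ->]] /dominated_val hd.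
pose PP (i : I) : LGseq R d n :=
  match i with inl j => P j | inr j => fun k w => - P0 j k w end.
have cP i : is_prod G (c i) (LGsub (q (be i)) (q (al i))) (PP i).
  by case: i => j; [exact: hP|apply: is_prod_opp; exact: hP0].
have := LGnorm_int_qv qP al0 albe beT cL T0 cP hd.
rewrite /LGdist; suff -> : LGsub (fun m w => \sum_(k < sp_size S) P k m w)
    (fun m w => \sum_(k < sp_size S0) P0 k m w) =
  (fun k w => \sum_i PP i k w) by [].
apply/funext => k; apply/funext => w.
by rewrite big_sumType/= /LGsub -sumrN.
Qed.

End two_simple_processes.

Lemma simple_cvg_dominated (S : nat -> @simple_process R d n) eta e :
  simple_cvg G T S eta -> 0 < e -> \forall m \near \oo,
    dominated T (fun s => LGdist G (sp_val (S m) s) (eta s)) e.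
Proof.
move=> [_ h] e0; apply: (filterS _ (cvge0_lt _ h e0)) => m.
exact: dominated_upper_int.
Qed.

Lemma MG1_LG1 (eta : R -> LGseq R d n) s : MG1 G T eta -> 0 <= s <= T ->
  LG1 G Lip (eta s).
Proof. by move=> [h _] /h/LG1_upto. Qed.

(** A simple process within distance 1 is bounded at every time by the sum of the norms of its
    coefficients. The bound found here makes the infimum taken before Osgood's lemma an infimum over
    a nonempty set. *)
Lemma MG1_dominated (eta : R -> LGseq R d n) : MG1 G T eta ->
  exists y, dominated T (fun s => LGnorm G (eta s)) y.
Proof.
move=> heta; case: (heta) => _ [S hS].
have [m _ /(_ m (leqnn m)) hm] := simple_cvg_dominated hS ltr01.
case: hS => /(_ m) hS _; case: (hS) => _ _ hc.
have lc (k : 'I_(sp_size (S m))) : LG1 G Lip (sp_coef (S m) k).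
  exact: LG1_upto (hc k (ltn_ord k)).
pose B := \sum_(k < sp_size (S m)) LGnorm G (sp_coef (S m) k).
have B0 : 0 <= B by apply: sumr_ge0 => k _; exact: LGnorm_ge0.
exists (1 + (B * T + B)).
apply: dominated_le (lexx _) (dominated_add hm (dominated_cst B0 T0)) => s sT.
have hs := MG1_LG1 heta sT; have hv := LG1_sp_val s hS.
apply: (le_trans (LGnorm_dist hs hv)); rewrite LGdistC addrC lerD2l.
apply: LGnorm_ule => //.
apply: (ule_le (@ule_sum _ _ (index_enum _) xpredT _ _ (fun k _ => ule_LGnorm (lc k)))) => k.
have lck j := LG1_Lipv k (lc j); have lv := LG1_Lipv k hv.
apply: (@le_trans _ _ (E (fun w => \sum_(j < sp_size (S m)) enorm (sp_coef (S m) j k w)))).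
  apply: E_le; [lip|lip|move=> w].
  apply: (le_trans (enorm_sum _ _ _)); apply: ler_sum => j _.
  by case: ifP => // _; rewrite enorm0 enorm_ge0.
by apply: E_sum => j _ _; lip.
Qed.

Section two_processes.
Variables (eta eta0 : R -> LGseq R d n) (t y : R).
Hypothesis heta : forall s, 0 <= s <= T -> LG1 G Lip (eta s).
Hypothesis heta0 : forall s, 0 <= s <= T -> LG1 G Lip (eta0 s).
Hypothesis t0 : 0 <= t.
Hypothesis tT : t <= T.
Hypothesis hd : dominated T (fun s => if t <= s then LGdist G (eta s) (eta0 s) else 0) y.

Let dominated_approx S S0 e : is_simple G T S -> is_simple G T S0 ->
  dominated T (fun s => LGdist G (sp_val S s) (eta s)) e ->
  dominated T (fun s => LGdist G (sp_val S0 s) (eta0 s)) e ->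
  dominated T (fun s => if t <= s then LGdist G (sp_val S s) (sp_val S0 s) else 0) (y + e * 2).
Proof.
move=> hS hS0 h h0.
have e2 : e + e + y <= y + e * 2 by lra.
apply: dominated_le e2 (dominated_add (dominated_add h h0) hd) => s sT.
have hs := heta sT; have hs0 := heta0 sT.
have hv := LG1_sp_val s hS; have hv0 := LG1_sp_val s hS0.
case: ifP => _; last by rewrite addr0 addr_ge0//; exact: LGdist_ge0.
have := LGdist_triangle hv hs hv0; have := LGdist_triangle hs hs0 hv0.
rewrite [LGdist G (eta0 s) _]LGdistC.
move: (LGdist G _ _) (LGdist G _ _) (LGdist G _ _) (LGdist G _ _) (LGdist G _ _) => *; lra.
Qed.

Lemma int_dist I I0 : is_int G T eta t I -> is_int G T eta0 t I0 ->
  LGdist G I I0 <= y.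
Proof.
move=> [/LG1_upto hI [S [hS cI]]] [/LG1_upto hI0 [S0 [hS0 cI0]]].
apply/ler_addgt0Pr => e e0.
(* Budget: twice e / 4 for replacing both processes by simple ones, and e / 4 for each limit of
   integrals. *)
have key (x u v w z : R) : v <= y + e / 4 * 2 -> u <= v + z -> x <= w + u ->
  w < e / 4 -> z < e / 4 -> x <= y + e by lra.
have e4 : 0 < e / 4 by rewrite divr_gt0.
have [m _ hm] := filterI (filterI (simple_cvg_dominated hS e4) (cvgr_lt _ cI _ e4))
  (filterI (simple_cvg_dominated hS0 e4) (cvgr_lt _ cI0 _ e4)).
have [[h1 h2] [h3 h4]] := hm m (leqnn m).
have sm := hS.1 m; have sm0 := hS0.1 m.
have i1 := LG1_sp_int t sm; have i2 := LG1_sp_int t sm0.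
have h5 := simple_int_dist sm sm0 t0 tT (dominated_approx sm sm0 h1 h3).
have h6 := LGdist_triangle i1 i2 hI0; have h7 := LGdist_triangle hI i1 hI0.
rewrite (LGdistC G I (sp_int (S m) t)) in h7.
exact: key h5 h6 h7 h2 h4.
Qed.

Lemma int_qv_dist a b (q : R -> LGseq R d 1) J J0 :
  (forall s, 0 <= s -> is_qv G a b s (q s)) ->
  is_int_qv G q T eta t J -> is_int_qv G q T eta0 t J0 ->
  LGdist G J J0 <= qmom G a b * y.
Proof.
move=> qP [/LG1_upto hJ [S [K [hS hK cJ]]]] [/LG1_upto hJ0 [S0 [K0 [hS0 hK0 cJ0]]]].
have a0 := qmom_ge0 G a b.
(* The approximation errors add up to [2 * qmom G a b * e' + 2 * e'], which is e. *)
apply/ler_addgt0Pr => e e0; pose e' := e / (2 * qmom G a b + 2).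
have e'0 : 0 < e' by rewrite divr_gt0//; lra.
have ee : e' * (2 * qmom G a b + 2) = e.
  by rewrite /e' mulfVK// lt0r_neq0//; lra.
have key (x u v w z : R) : v <= qmom G a b * (y + e' * 2) -> u <= v + z -> x <= w + u ->
    w < e' -> z < e' -> x <= qmom G a b * y + e by rewrite -ee; lra.
have [m _ hm] := filterI (filterI (simple_cvg_dominated hS e'0) (cvgr_lt _ cJ _ e'0))
  (filterI (simple_cvg_dominated hS0 e'0) (cvgr_lt _ cJ0 _ e'0)).
have [[h1 h2] [h3 h4]] := hm m (leqnn m).
have sm := hS.1 m; have sm0 := hS0.1 m.
have LGK (U : @simple_process R d n) p : is_sp_int_qv G q U t p -> LG1 G Lip p.
  by move=> [P [hP ->]]; apply: LG1_sum => k _ _; have [] := hP k (ltn_ord k).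
have i1 := LGK _ _ (hK m); have i2 := LGK _ _ (hK0 m).
have h5 := simple_int_qv_dist sm sm0 t0 tT qP (hK m) (hK0 m) (dominated_approx sm sm0 h1 h3).
have h6 := LGdist_triangle i1 i2 hJ0; have h7 := LGdist_triangle hJ i1 hJ0.
rewrite (LGdistC G J (K m)) in h7.
exact: key h5 h6 h7 h2 h4.
Qed.

End two_processes.
End simple_integrals.

(** * Substitution of a random vector *)

Section hats.
Context {R : realType}.

(** The closed form records how the sum falls off to the right of J, which the induction on J needs;
    it is applied for z <= J, where its value is 1. *)
Lemma hat_partition1 (J : nat) (z : R) : 0 <= z ->
  \sum_(j < J.+1) Num.max 0 (1 - `|z - j%:R|) = Num.min 1 (Num.max 0 (J%:R + 1 - z)).
Proof.
move=> z0; elim: J => [|J IH].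
  rewrite big_ord1 subr0 ger0_norm// add0r; apply/esym/min_idPr.
  by rewrite ge_max ler01/= lerBlDr lerDl.
rewrite big_ord_recr/= IH -natr1 distrC.
have -> : J%:R + 1 + 1 - z = J%:R + 1 - z + 1 by ring.
set u : R := J%:R + 1 - z; have [u0|u0] := leP 0 u.
  have u1 : 0 <= u + 1 by lra.
  have m1 : Num.min 1 (u + 1) = 1 by apply: min_l; lra.
  rewrite ger0_norm// (max_r u1) m1.
  have [u2|/ltW u2] := leP u 1.
    by rewrite max_r ?subr_ge0//; ring.
  by rewrite max_l ?subr_le0// addr0.
rewrite ltr0_norm// opprK (min_r ler01) add0r [1 + u]addrC.
by rewrite min_r// ge_max ler01/=; lra.
Qed.

Lemma prod_dist (I : Type) (r : seq I) (x y : I -> R) :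
  (forall i, 0 <= x i <= 1) -> (forall i, 0 <= y i <= 1) ->
  `|\prod_(i <- r) x i - \prod_(i <- r) y i| <= \sum_(i <- r) `|x i - y i|.
Proof.
move=> hx hy; elim: r => [|i r IH]; first by rewrite !big_nil subrr normr0.
rewrite !big_cons; set A := \prod_(j <- r) x j; set B := \prod_(j <- r) y j.
have B01 : 0 <= B <= 1.
  apply/andP; split; first by apply: prodr_ge0 => j _; case/andP: (hy j).
  by apply: prodr_ile1 => j _; exact: hy.
have -> : x i * A - y i * B = x i * (A - B) + (x i - y i) * B by ring.
apply: (le_trans (ler_normD _ _)); rewrite addrC !normrM; apply: lerD.
  by rewrite ler_piMr// ger0_norm; case/andP: B01.
apply: le_trans IH; rewrite ler_piMl// ger0_norm; by case/andP: (hx i).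
Qed.

Variables (n N : nat).
Implicit Types (a y : 'rV[R]_n).

Let hat1 a y i : R := Num.max 0 (1 - N.+1%:R * `|y 0 i - a 0 i|).

Let hat1_01 a y i : 0 <= hat1 a y i <= 1.
Proof.
by rewrite /hat1 le_max lexx ge_max ler01/= lerBlDr lerDl mulr_ge0.
Qed.

Lemma hat_01 a y : 0 <= hat N a y <= 1.
Proof.
apply/andP; split; first by apply: prodr_ge0 => i _; case/andP: (hat1_01 a y i).
by apply: prodr_ile1 => i _; exact: hat1_01.
Qed.

Lemma hat_dist a y y' : `|hat N a y - hat N a y'| <= (n * N.+1)%:R * enorm (y - y').
Proof.
apply: (le_trans (prod_dist _ (hat1_01 a y) (hat1_01 a y'))).
rewrite natrM -mulrA mulr_natl -[X in _ *+ X]card_ord -sumr_const; apply: ler_sum => i _.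
have hm (u v : R) : `|Num.max 0 u - Num.max 0 v| <= `|u - v|.
  have h1 := ler_norm (u - v); have h2 := ler_norm (v - u); rewrite distrC in h2.
  by rewrite ler_norml; case: (leP 0 u) => ?; case: (leP 0 v) => ?; lra.
apply: (le_trans (hm _ _)).
have -> : 1 - N.+1%:R * `|y 0 i - a 0 i| - (1 - N.+1%:R * `|y' 0 i - a 0 i|) =
  N.+1%:R * (`|y' 0 i - a 0 i| - `|y 0 i - a 0 i|) by ring.
rewrite normrM ger0_norm// ler_wpM2l//; apply: (le_trans (ler_dist_dist _ _)).
rewrite opprB addrA subrK distrC; have := enorm_coord (y - y') 0 i.
by rewrite !mxE.
Qed.

Lemma hat_support a y : hat N a y != 0 -> enorm (y - a) <= n%:R / N.+1%:R.
Proof.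
move=> /prodf_neq0 h; apply: (le_trans (enorm_le_sum _)); rewrite big_ord1.
rewrite mulr_natl -[X in _ *+ X]card_ord -sumr_const; apply: ler_sum => i _.
have := h i isT; rewrite !mxE -/(hat1 a y i); apply: contraNle => hi.
rewrite /hat1; apply/eqP/max_idPl; rewrite subr_le0.
by rewrite -ler_pdivrMl// mulr1 ltW.
Qed.

(** Distributing the product over the coordinates reduces to dimension one. There z = (N + 1)(y_i +
    N + 1) moves the nodes to the integers from 0 to 2 (N + 1)^2, and the condition on y keeps z
    between these ends. *)
Lemma hat_partition y : (forall i, `|y 0 i| <= N.+1%:R) ->
  \sum_(a : {ffun 'I_n -> 'I_(2 * N.+1 ^ 2).+1}) hat N (grid_pt a) y = 1.
Proof.
move=> hy.
pose F (i : 'I_n) (j : 'I_(2 * N.+1 ^ 2).+1) : R :=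
  Num.max 0 (1 - N.+1%:R * `|y 0 i - (j%:R / N.+1%:R - N.+1%:R)|).
transitivity (\sum_(a : {ffun 'I_n -> 'I_(2 * N.+1 ^ 2).+1}) \prod_i F i (a i)).
  by apply: eq_bigr => a _; apply: eq_bigr => i _; rewrite /F mxE.
rewrite -bigA_distr_bigA big1// => i _.
have N0 : (0 : R) < N.+1%:R by [].
pose z := N.+1%:R * (y 0 i + N.+1%:R).
have /andP[y1 y2] : - N.+1%:R <= y 0 i <= N.+1%:R by rewrite -ler_norml.
have z0 : 0 <= z by rewrite mulr_ge0//; lra.
transitivity (\sum_(j < (2 * N.+1 ^ 2).+1) Num.max 0 (1 - `|z - j%:R|)).
  apply: eq_bigr => j _; rewrite /F; congr (Num.max _ (_ - _)).
  rewrite -{1}[N.+1%:R]ger0_norm// -normrM; congr `|_|; rewrite /z.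
  by field; rewrite lt0r_neq0.
rewrite hat_partition1//; apply/min_idPl; rewrite le_max; apply/orP; right.
suff : z <= (2 * N.+1 ^ 2)%:R by lra.
rewrite natrM natrX /z expr2 mulrCA ler_pM2l//; lra.
Qed.

End hats.

(** * Interpolants and the modulus of continuity after substitution *)

Section substitution.
Context {R : realType} {d : nat} (G : Gexpectation R d).
Local Notation Omega := (path_space R d).
Local Notation E := (Ehat G).
Variables (n p : nat).
Local Notation idx N := {ffun 'I_n -> 'I_(2 * N.+1 ^ 2).+1}.

Lemma Lip_hat N (a : 'rV[R]_n) (Y : Omega -> 'rV[R]_n) : Lipv Y ->
  Lip (fun w => hat N a (Y w)).
Proof.
move=> hY; have hd : Lip (fun w => \sum_(i < n) `|Y w 0 i|).
  by apply: Lip_sum => i _ _; apply: Lip_abs; exact: hY.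
rewrite /hat; apply: Lip_prod => i _ _; have hYi := hY i; lip.
Qed.

(** The increment of the hat is at most 1 and at most a multiple of |Y_k - Y_l|. With |F_l| <= b +
    r_l from uniform integrability, the first bound serves for r_l and the second for b. *)
Lemma LG1_hat N (a : 'rV[R]_n) (Y : LGseq R d n) (F : LGseq R d p) :
  LG1 G Lip Y -> LG1 G Lip F -> LG1 G Lip (fun k w => hat N a (Y k w) *: F k w).
Proof.
move=> hY hF; have [lY cY] := (LG1P G Y).1 hY; have [lF cF] := (LG1P G F).1 hF.
have lh k := Lip_hat N a (lY k).
apply/LG1P; split=> [k|e e0].
  by have ? := lF k; apply: (@Lipv_scale _ _ _ (fun w => hat N a (Y k w))).
have e4 : 0 < e / 4 by rewrite divr_gt0.
have [b [r [b0 rL r0 rE hr]]] := LG1_ui hF e4.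
pose c := b * (n * N.+1)%:R + 1.
have bc0 : 0 <= b * (n * N.+1)%:R by rewrite mulr_ge0// ltW.
have c0 : 0 < c by rewrite /c; lra.
have [N1 h1] := cF _ e4; have [N2 h2] := cY _ (divr_gt0 e4 c0).
have [N3 h3] := rE _ e4; exists (maxn N1 (maxn N2 N3)) => k l.
rewrite !geq_max => /and3P[k1 k2 _] /and3P[l1 l2 l3].
have lYk := lY k; have lYl := lY l; have lFk := lF k; have lFl := lF l.
have lrl := rL l; have lhk := lh k; have lhl := lh l.
have h4 := h1 k l k1 l1; have h5 := h2 k l k2 l2; have h6 := h3 l l3.
have h7 : E (fun w => enorm (hat N a (Y k w) *: F k w - hat N a (Y l w) *: F l w)) <=
    E (fun w => enorm (F k w - F l w)) + E (fun w => c * enorm (Y k w - Y l w)) + E (r l).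
  apply: E_leD3; [|lip|lip|lip|move=> w].
    apply: Lip_enorm; apply: Lipv_sub.
      exact: (@Lipv_scale _ _ _ (fun w => hat N a (Y k w))).
    exact: (@Lipv_scale _ _ _ (fun w => hat N a (Y l w))).
  have -> : hat N a (Y k w) *: F k w - hat N a (Y l w) *: F l w =
    hat N a (Y k w) *: (F k w - F l w) + (hat N a (Y k w) - hat N a (Y l w)) *: F l w.
    by rewrite scalerBr scalerBl addrA subrK.
  apply: (le_trans (enorm_add _ _)); rewrite !enormZ.
  have /andP[hk0 hk1] := hat_01 N a (Y k w); have /andP[hl0 hl1] := hat_01 N a (Y l w).
  have hd := hat_dist N a (Y k w) (Y l w).
  have d1 : `|hat N a (Y k w) - hat N a (Y l w)| <= 1.
    by rewrite ler_norml; apply/andP; split; lra.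
  rewrite -addrA; apply: lerD; first by rewrite ger0_norm// ler_piMl// enorm_ge0.
  have hrw := hr l w; have rw0 := r0 l w; have D0 := normr_ge0 (hat N a (Y k w) - hat N a (Y l w)).
  have y0 := enorm_ge0 (Y k w - Y l w).
  apply: (le_trans (ler_wpM2l D0 hrw)); rewrite mulrDr; apply: lerD; last by rewrite ler_piMl.
  rewrite /c mulrDl mul1r -[leLHS]addr0; apply: lerD => //.
  by rewrite mulrC -mulrA ler_wpM2l// ltW.
rewrite E_scale// in h7; [|exact: ltW|by lip].
have h8 : c * E (fun w => enorm (Y k w - Y l w)) <= e / 4.
  by rewrite -ler_pdivlMl// mulrC.
by apply: (le_trans h7); lra.
Qed.

Lemma LG1_interp N (F : 'rV[R]_n -> LGseq R d p) (Y : LGseq R d n) :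
  (forall y, LG1 G Lip (F y)) -> LG1 G Lip Y -> LG1 G Lip (interp N F Y).
Proof. by move=> hF hY; apply: LG1_sum => a _ _; exact: LG1_hat. Qed.

Lemma is_eval_unique (F : 'rV[R]_n -> LGseq R d p) (Y : LGseq R d n) (Z Z' : LGseq R d p) :
  (forall y, LG1 G Lip (F y)) -> LG1 G Lip Y ->
  is_eval G F Y Z -> is_eval G F Y Z' -> LGdist G Z Z' = 0.
Proof.
move=> hF hY [hZ cZ] [hZ' cZ']; apply/eqP; rewrite eq_le LGdist_ge0// andbT.
rewrite -[leRHS]addr0; apply: ule_cst_le.
apply: (ule_le (ule_add (ule_cvg0 cZ) (ule_cvg0 cZ'))) => N.
have hI := LG1_interp N hF hY.
by apply: (le_trans (LGdist_triangle hZ hI hZ')); rewrite LGdistC.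
Qed.

(* Both interpolants are averages of the values of F at grid points, so their
   difference is an average of differences at pairs of points that are close
   to (y, y'). *)
Lemma interp_dist N (F : 'rV[R]_n -> 'rV[R]_p) (y y' : 'rV[R]_n) (c : R)
    (err : idx N -> idx N -> R) :
  (forall i, `|y 0 i| <= N.+1%:R) -> (forall i, `|y' 0 i| <= N.+1%:R) ->
  0 <= c -> (forall a b, 0 <= err a b) ->
  (forall a b : idx N, enorm (grid_pt a - grid_pt b) <= enorm (y - y') + 2 * (n%:R / N.+1%:R) ->
     enorm (F (grid_pt a) - F (grid_pt b)) <= c + err a b) ->
  enorm (\sum_(a : idx N) hat N (grid_pt a) y *: F (grid_pt a) -
         \sum_(b : idx N) hat N (grid_pt b) y' *: F (grid_pt b)) <= c + \sum_a \sum_b err a b.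
Proof.
move=> yN y'N c0 err0 hF.
pose h (a : idx N) := hat N (grid_pt a) y; pose h' (a : idx N) := hat N (grid_pt a) y'.
have h1 : \sum_a h a = 1 by exact: hat_partition.
have h'1 : \sum_a h' a = 1 by exact: hat_partition.
have h01 a : 0 <= h a <= 1 by exact: hat_01.
have h'01 a : 0 <= h' a <= 1 by exact: hat_01.
have -> : \sum_a h a *: F (grid_pt a) - \sum_b h' b *: F (grid_pt b) =
    \sum_a \sum_b (h a * h' b) *: (F (grid_pt a) - F (grid_pt b)).
  transitivity (\sum_a \sum_b (h a * h' b) *: F (grid_pt a) -
                \sum_a \sum_b (h a * h' b) *: F (grid_pt b)).
    congr (_ - _).
      by apply: eq_bigr => a _; rewrite -scaler_suml -mulr_sumr h'1 mulr1.
    rewrite exchange_big/=; apply: eq_bigr => b _.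
    by rewrite -scaler_suml -mulr_suml h1 mul1r.
  rewrite -sumrB; apply: eq_bigr => a _; rewrite -sumrB; apply: eq_bigr => b _.
  by rewrite scalerBr.
have -> : c = \sum_a \sum_b (h a * h' b) * c.
  under eq_bigr do rewrite -mulr_suml -mulr_sumr h'1 mulr1.
  by rewrite -mulr_suml h1 mul1r.
rewrite -big_split/=; apply: (le_trans (enorm_sum _ _ _)); apply: ler_sum => a _.
rewrite -big_split/=; apply: (le_trans (enorm_sum _ _ _)); apply: ler_sum => b _.
have /andP[ha0 ha1] := h01 a; have /andP[hb0 hb1] := h'01 b.
have e0 := err0 a b.
rewrite enormZ ger0_norm ?mulr_ge0//.
have [ha|ha] := eqVneq (h a) 0; first by rewrite ha !mul0r add0r.
have [hb|hb] := eqVneq (h' b) 0; first by rewrite hb mulr0 !mul0r add0r.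
have close : enorm (grid_pt a - grid_pt b) <= enorm (y - y') + 2 * (n%:R / N.+1%:R).
  have := hat_support ha; have := hat_support hb.
  have := enorm_triangle y (grid_pt a) (grid_pt b).
  have := enorm_triangle y' y (grid_pt b); rewrite (enorm_distC (grid_pt a) y).
  move: (n%:R / N.+1%:R) => ?; lra.
apply: (le_trans (ler_wpM2l (mulr_ge0 ha0 hb0) (hF a b close))).
rewrite mulrDr lerD2l ler_piMl// mulr_ile1//.
Qed.

(** The modulus holds in L_G^1 for each fixed pair of points, not for all pairs at once. A fixed
    grid has finitely many pairs, so the positive parts [err] disappear in the limit of the
    representatives. The affine majorant of rho requires only E|Y - Y'| <= x0, which gives r0 (1 +
    1). *)
Lemma eval_modulus (F : 'rV[R]_n -> LGseq R d p) (Y Y' : LGseq R d n)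
    (Z Z' : LGseq R d p) (rho : R -> R) (r0 x0 : R) :
  (forall y, LG1 G Lip (F y)) -> LG1 G Lip Y -> LG1 G Lip Y' ->
  is_eval G F Y Z -> is_eval G F Y' Z' ->
  (forall y1 y2, LGle G (fun k w => enorm (F y1 k w - F y2 k w))
                        (fun _ _ => rho (enorm (y1 - y2)))) ->
  0 <= r0 -> 0 < x0 -> (forall x, 0 <= x -> rho x <= r0 * (1 + x / x0)) ->
  LGdist G Y Y' <= x0 -> LGdist G Z Z' <= 2 * r0.
Proof.
move=> hF hY hY' [hZ cZ] [hZ' cZ'] hmod r00 x00 hrho hYY.
have hD := LG1_sub hZ hZ'.
(* Five errors of size eta: the two interpolations, the mesh, the remainder r of uniform
   integrability and the exterior of the box. *)
apply/ler_addgt0Pr => e e0; pose eta := e / 5.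
have eta0 : 0 < eta by rewrite divr_gt0.
have e5 : e = eta * 5 by rewrite /eta mulfVK.
have [b [r [b0 rL rge0 rE hr]]] := LG1_ui hD eta0.
pose SY := LGnorm G Y + LGnorm G Y'.
have SY0 : 0 <= SY by apply: addr_ge0; exact: LGnorm_ge0.
(* The coefficient of the mesh 1 / (N + 1) in the affine majorant: the grid points in play are at
   most 2 n / (N + 1) farther apart than y and y'. *)
pose c1 : R := r0 / x0 * (2 * n%:R).
have c10 : 0 <= c1 by rewrite /c1 !mulr_ge0// invr_ge0 ltW.
have [N [hN1 hN2 hN3 hN4]] : exists N, [/\ LGdist G (interp N F Y) Z <= eta,
    LGdist G (interp N F Y') Z' <= eta, c1 / N.+1%:R <= eta & b / N.+1%:R * SY <= eta].
  have [N1 h1] := ule_cvg0 cZ eta0; have [N2 h2] := ule_cvg0 cZ' eta0.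
  have big x : 0 <= x -> forall N, (Num.bound (x / eta) <= N)%N -> x / N.+1%:R <= eta.
    move=> x0' N hN; have N0 : (0 : R) < N.+1%:R by [].
    rewrite ler_pdivrMr// mulrC -ler_pdivrMr//.
    have := archi_boundP (divr_ge0 x0' (ltW eta0)) => /ltW/le_trans; apply.
    by rewrite ler_nat ltnW.
  exists (maxn (maxn N1 N2) (maxn (Num.bound (c1 / eta)) (Num.bound (b * SY / eta)))); split.
  - by have := h1 (maxn (maxn N1 N2) (maxn (Num.bound (c1 / eta)) (Num.bound (b * SY / eta)))); rewrite add0r; apply; rewrite !leq_max leqnn.
  - by have := h2 (maxn (maxn N1 N2) (maxn (Num.bound (c1 / eta)) (Num.bound (b * SY / eta)))); rewrite add0r; apply; rewrite !leq_max leqnn orbT.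
  - by apply: big => //; rewrite !leq_max leqnn !orbT.
  - rewrite mulrAC; apply: big; first by rewrite mulr_ge0// ltW.
    by rewrite !leq_max leqnn !orbT.
have hI := LG1_interp N hF hY; have hI' := LG1_interp N hF hY'.
pose err k (a b' : idx N) w : R := Num.max 0 (enorm (F (grid_pt a) k w - F (grid_pt b') k w) -
   rho (enorm (grid_pt a - grid_pt b'))).
pose cc k w : R := r0 * (1 + (enorm (Y k w - Y' k w) + 2 * (n%:R / N.+1%:R)) / x0).
have lZ k := LG1_Lipv k hZ; have lZ' k := LG1_Lipv k hZ'.
have lI k := LG1_Lipv k hI; have lI' k := LG1_Lipv k hI'.
have lY k := LG1_Lipv k hY; have lY' k := LG1_Lipv k hY'.
have lF k y := LG1_Lipv k (hF y).
have lerr k a b' : Lip (err k a b') by rewrite /err; lip.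
have lcc k : Lip (cc k) by rewrite /cc; lip.
have N0 : (0 : R) < N.+1%:R by [].
have cc0 k w : 0 <= cc k w.
  rewrite /cc; apply: mulr_ge0 => //; apply: addr_ge0 => //.
  apply: divr_ge0; last exact: ltW.
  by apply: addr_ge0; [exact: enorm_ge0|rewrite mulr_ge0// divr_ge0].
have err0 k a b' w : 0 <= err k a b' w by rewrite le_max lexx.
pose bN := b / N.+1%:R.
have bN0 : 0 <= bN by rewrite divr_ge0// ltW.
pose S k w := enorm (Z k w - interp N F Y k w) + enorm (Z' k w - interp N F Y' k w) +
  (cc k w + \sum_a \sum_b' err k a b' w) +
  (r k w + bN * (enorm (Y k w) + enorm (Y' k w))).
have bound k w : enorm (Z k w - Z' k w) <= S k w.
  have z1 := enorm_ge0 (Z k w - interp N F Y k w).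
  have z2 := enorm_ge0 (Z' k w - interp N F Y' k w).
  have s0 : 0 <= \sum_a \sum_b' err k a b' w.
    by apply: sumr_ge0 => a _; apply: sumr_ge0.
  have y0 : 0 <= bN * (enorm (Y k w) + enorm (Y' k w)).
    by rewrite mulr_ge0// addr_ge0// enorm_ge0.
  have := cc0 k w; have := rge0 k w => r1 c1'.
  (* Outside the box the hats need not add up to 1. There |Z - Z'| <= b + r, and b is bounded as in
     Markov's inequality by a small multiple of |Y| + |Y'|. *)
  have [inside|outside] := leP (enorm (Y k w) + enorm (Y' k w)) N.+1%:R; last first.
    have h1 : b <= bN * (enorm (Y k w) + enorm (Y' k w)).
      by rewrite /bN mulrAC ler_pdivlMr// ler_pM2l// ltW.
    have := hr k w; rewrite /LGsub /S; move: h1 s0 z1 z2 c1' r1.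
    move: (\sum_a _) (cc k w) (enorm (Z k w - Z' k w)) (enorm (Z k w - _)) (enorm (Z' k w - _)) => *; lra.
  have yN i : `|Y k w 0 i| <= N.+1%:R.
    by have := enorm_coord (Y k w) 0 i; have := enorm_ge0 (Y' k w); lra.
  have y'N i : `|Y' k w 0 i| <= N.+1%:R.
    by have := enorm_coord (Y' k w) 0 i; have := enorm_ge0 (Y k w); lra.
  have hII : enorm (interp N F Y k w - interp N F Y' k w) <= cc k w + \sum_a \sum_b' err k a b' w.
    apply: (@interp_dist N (fun y => F y k w)) => // a b' close.
    apply: (@le_trans _ _ (rho (enorm (grid_pt a - grid_pt b')) + err k a b' w)).
      have : enorm (F (grid_pt a) k w - F (grid_pt b') k w) - rho (enorm (grid_pt a - grid_pt b'))
        <= err k a b' w by rewrite le_max lexx orbT.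
      lra.
    rewrite lerD2r; apply: (le_trans (hrho _ (enorm_ge0 _))).
    by rewrite /cc ler_wpM2l// lerD2l ler_wpM2r// invr_ge0 ltW.
  have t1 := enorm_triangle (interp N F Y k w) (Z k w) (Z' k w).
  have t2 := enorm_triangle (interp N F Y' k w) (interp N F Y k w) (Z' k w).
  rewrite (enorm_distC (interp N F Y' k w) (Z' k w)) in t2.
  move: t1 t2 hII z1 z2 s0 y0 r1 c1'; rewrite /S.
  move: (\sum_a _) (cc k w) (enorm (_ - _)) (enorm (_ - _)) (enorm (_ - _)) (enorm (_ - _)) (enorm (_ - _)) => *; lra.
apply: LGdist_ule => //.
have hE1 := ule_mono hN1 (ule_LGdist hI hZ).
have hE2 := ule_mono hN2 (ule_LGdist hI' hZ').
have hEY := ule_mono hYY (ule_LGdist hY hY').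
have hEcc : ule (fun k => E (cc k)) (2 * r0 + eta).
  have a0 : 0 <= r0 / x0 by rewrite divr_ge0// ltW.
  have e1 : r0 + c1 / N.+1%:R + r0 / x0 * x0 <= 2 * r0 + eta.
    rewrite mulfVK; last exact: lt0r_neq0.
    by move: (c1 / _) hN3 => c2 ?; lra.
  apply: (ule_mono e1); apply: (ule_le (ule_add (ule_cst (r0 + c1 / N.+1%:R)) (ule_scale a0 hEY))) => k.
  have ? := lY k; have ? := lY' k.
  have -> : cc k = (fun w => (r0 + c1 / N.+1%:R) + r0 / x0 * enorm (Y k w - Y' k w)).
    by apply/funext => w; rewrite /cc /c1; field; rewrite !lt0r_neq0.
  apply: (le_trans (E_add G _ _)); [lip|lip|].
  by rewrite E_cst lerD2l E_scale//; lip.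
have hEerr : ule (fun k => E (fun w => \sum_a \sum_b' err k a b' w)) 0.
  have h a b' : ule (fun k => E (err k a b')) 0.
    by apply: ule_cvg0; exact: (hmod (grid_pt a) (grid_pt b')).
  have := @ule_sum _ _ (index_enum _) xpredT _ _ (fun a _ =>
    @ule_sum _ _ (index_enum _) xpredT _ _ (fun b' _ => h a b')).
  rewrite big1 => [h'|a _]; last by rewrite big1.
  apply: (ule_le h') => k; apply: (le_trans (E_sum _ _)).
    by move=> a _ _; apply: Lip_sum => b' _ _; exact: lerr.
  by apply: ler_sum => a _; apply: E_sum => b' _ _; exact: lerr.
have hEYY : ule (fun k => bN * (E (fun w => enorm (Y k w)) + E (fun w => enorm (Y' k w)))) eta.
  apply: (ule_mono hN4); apply: ule_scale => //.
  by apply: ule_add; exact: ule_LGnorm.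
have := ule_add (ule_add (ule_add hE1 hE2) (ule_add hEcc hEerr)) (ule_add rE hEYY).
have -> : eta + eta + (2 * r0 + eta + 0) + (eta + eta) = 2 * r0 + e by rewrite e5; ring.
move=> h; apply: (ule_le h) => k {h}.
have lZk := lZ k; have lZk' := lZ' k; have lIk := lI k; have lIk' := lI' k.
have lYk := lY k; have lYk' := lY' k; have lcck := lcc k; have lrk := rL k.
have lek : Lip (fun w => \sum_a \sum_b' err k a b' w).
  by apply: Lip_sum => a _ _; apply: Lip_sum => b' _ _; exact: lerr.
apply: (@le_trans _ _ (E (S k))); first by apply: E_le => //; rewrite ?/S; lip.
have eI (X V : Omega -> 'rV[R]_p) : (fun w => enorm (X w - V w)) = (fun w => enorm (V w - X w)).
  by apply/funext => w; exact: enorm_distC.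
rewrite /S (eI (interp N F Y k)) (eI (interp N F Y' k)).
apply: (le_trans (E_add G _ _)); [lip|lip|apply: lerD].
  apply: (le_trans (E_add G _ _)); [lip|lip|apply: lerD]; by apply: E_add; lip.
apply: (le_trans (E_add G _ _)); [lip|lip|rewrite lerD2l E_scale//; last by lip].
by rewrite ler_wpM2l//; apply: E_add; lip.
Qed.

End substitution.

(** * Osgood's lemma *)

Lemma clamp_increment (R : realType) (T x y : R) : 0 <= T -> x <= y ->
  0 <= Num.max 0 (Num.min T y) - Num.max 0 (Num.min T x) <= y - x.
Proof.
rewrite /Num.min /Num.max => T0 xy.
by case: (ltP T x) => ?; case: (ltP T y) => ?; do ![case: ltP => ?]; lra.
Qed.

Section osgood.
Context {R : realType} (rho : R -> R).
Hypothesis rho0 : rho 0 = 0.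
Hypothesis rho_gt0 : forall r, 0 < r -> 0 < rho r.
Hypothesis rho_cont : forall r, 0 < r -> {for r, continuous rho}.
Hypothesis rho_incr : forall r s, 0 < r -> r <= s -> rho r <= rho s.
Hypothesis rho_concave : forall r s l, 0 < r -> 0 < s -> 0 <= l <= 1 ->
    l * rho r + (1 - l) * rho s <= rho (l * r + (1 - l) * s).
Hypothesis rho_int : (\int[@lebesgue_measure R]_(r in `]0%R, 1%R]) ((rho r)^-1)%:E
              = +oo)%E.

(** Monotonicity suffices for x <= x0; beyond x0, concavity and positivity give rho x / x <= rho x0
    / x0. Concavity is assumed on positive arguments, so the chord starts at a small r > 0 that then
    tends to 0. *)
Lemma concave_le_affine x0 x : 0 < x0 -> 0 <= x -> rho x <= rho x0 * (1 + x / x0).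
Proof.
move=> x00 x_ge0; have r0 := rho_gt0 x00.
have xx0 : 0 <= x / x0 by rewrite divr_ge0// ltW.
have [xx|x0x] := leP x x0.
  apply: (@le_trans _ _ (rho x0)).
2: by have := mulr_ge0 (ltW r0) xx0; rewrite mulrDr mulr1; lra.
  move: x_ge0; rewrite le_eqVlt => /orP[/eqP<-|x1]; first by rewrite rho0 ltW.
  exact: rho_incr.
suff h : rho x * x0 <= rho x0 * x.
  have : rho x <= rho x0 * (x / x0) by rewrite mulrA ler_pdivlMr.
  lra.
have x1 := lt_trans x00 x0x; have rx := rho_gt0 x1.
have key r : 0 < r -> r < x0 -> rho x * (x0 - r) <= rho x0 * (x - r).
  move=> r1 rx0; have xr : 0 < x - r by lra.
  pose l := (x - x0) / (x - r).
  have l01 : 0 <= l <= 1.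
    rewrite divr_ge0/=; [|lra|lra].
    by rewrite ler_pdivrMr// mul1r; lra.
  have lE : 1 - l = (x0 - r) / (x - r) by rewrite /l; field; rewrite lt0r_neq0.
  have := rho_concave r1 x1 l01.
  have -> : l * r + (1 - l) * x = x0 by rewrite lE /l; field; rewrite lt0r_neq0.
  rewrite lE => h; have {}h : (x0 - r) / (x - r) * rho x <= rho x0.
    apply: le_trans h; rewrite lerDr mulr_ge0//; last by rewrite ltW// rho_gt0.
    by case/andP: l01.
  by move: h; rewrite mulrAC ler_pdivrMr// [_ * rho x]mulrC.
apply/ler_addgt0Pr => e e0.
pose r := Num.min (x0 / 2) (e / rho x).
have r1 : 0 < r by rewrite lt_min !divr_gt0.
have r2 : r <= x0 / 2 by rewrite ge_min lexx.
have r3 : rho x * r <= e by rewrite mulrC -ler_pdivlMr// ge_min lexx orbT.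
have := key r r1 (_ : _); rewrite !mulrBr => h; have {}h := h ltac:(lra).
have : 0 <= rho x0 * r by rewrite mulr_ge0// ltW.
lra.
Qed.

Let dy (k : nat) : R := 2^-1 ^+ k.

Let dy_gt0 k : 0 < dy k.
Proof. by rewrite exprn_gt0// invr_gt0. Qed.

Let dyS k : dy k = 2 * dy k.+1.
Proof. by rewrite /dy exprS mulrA divff ?mul1r. Qed.

Let dy_le j k : (j <= k)%N -> dy k <= dy j.
Proof. by move=> jk; apply: ler_wiXn2l => //; rewrite ?invr_ge0// invf_le1// ler1n. Qed.

Let dy_small e : 0 < e -> exists k, dy k < e.
Proof.
move=> e0; exists (Num.bound e^-1); rewrite /dy exprVn.
rewrite invf_plt ?posrE ?exprn_gt0//.
apply: (lt_trans (archi_boundP (ltW _))); first by rewrite invr_gt0.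
by rewrite -natrX ltr_nat ltn_expl.
Qed.

Let dyadic_cover : \bigcup_k [set` `]dy k.+1, dy k]] = [set` `]0%R, 1%R]].
Proof.
apply/seteqP; split=> x /=.
  move=> [k _] /=; rewrite !in_itv/= => /andP[h1 h2].
  rewrite (lt_trans (dy_gt0 _) h1)/=; apply: (le_trans h2).
  by have := dy_le (leq0n k); rewrite {2}/dy expr0.
rewrite in_itv/= => /andP[x0 x1].
have ex : exists k, dy k.+1 < x.
  have [k hk] := dy_small x0; exists k; apply: le_lt_trans hk; exact: dy_le.
exists (ex_minn ex) => //=; rewrite in_itv/=; case: ex_minnP => -[|k] -> hmin //=.
rewrite leNgt; apply/negP => /hmin; by rewrite ltnn.
Qed.

Let dyadic_disjoint : trivIset setT (fun k => [set` `]dy k.+1, dy k]]).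
Proof.
move=> i j _ _ [x [/=]]; rewrite !in_itv/= => /andP[h1 h2] /andP[h3 h4].
have [ij|ji|//] := ltngtP i j.
- by have := lt_le_trans h1 (le_trans h4 (dy_le ij)); rewrite ltxx.
- by have := lt_le_trans h3 (le_trans h2 (dy_le ji)); rewrite ltxx.
Qed.

Let measurable_rhoV (A : set R) : measurable A -> A `<=` [set x | 0 < x] ->
  measurable_fun A (EFin \o (fun r => (rho r)^-1)).
Proof.
move=> mA A0; apply/measurable_EFinP.
have sA : A `<=` [set` `]0, +oo[] by move=> x /A0 /= x0; rewrite in_itv/= x0.
apply: (measurable_funS _ sA); first exact: measurable_itv.
apply: open_continuous_measurable_fun; first exact: interval_open.
move=> x; rewrite inE/= in_itv/= andbT => x0.
by apply: cvgV; [rewrite gt_eqF// rho_gt0|exact: rho_cont].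
Qed.

(** On ]2^-(k+1), 2^-k] the function 1 / rho is at most its value at the left end, and the interval
    has length 2^-(k+1); the integral over ]0, 1] is thus at most the sum of the terms of index k +
    1. *)
Let dyadic_series_unbounded B : exists m, B < \sum_(k < m) dy k / rho (dy k).
Proof.
apply/not_existsP => hB; pose f (r : R) := ((rho r)^-1)%:E.
have bnd m : \sum_(k < m) dy k / rho (dy k) <= B by rewrite leNgt; apply/negP; exact: hB.
have f0 x : 0 < x -> (0 <= f x)%E by move=> x0; rewrite lee_fin invr_ge0 ltW// rho_gt0.
suff : (\int[@lebesgue_measure R]_(r in `]0%R, 1%R]) f r <= B%:E)%E by rewrite rho_int.
rewrite -dyadic_cover ge0_integral_bigcup//; last 2 first.
- rewrite dyadic_cover; apply: measurable_rhoV => // x /=.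
  by rewrite in_itv/= => /andP[].
- by move=> x; rewrite dyadic_cover/= in_itv/= => /andP[/f0].
have piece k : (\int[@lebesgue_measure R]_(r in `]dy k.+1, dy k]) f r <=
    (dy k.+1 / rho (dy k.+1))%:E)%E.
  apply: (@le_trans _ _ (\int[@lebesgue_measure R]_(r in `]dy k.+1, dy k])
      (cst ((rho (dy k.+1))^-1)%:E r))%E).
    apply: ge0_le_integral => //=.
    - by move=> x; rewrite in_itv/= => /andP[h _]; apply: f0; exact: lt_trans h.
    - apply: measurable_rhoV => // x /=; rewrite in_itv/= => /andP[h _].
      exact: lt_trans h.
    - move=> x; rewrite in_itv/= => /andP[h _]; rewrite lee_fin.
      rewrite lef_pV2 ?posrE ?rho_gt0//; last exact: lt_trans h.
      by apply: rho_incr => //; exact: ltW.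
  rewrite integral_cst//= lebesgue_measure_itv/= lte_fin.
  case: ifP => _; last by rewrite mule0 lee_fin divr_ge0// ltW// rho_gt0.
  rewrite -EFinB -EFinM lee_fin mulrC; have dk := dyS k.
  by apply: ler_wpM2r; [rewrite invr_ge0 ltW// rho_gt0|lra].
apply: lime_le.
  apply: is_cvg_nneseries => k _ _; apply: integral_ge0 => x /=.
  by rewrite in_itv/= => /andP[h _]; apply: f0; exact: lt_trans h.
apply: nearW => m; apply: (@le_trans _ _ (\sum_(0 <= k < m) (dy k.+1 / rho (dy k.+1))%:E)%E).
  by apply: lee_sum => k _; exact: piece.
rewrite sumEFin lee_fin big_mkord; apply: le_trans (bnd m.+1).
by rewrite big_ord_recl/= lerDr divr_ge0// ltW// rho_gt0.
Qed.

(* v needs a time of at least 2^-(k+1) / (K rho(2^-k)) to decrease from 2^-k to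
   2^-(k+1), and these times add up to +oo. *)
Lemma osgood (T K eta : R) : 0 <= T -> 0 <= K -> 0 < eta ->
  exists2 eps, 0 < eps & forall v : R -> R,
    (forall s, 0 <= s <= T -> 0 < v s) ->
    (forall s t, 0 <= s -> s <= t -> t <= T ->
       0 <= v s - v t /\ v s - v t <= K * rho (v s) * (t - s)) ->
    v T <= eps -> v 0 <= eta.
Proof.
move=> T0 K0 eta0; have [k0 hk0] := dy_small eta0.
(* The levels k0 <= k < m0 alone sum to more than 2 K T, so v cannot pass through all of them within
   time T. *)
have [m0 hm0] := dyadic_series_unbounded (2 * (K * T) + \sum_(k < k0) dy k / rho (dy k)).
have term_ge0 k : 0 <= dy k / rho (dy k) by rewrite divr_ge0// ltW// rho_gt0.
have k0m : (k0 <= m0)%N.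
  rewrite leqNgt; apply/negP => mk; have : \sum_(k < m0) dy k / rho (dy k) <=
      \sum_(k < k0) dy k / rho (dy k).
    rewrite -!(big_mkord xpredT (fun k => dy k / rho (dy k))).
    rewrite [leRHS](big_cat_nat (leq0n m0) (ltnW mk))/= lerDl.
    by apply: sumr_ge0 => k _; exact: term_ge0.
  have : 0 <= K * T by rewrite mulr_ge0.
  lra.
exists (dy m0) => // v v0 hv vT; rewrite leNgt; apply/negP => v0eta.
have vle s t : 0 <= s -> s <= t -> t <= T -> v t <= v s.
  by move=> s0 st tT; have [h _] := hv s t s0 st tT; lra.
have rv0 : 0 < rho (v 0) by apply/rho_gt0/v0; rewrite lexx.
(* v is controlled on [0, T] only; composed with the clamp it becomes a continuous function on the
   line, to which the intermediate value theorem applies. *)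
pose clamp x : R := Num.max 0 (Num.min T x).
have clampT x : 0 <= clamp x <= T.
  by rewrite /clamp le_max lexx/= ge_max T0 ge_min lexx.
have cl_le x y : x <= y -> 0 <= clamp y - clamp x <= y - x.
  exact: clamp_increment.
pose u x := v (clamp x).
have u_lip x y : x <= y -> 0 <= u x - u y <= K * rho (v 0) * (y - x).
  move=> xy; have /andP[c1 c2] := cl_le x y xy; rewrite subr_ge0 in c1.
  have /andP[x0 xT] := clampT x; have /andP[y0 yT] := clampT y.
  have [h1 h2] := hv _ _ x0 c1 yT; rewrite /u h1/=; apply: (le_trans h2).
  apply: ler_pM => //; [by rewrite mulr_ge0// ltW// rho_gt0// v0// x0|lra|].
  rewrite ler_wpM2l//; apply: rho_incr; first by apply: v0; rewrite x0.
  exact: vle.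
pose Lc := K * rho (v 0) + 1.
have Lc0 : 0 < Lc by have := mulr_ge0 K0 (ltW rv0); rewrite /Lc; lra.
have u_cont : continuous u.
  move=> x; apply/cvgrPdist_le => e e0; near=> y.
  have : `|x - y| <= e / Lc by near: y; apply: cvgr_dist_le => //; exact: divr_gt0.
  rewrite ler_pdivlMr// => h; apply: le_trans h.
  have [xy|/ltW yx] := leP x y.
    have /andP[h1 h2] := u_lip _ _ xy; rewrite ger0_norm// distrC ger0_norm ?subr_ge0//.
    by apply: (le_trans h2); rewrite mulrC ler_wpM2l ?subr_ge0// /Lc; lra.
  have /andP[h1 h2] := u_lip _ _ yx; rewrite distrC ger0_norm// ger0_norm ?subr_ge0//.
  by apply: (le_trans h2); rewrite mulrC ler_wpM2l ?subr_ge0// /Lc; lra.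
have uE x : 0 <= x <= T -> u x = v x.
  by move=> /andP[x0 xT]; rewrite /u /clamp (min_idPr xT) (max_idPr x0).
have level k : (k0 <= k <= m0)%N -> exists t, 0 <= t <= T /\ v t = dy k.
  move=> /andP[k1 k2].
  have [||t tT ut] := @IVT R u 0 T (dy k) T0.
  - exact: continuous_subspaceT.
  - rewrite !uE ?lexx ?T0// ge_min le_max; apply/andP; split; apply/orP.
      by right; exact: le_trans vT (dy_le k2).
    by left; apply: (le_trans (dy_le k1)); apply: ltW; exact: lt_trans v0eta.
  - rewrite in_itv/= in tT; exists t; split=> //; by rewrite -uE.
have [tau htau] := @choice _ _ (fun k t => (k0 <= k <= m0)%N -> 0 <= t <= T /\ v t = dy k)
  (fun k => match boolP (k0 <= k <= m0)%N with
   | AltTrue h => let: ex_intro t ht := level k h in ex_intro _ t (fun=> ht)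
   | AltFalse h => ex_intro _ 0 (fun h' => False_ind _ (negP h h'))
   end).
(* Between these two times v drops by half of [dy k], whence the factor 2. *)
have step k : (k0 <= k < m0)%N -> dy k / rho (dy k) <= 2 * K * (tau k.+1 - tau k).
  move=> /andP[k1 k2].
  have [/andP[a0 aT] va] := htau k ltac:(by rewrite k1 ltnW).
  have [/andP[b0 bT] vb] := htau k.+1 ltac:(by rewrite leqW).
  have tt : tau k <= tau k.+1.
    rewrite leNgt; apply/negP => /ltW tt; have := vle _ _ b0 tt aT; rewrite va vb.
    by have := dyS k; have := dy_gt0 k.+1; lra.
  have [_] := hv _ _ a0 tt bT; rewrite va vb => h.
  by rewrite ler_pdivrMr ?rho_gt0//; have := dyS k; lra.
have sumb j : (k0 + j <= m0)%N -> \sum_(k0 <= k < k0 + j) dy k / rho (dy k) <=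
    2 * K * (tau (k0 + j)%N - tau k0).
  elim: j => [|j IH] hj; first by rewrite addn0 big_geq// subrr mulr0.
  rewrite addnS big_nat_recr/= ?leq_addr//.
  rewrite addnS in hj; have := IH (ltnW hj); have := step (k0 + j)%N; rewrite leq_addr/= => /(_ hj).
  by move: (\sum_(_ <= _ < _) _) => S' *; lra.
have := sumb (m0 - k0)%N; rewrite subnKC// => /(_ (leqnn _)).
have [/andP[a0 aT] _] := htau k0 ltac:(by rewrite leqnn).
have [/andP[b0 bT] _] := htau m0 ltac:(by rewrite leqnn k0m).
have : 2 * K * (tau m0 - tau k0) <= 2 * K * T by rewrite ler_wpM2l// ?mulr_ge0//; lra.
move: hm0; rewrite -!(big_mkord xpredT (fun k => dy k / rho (dy k))).
rewrite (big_cat_nat (leq0n k0) k0m)/=; move: (\sum_(_ <= _ < _) _) (\sum_(_ <= _ < _) _) => *; lra.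
Unshelve. all: by end_near. Qed.

End osgood.

(** * Osgood's lemma for upper integrals *)

Section integral_inequality.
Context {R : realType} (rho : R -> R).
Hypothesis rho0 : rho 0 = 0.
Hypothesis rho_gt0 : forall r, 0 < r -> 0 < rho r.
Hypothesis rho_cont : forall r, 0 < r -> {for r, continuous rho}.
Hypothesis rho_incr : forall r s, 0 < r -> r <= s -> rho r <= rho s.
Hypothesis rho_int : (\int[@lebesgue_measure R]_(r in `]0%R, 1%R]) ((rho r)^-1)%:E
              = +oo)%E.

(** The infimum V t of the bounds for H on [t, T] replaces the integral. It is nonincreasing, and u
    <= v for v an affine function of V; on [s, t) this gives H <= M rho (v s), which is Osgood's
    increment inequality for v. *)
Lemma osgood_integral (T c M eta : R) : 0 <= T -> 0 <= c -> 0 <= M -> 0 < eta ->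
  exists2 eps, 0 < eps & forall (u H : R -> R) (e : R), 0 <= e -> e <= eps ->
    (forall s, 0 <= s <= T -> 0 <= H s) -> (exists y, dominated T H y) ->
    (forall t y, 0 <= t <= T ->
       dominated T (fun s => if t <= s then H s else 0) y -> u t <= e + c * y) ->
    (forall s x, 0 <= s <= T -> 0 < x -> u s <= x -> H s <= M * rho x) ->
    forall t, 0 <= t <= T -> u t <= eta.
Proof.
move=> T0 c0 M0 eta0.
have [eps eps0 hosg] := osgood rho_gt0 rho_cont rho_incr rho_int T0 (mulr_ge0 c0 M0) eta0.
have eps2 : 0 < eps / 2 by rewrite divr_gt0.
exists (eps / 2) => // u H e e0 e_eps H0 [y0 hy0] hu hH.
pose D t : set R := [set y | dominated T (fun s => if t <= s then H s else 0) y].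
have D0 t : D t y0.
  by apply: dominated_le (lexx _) hy0 => s sT; case: ifP => // _; exact: H0.
have Dinf t : has_inf (D t).
  by split; [exists y0; exact: D0|exists 0 => y; exact: dominated_ge0].
pose V t := inf (D t).
have V_ge0 t : 0 <= V t.
  by apply: lb_le_inf; [exists y0; exact: D0|move=> y; exact: dominated_ge0].
have V_le t y : D t y -> V t <= y by apply: ge_inf; case: (Dinf t).
(* The summand eps / 2 keeps v positive when e and V vanish; as e <= eps / 2 and V T = 0, still v T
   <= eps. *)
pose v t := e + eps / 2 + c * V t.
have v_gt0 t : 0 < v t.
  by have := mulr_ge0 c0 (V_ge0 t); rewrite /v; lra.
have V_mono s t : s <= t -> V t <= V s.
  move=> st; apply: lb_le_inf; first by exists y0; exact: D0.
  move=> y hy; apply: V_le; apply: dominated_le (lexx _) hy => x xT.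
  case: ifP => [tx|_]; first by rewrite (le_trans st tx).
  by case: ifP => // _; exact: H0.
have u_le_v t : 0 <= t <= T -> u t <= v t.
  move=> tT; apply/ler_addgt0Pr => r r0; have c1 : 0 < c + 1 by lra.
  have [y hy yV] := inf_adherent (divr_gt0 r0 c1) (Dinf t).
  apply: (le_trans (hu t y tT hy)); rewrite -/(V t) in yV.
  have : c * y <= c * V t + r.
    apply: (le_trans (ler_wpM2l c0 (ltW yV))); rewrite mulrDr lerD2l mulrA.
    by rewrite ler_pdivrMr//; nra.
  by rewrite /v; lra.
have v_step s t : 0 <= s -> s <= t -> t <= T -> v s - v t <= c * M * rho (v s) * (t - s).
  move=> s0 st tT.
  (* A majorant on [t, T] plus a step of height M rho (v s) on [s, t) is a majorant on [s, T]. *)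
  suff hV : V s <= V t + M * rho (v s) * (t - s).
    have := ler_wpM2l c0 hV; rewrite /v mulrDr !mulrA; lra.
  rewrite -lerBlDr; apply: lb_le_inf; first by exists y0; exact: D0.
  move=> y hy; rewrite lerBlDr; apply: V_le.
  have rv0 : 0 <= M * rho (v s) by rewrite mulr_ge0// ltW// rho_gt0.
  apply: dominated_le (lexx _) (dominated_add hy (dominated_step T rv0 st)) => x xT.
  have Hx := H0 x xT; case: (leP s x) => sx /=; last first.
    by rewrite addr0; case: ifP.
  case: (leP t x) => tx; first by rewrite addr0.
  rewrite add0r; apply: hH => //; apply: (le_trans (u_le_v x xT)).
  by rewrite /v lerD2l ler_wpM2l// V_mono.
(* Only the single time T is left, and a step of height H T and arbitrarily small width covers
   it. *)
have VT : V T <= 0.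
  apply/ler_addgt0Pr => r r0; rewrite add0r; apply: V_le.
  have HT : 0 <= H T by apply: H0; rewrite T0 lexx.
  have H1 : 0 < H T + 1 by lra.
  have rH : 0 < r / (H T + 1) by rewrite divr_gt0.
  have Tr : T <= T + r / (H T + 1) by rewrite lerDl ltW.
  have hr : H T * (T + r / (H T + 1) - T) <= r.
    by rewrite [T + _]addrC addrK mulrA ler_pdivrMr//; nra.
  apply: dominated_le hr (dominated_step T HT Tr) => x /andP[_ xT].
  case: (leP T x) => //= Tx; have -> : x = T by apply/eqP; rewrite eq_le xT.
  by rewrite ltrDl rH.
move=> t /andP[t0 tT]; apply: (le_trans (u_le_v t _)); first by rewrite t0.
apply: (@le_trans _ _ (v 0)); first by rewrite /v lerD2l ler_wpM2l// V_mono.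
apply: hosg => [s _|s s' s0 ss s'T|]; [exact: v_gt0|split; last exact: v_step|].
  by rewrite subr_ge0 /v lerD2l ler_wpM2l// V_mono.
by have := ler_wpM2l c0 VT; rewrite mulr0 /v; lra.
Qed.

End integral_inequality.

(** * Stability of solutions *)

Section estimates.
Context {R : realType} {d : nat} (G : Gexpectation R d).
Local Notation Omega := (path_space R d).
Local Notation E := (Ehat G).

Lemma LGdist_le_norms n (X Y : LGseq R d n) : LG1 G Lip X -> LG1 G Lip Y ->
  LGdist G X Y <= LGnorm G X + LGnorm G Y.
Proof.
move=> hX hY; apply: LGnorm_le_add => //; first exact: LG1_sub.
by move=> k w; exact: enorm_sub.
Qed.

Lemma LGle_le (U U' V : nat -> Omega -> R) :
  (forall k, Lip (U k)) -> (forall k, Lip (U' k)) -> (forall k, Lip (V k)) ->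
  (forall k w, U' k w <= U k w) -> LGle G U V -> LGle G U' V.
Proof.
move=> lU lU' lV UU /ule_cvg0 h; apply: cvg0_ule => [k|].
  have ? := lU' k; have ? := lV k.
  by apply: E_ge0 => [|w]; [lip|rewrite le_max lexx].
apply: (ule_le h) => k; have ? := lU k; have ? := lU' k; have ? := lV k.
apply: E_le; [lip|lip|move=> w].
by rewrite ge_max !le_max lexx/= lerD2r UU orbT.
Qed.

Lemma LGdist_sum n (z z0 I I0 : LGseq R d n) (J J0 : 'I_d -> 'I_d -> LGseq R d n) :
  LG1 G Lip z -> LG1 G Lip z0 -> LG1 G Lip I -> LG1 G Lip I0 ->
  (forall i j, LG1 G Lip (J i j)) -> (forall i j, LG1 G Lip (J0 i j)) ->
  [/\ LG1 G Lip (fun k w => z k w + I k w + \sum_i \sum_j J i j k w),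
      LG1 G Lip (fun k w => z0 k w + I0 k w + \sum_i \sum_j J0 i j k w) &
      LGdist G (fun k w => z k w + I k w + \sum_i \sum_j J i j k w)
               (fun k w => z0 k w + I0 k w + \sum_i \sum_j J0 i j k w) <=
      LGdist G z z0 + LGdist G I I0 + \sum_i \sum_j LGdist G (J i j) (J0 i j)].
Proof.
move=> hz hz0 hI hI0 hJ hJ0.
have hS (K : 'I_d -> 'I_d -> LGseq R d n) : (forall i j, LG1 G Lip (K i j)) ->
    LG1 G Lip (fun k w => \sum_i \sum_j K i j k w).
  move=> hK; apply: (LG1_sum (X := fun i k w => \sum_j K i j k w)) => i _ _.
  by apply: (LG1_sum (X := fun j => K i j)).
have h1 := LG1_add (LG1_add hz hI) (hS _ hJ).
have h2 := LG1_add (LG1_add hz0 hI0) (hS _ hJ0).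
split=> //; apply: LGdist_ule => //.
have hu := @ule_sum _ _ (index_enum 'I_d) xpredT _ _ (fun i _ =>
  @ule_sum _ _ (index_enum 'I_d) xpredT _ _ (fun j _ => ule_LGdist (hJ i j) (hJ0 i j))).
apply: (ule_le (ule_add (ule_add (ule_LGdist hz hz0) (ule_LGdist hI hI0)) hu)) => k.
have ? := LG1_Lipv k hz; have ? := LG1_Lipv k hz0.
have ? := LG1_Lipv k hI; have ? := LG1_Lipv k hI0.
have lJ i j := LG1_Lipv k (hJ i j); have lJ0 i j := LG1_Lipv k (hJ0 i j).
have lS : Lip (fun w => \sum_i \sum_j enorm (J i j k w - J0 i j k w)) by lip.
have lX := LG1_Lipv k h1; have lX0 := LG1_Lipv k h2.
apply: (@le_trans _ _ (E (fun w => enorm (z k w - z0 k w)) + E (fun w => enorm (I k w - I0 k w)) +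
   E (fun w => \sum_i \sum_j enorm (J i j k w - J0 i j k w)))).
  apply: E_leD3; [lip|lip|lip|lip|move=> w].
  have -> : z k w + I k w + \sum_i \sum_j J i j k w -
      (z0 k w + I0 k w + \sum_i \sum_j J0 i j k w) =
      (z k w - z0 k w) + (I k w - I0 k w) + \sum_i \sum_j (J i j k w - J0 i j k w).
    have -> : \sum_i \sum_j (J i j k w - J0 i j k w) =
        \sum_i \sum_j J i j k w - \sum_i \sum_j J0 i j k w.
      by rewrite -sumrB; apply: eq_bigr => i _; rewrite sumrB.
    by rewrite !opprD addrACA; congr (_ + _); rewrite addrACA.
  apply: (le_trans (enorm_add _ _)); apply: lerD; first exact: enorm_add.
  apply: (le_trans (enorm_sum _ _ _)); apply: ler_sum => i _; exact: enorm_sum.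
rewrite lerD2l; apply: (le_trans (E_sum _ _)); first by move=> i _ _; lip.
by apply: ler_sum => i _; apply: E_sum => j _ _; lip.
Qed.

End estimates.

Theorem theorem4p1 (R : realType) (d n : nat) (hd : (0 < d)%N) (hn : (0 < n)%N)
  (G : Gexpectation R d)
  (QV : 'I_d -> 'I_d -> R -> LGseq R d 1)
  (hQV : forall i j (t : R), 0 <= t -> is_qv G i j t (QV i j t))
  (T : R) (hT : 0 < T)
  (zeta : R -> LGseq R d n)
  (hzeta : forall delta, 0 <= delta -> LG1 G (Lip_upto T) (zeta delta))
  (f : R -> R -> 'rV[R]_n -> LGseq R d n)
  (hf : forall delta, 0 <= delta -> forall y, MG1 G T (fun t => f delta t y))
  (g : R -> 'I_d -> 'I_d -> R -> 'rV[R]_n -> LGseq R d n)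
  (hg : forall delta, 0 <= delta -> forall i j y,
    MG1 G T (fun t => g delta i j t y))
  (C : R) (hC : 0 < C)
  (beta : R -> LGseq R d 1)
  (hbeta : MG1 G T beta)
  (beta_ge0 : forall t, 0 <= t <= T ->
    LGle G (fun _ _ => 0) (fun k w => beta t k w 0 0))
  (rho : R -> R)
  (rho0 : rho 0 = 0)
  (rho_gt0 : forall r, 0 < r -> 0 < rho r)
  (rho_cont : forall r, 0 < r -> {for r, continuous rho})
  (rho_incr : forall r s, 0 < r -> r <= s -> rho r <= rho s)
  (rho_concave : forall r s l, 0 < r -> 0 < s -> 0 <= l <= 1 ->
    l * rho r + (1 - l) * rho s <= rho (l * r + (1 - l) * s))
  (rho_cvg0 : rho r @[r --> 0^'+] --> 0)
  (rho_int : (\int[@lebesgue_measure R]_(r in `]0%R, 1%R]) ((rho r)^-1)%:E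
              = +oo)%E)
  (growth : forall delta t y, 0 <= delta -> 0 <= t <= T ->
    LGle G
      (fun k w => enorm (f delta t y k w)
                  + \sum_i \sum_j enorm (g delta i j t y k w))
      (fun k w => beta t k w 0 0 + C * enorm y))
  (modulus : forall delta t y1 y2, 0 <= delta -> 0 <= t <= T ->
    LGle G
      (fun k w => enorm (f delta t y1 k w - f delta t y2 k w)
                  + \sum_i \sum_j enorm (g delta i j t y1 k w
                                         - g delta i j t y2 k w))
      (fun _ _ => rho (enorm (y1 - y2))))
  (Y : R -> R -> LGseq R d n)
  (hY : forall delta, 0 <= delta ->
    is_solution G QV T (zeta delta) (f delta) (g delta) (Y delta))
  (zeta_cvg : LGdist G (zeta delta) (zeta 0) @[delta --> 0^'+] --> 0)
  (f_cvg : coef_cvg G T f (Y 0))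
  (g_cvg : forall i j, coef_cvg G T (fun delta => g delta i j) (Y 0)) :
  forall t, 0 <= t <= T ->
    LGdist G (Y delta t) (Y 0 t) @[delta --> 0^'+] --> 0.

Proof.
have T0 : 0 <= T by exact: ltW.
(* [None] stands for f and [Some (i, j)] for g_ij, so that all coefficients are treated alike. *)
pose idx : finType := option ('I_d * 'I_d)%type.
pose phi delta (o : idx) : R -> 'rV[R]_n -> LGseq R d n :=
  if o is Some (i, j) then g delta i j else f delta.
pose a (o : idx) : R := if o is Some (i, j) then qmom G i j else 1.
(* The integral in ds contributes the constant 1, the one in d<B^i,B^j> the moment [qmom G i j]. *)
pose A : R := 1 + \sum_i \sum_j qmom G i j.
have A0 : 0 <= A.
  apply: addr_ge0 => //; apply: sumr_ge0 => i _; apply: sumr_ge0 => j _.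
  exact: qmom_ge0.
have phi_LG1 delta o s y : 0 <= delta -> 0 <= s <= T -> LG1 G Lip (phi delta o s y).
  move=> d0 sT; case: o => [[i j]|] /=.
  - by have := MG1_LG1 (hg delta d0 i j y) sT.
  - by have := MG1_LG1 (hf delta d0 y) sT.
have phi_modulus delta o s : 0 <= delta -> 0 <= s <= T -> forall y1 y2,
    LGle G (fun k w => enorm (phi delta o s y1 k w - phi delta o s y2 k w))
           (fun _ _ => rho (enorm (y1 - y2))).
  move=> d0 sT y1 y2; apply: (LGle_le _ _ _ _ (modulus delta s y1 y2 d0 sT)).
  - move=> k; have lf y := LG1_Lipv k (phi_LG1 delta None s y d0 sT).
    have lg i j y := LG1_Lipv k (phi_LG1 delta (Some (i, j)) s y d0 sT).
    rewrite /= in lf lg; lip.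
  - by move=> k; have lf y := LG1_Lipv k (phi_LG1 delta o s y d0 sT); lip.
  - by move=> k; lip.
  - have g0 i k w : 0 <= \sum_j enorm (g delta i j s y1 k w - g delta i j s y2 k w).
      by apply: sumr_ge0 => j _; exact: enorm_ge0.
    move=> k w; case: o => [[i j]|] /=; last by rewrite lerDl sumr_ge0.
    rewrite (bigD1 i)//= (bigD1 j)//= -[X in _ <= _ + X]addrA [leRHS]addrCA lerDl.
    apply: addr_ge0; first exact: enorm_ge0.
    apply: addr_ge0.
      by apply: sumr_ge0 => j' _; exact: enorm_ge0.
    by apply: sumr_ge0.
(* The convergence at time 0 controls the integrals over all [t, T] at once. *)
have [Phi [hPhi cPhi]] : exists Phi : idx -> R -> R -> LGseq R d n,
    (forall o delta, 0 <= delta -> is_subst G T (phi delta o) (Y 0) (Phi o delta)) /\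
    (forall o, upper_int `[0, T] (fun s => LGdist G (Phi o delta s) (Phi o 0 s))
      @[delta --> 0^'+] --> 0%E).
  have T00 : 0 <= (0 : R) <= T by rewrite lexx.
  have [Pf [hPf cPf]] := f_cvg.
  have [Pg hPg] := choice (fun ij : 'I_d * 'I_d => g_cvg ij.1 ij.2).
  exists (fun o => if o is Some ij then Pg ij else Pf); split.
  - case=> [[i j]|] delta d0; last exact: hPf.
    by have [h _] := hPg (i, j); exact: h.
  - by case=> [ij|]; [case: (hPg ij) => _ /(_ 0 T00)|exact: (cPf 0 T00)].
have sol delta : 0 <= delta -> exists F : idx -> R -> LGseq R d n,
    (forall o, is_subst G T (phi delta o) (Y delta) (F o)) /\
    forall t, 0 <= t <= T -> exists (I : LGseq R d n) (J : 'I_d -> 'I_d -> LGseq R d n),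
       [/\ is_int G T (F None) t I,
           forall i j, is_int_qv G (QV i j) T (F (Some (i, j))) t (J i j) &
          is_cexp G t
            (fun k w => zeta delta k w + I k w + \sum_i \sum_j J i j k w) (Y delta t)].
  move=> d0; have [_ [F [K [hF hK heq]]]] := hY delta d0.
  exists (fun o => if o is Some (i, j) then K i j else F); split; last exact: heq.
  by case=> [[i j]|]; [exact: hK|exact: hF].
have [F0 [hF0 eq0]] := sol 0 (lexx 0).
have Y_LG1 delta s : 0 <= delta -> 0 <= s <= T -> LG1 G Lip (Y delta s).
  by move=> d0; apply: MG1_LG1; case: (hY delta d0).
have F0_LG1 o s : 0 <= s <= T -> LG1 G Lip (F0 o s) by apply: MG1_LG1; case: (hF0 o).
move=> t tT; apply/cvgrPdist_le => eta eta0.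
(* One factor 2 from [eval_modulus] for each coefficient. *)
pose N : R := #|idx|%:R * 2.
have N0 : 0 <= N by rewrite mulr_ge0.
have c0 : 0 <= n%:R * A by rewrite mulr_ge0.
have [eps eps0 hosg] :=
  osgood_integral rho_gt0 rho_cont rho_incr rho_int T0 c0 N0 eta0.
(* The free term of the integral inequality will be n (z + A e') with the terminal error z below e';
   this choice keeps it below eps, and the summand 1 keeps the denominator positive. *)
pose e' := eps / (n%:R * (1 + A) + 1).
have den0 : 0 < n%:R * (1 + A) + 1.
  by rewrite ltr_wpDl// mulr_ge0// addr_ge0.
have e'0 : 0 < e' by rewrite divr_gt0.
have small : n%:R * (1 + A) * e' <= eps.
  by rewrite /e' mulrA ler_pdivrMr// mulrC ler_pM2l// lerDl.
have near_Phi : \forall delta \near 0^'+, forall o,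
    dominated T (fun s => LGdist G (Phi o delta s) (Phi o 0 s)) e'.
  apply: filter_forall => o; apply: (filterS _ (cvge0_lt _ (cPhi o) e'0)) => delta.
  exact: dominated_upper_int.
have near_zeta : \forall delta \near 0^'+, LGdist G (zeta delta) (zeta 0) < e'.
  exact: (cvgr_lt _ zeta_cvg _ e'0).
have near_pos : \forall delta \near (0 : R)^'+, 0 < delta by exact: nbhs_right_gt.
apply: (filterS _ (filterI near_Phi (filterI near_zeta near_pos))) => delta /=.
move=> [dPhi [dzeta /ltW d0]].
have [F [hF eqd]] := sol delta d0.
have F_LG1 o s : 0 <= s <= T -> LG1 G Lip (F o s) by apply: MG1_LG1; case: (hF o).
have Phi_LG1 o s : 0 <= s <= T -> LG1 G Lip (Phi o delta s).
  by apply: MG1_LG1; case: (hPhi o delta d0).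
have Phi0_LG1 o s : 0 <= s <= T -> LG1 G Lip (Phi o 0 s).
  by apply: MG1_LG1; case: (hPhi o 0 (lexx 0)).
have zeta_LG1 del : 0 <= del -> LG1 G Lip (zeta del) by move=> /hzeta/LG1_upto.
rewrite sub0r normrN ger0_norm; last by apply: LGdist_ge0; exact: Y_LG1.
(* The effect of replacing Y^0 by Y^delta inside phi^delta, summed over the coefficients so that one
   function serves all the integrals. *)
pose H s := \sum_o LGdist G (F o s) (Phi o delta s).
(* The convergence hypothesis and the equation for Y^0 each provide their own version of phi^0(s,
   Y^0_s); uniqueness of the substitution identifies them. *)
have Phi0_F0 o s : 0 <= s <= T -> LGdist G (Phi o 0 s) (F0 o s) = 0.
  move=> sT; have [_ /(_ s sT) h1] := hPhi o 0 (lexx 0); have [_ /(_ s sT) h2] := hF0 o.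
  apply: is_eval_unique h1 h2; last exact: Y_LG1.
  by move=> y; exact: phi_LG1.
pose z := LGdist G (zeta delta) (zeta 0).
have z0 : 0 <= z by apply: LGdist_ge0; exact: zeta_LG1.
have H_ge o s : 0 <= s <= T -> LGdist G (F o s) (Phi o delta s) <= H s.
  move=> sT; rewrite /H (bigD1 o)//= lerDl; apply: sumr_ge0 => o' _.
  by apply: LGdist_ge0; [exact: F_LG1|exact: Phi_LG1].
apply: (hosg (fun s => LGdist G (Y delta s) (Y 0 s)) H (n%:R * (z + A * e'))) => //.
- by rewrite mulr_ge0// addr_ge0// mulr_ge0// ltW.
- apply: le_trans small; rewrite -[leRHS]mulrA; apply: ler_wpM2l => //.
  have -> : (1 + A) * e' = e' + A * e' by ring.
  by apply: lerD => //; exact: ltW.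
- move=> s sT; apply: sumr_ge0 => o _.
  by apply: LGdist_ge0; [exact: F_LG1|exact: Phi_LG1].
- have hy o : exists y, dominated T (fun s => LGdist G (F o s) (Phi o delta s)) y.
    have [y1 h1] := MG1_dominated T0 (proj1 (hF o)).
    have [y2 h2] := MG1_dominated T0 (proj1 (hPhi o delta d0)).
    exists (y1 + y2); apply: dominated_le (lexx _) (dominated_add h1 h2) => s sT.
    by apply: LGdist_le_norms; [exact: F_LG1|exact: Phi_LG1].
  have [y hyy] := choice hy; exists (\sum_o y o).
  by apply: dominated_sum => o _; exact: hyy.
- move=> s y sT hdom; have /andP[s0 sT'] := sT.
  (* F - F0 is split at Phi^delta and Phi^0: H accounts for the first difference, e' for the second,
     and the third vanishes. *)
  have dom o : dominated T
      (fun x => if s <= x then LGdist G (F o x) (F0 o x) else 0) (y + e').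
    apply: dominated_le (lexx _) (dominated_add hdom (dPhi o)) => x xT.
    have h1 := F_LG1 o x xT; have h2 := Phi_LG1 o x xT.
    have h3 := Phi0_LG1 o x xT; have h4 := F0_LG1 o x xT.
    case: ifP => _; last by rewrite add0r; exact: LGdist_ge0.
    apply: (le_trans (LGdist_triangle h1 h2 h4)); apply: lerD; first exact: H_ge.
    apply: (le_trans (LGdist_triangle h2 h3 h4)).
    by rewrite (Phi0_F0 o x xT) addr0.
  have [I [J [hI hJ cY]]] := eqd s sT; have [I0 [J0 [hI0 hJ0 cY0]]] := eq0 s sT.
  have hI1 : LG1 G Lip I by case: hI => /LG1_upto.
  have hI01 : LG1 G Lip I0 by case: hI0 => /LG1_upto.
  have hJ1 i j : LG1 G Lip (J i j) by case: (hJ i j) => /LG1_upto.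
  have hJ01 i j : LG1 G Lip (J0 i j) by case: (hJ0 i j) => /LG1_upto.
  have [x1 x2 hX] := LGdist_sum (zeta_LG1 _ d0) (zeta_LG1 _ (lexx 0)) hI1 hI01 hJ1 hJ01.
  have yd := Y_LG1 delta s d0 sT; have yd0 := Y_LG1 0 s (lexx 0) sT.
  apply: (le_trans (cexp_dist x1 x2 yd yd0 cY cY0)).
  rewrite -mulrA -mulrDr ler_wpM2l//; apply: (le_trans hX).
  have -> : z + A * e' + A * y = z + (y + e') + \sum_i \sum_j qmom G i j * (y + e').
    rewrite /A; have -> : \sum_i \sum_j qmom G i j * (y + e') =
        (\sum_i \sum_j qmom G i j) * (y + e').
      by rewrite mulr_suml; apply: eq_bigr => i _; rewrite mulr_suml.
    ring.
  apply: lerD.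
    rewrite lerD2l.
    exact: (int_dist T0 (F_LG1 None) (F0_LG1 None) s0 sT' (dom None) hI hI0).
  apply: ler_sum => i _; apply: ler_sum => j _.
  exact: (int_qv_dist T0 (F_LG1 (Some (i, j))) (F0_LG1 (Some (i, j))) s0 sT'
    (dom (Some (i, j))) (hQV i j) (hJ i j) (hJ0 i j)).
- move=> s x sT x0 hx.
  rewrite /H /N -mulrA mulr_natl -sumr_const.
  apply: ler_sum => o _.
  (* The modulus estimate is used at threshold x with r0 = rho x, so each coefficient contributes at
     most 2 rho x. *)
  have [_ /(_ s sT) h1] := hF o; have [_ /(_ s sT) h2] := hPhi o delta d0.
  apply: (eval_modulus (fun y => phi_LG1 delta o s y d0 sT) (Y_LG1 delta s d0 sT)
    (Y_LG1 0 s (lexx 0) sT) h1 h2 (phi_modulus delta o s d0 sT) _ x0 _ hx).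
  + by rewrite ltW// rho_gt0.
  + by move=> r r0; exact: concave_le_affine.
Qed.
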